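(* Let $n\ge1$, let $\mathcal{Z}=\{z_1,\dots,z_m\}\subset\mathbb{D}^n$ be $m$ distinct points and let $w_1,\dots,w_m\in\mathbb{D}$. Let $\mathcal{Q}_{\mathcal{Z}}=\operatorname{span}\{\mathbb{S}(\cdot,z_i):i=1,\dots,m\}$ and $\mathcal{M}_{\mathcal{Q}_{\mathcal{Z}}}=\mathcal{Q}_{\mathcal{Z}}^{conj}+\mathcal{M}_n+H^2_0(\mathbb{T}^n)$, regarded as a subspace of $L^1(\mathbb{T}^n)$. Define $c=(c_1,\dots,c_m)^T$ by \[ c=\big(\mathbb{S}(z_j,z_i)\big)_{j,i=1}^m{}^{-1}\,(w_1,\dots,w_m)^T \] (the matrix whose $(j,i)$ entry is $\mathbb{S}(z_j,z_i)$), and set $\psi_{\mathcal{Z},\mathcal{W}}=\sum_{i=1}^m c_i\mathbb{S}(\cdot,z_i)$. Then there exists $\varphi\in\mathcal{S}(\mathbb{D}^n)$ with $\varphi(z_i)=w_i$ for all $i=1,\dots,m$ if and only if the functional $f\mapsto\int_{\mathbb{T}^n}\psi_{\mathcal{Z},\mathcal{W}}f\,d\mu$ is a contraction on $(\mathcal{M}_{\mathcal{Q}_{\mathcal{Z}}},\|\cdot\|_1)$.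
   Context: $\mu$ is normalized Lebesgue measure on $\mathbb{T}^n$, $\|\cdot\|_1$ the $L^1(\mathbb{T}^n,\mu)$ norm. $\mathbb{S}(z,w)=\prod_{i=1}^n(1-z_i\bar w_i)^{-1}$ is the Szegő kernel of $\mathbb{D}^n$, and $\mathbb{S}(\cdot,w)$ is the function $z\mapsto\mathbb{S}(z,w)$, an element of $H^2(\mathbb{T}^n)$ (the closed subspace of $L^2(\mathbb{T}^n)$ of functions with Fourier coefficients supported in $\mathbb{Z}_+^n$, identified with analytic functions on $\mathbb{D}^n$). $\mathcal{S}(\mathbb{D}^n)$ is the closed unit ball of $H^\infty(\mathbb{D}^n)$. $S^{conj}=\{\bar f:f\in S\}$; $H^2_0(\mathbb{T}^n)=\{f\in H^2:f(0)=0\}$; $\mathcal{M}_n=L^2(\mathbb{T}^n)\ominus(H^2(\mathbb{T}^n)^{conj}+H^2(\mathbb{T}^n))$. A functional $\Lambda$ is a contraction if $|\Lambda f|\le\|f\|_1$ for all $f$. *)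

(* Defs.v *)
From HB Require Import structures.
From mathcomp Require Import all_boot all_order all_algebra.
From mathcomp Require Import all_classical all_reals all_analysis.
From mathcomp Require Import complex.
Set Implicit Arguments. Unset Strict Implicit. Unset Printing Implicit Defensive.
Import Order.TTheory GRing.Theory Num.Theory.
Local Open Scope classical_set_scope.
Local Open Scope ring_scope.

Record mprob (R : realType) := MProb {
  mp_d : measure_display; mp_T : measurableType mp_d; mp_P : probability mp_T R }.

Definition unif01 (R : realType) := uniform_prob (@ltr01 R).

Fixpoint cube (R : realType) (n : nat) : mprob R :=
  match n with
  | 0 => @MProb R _ unit (@dirac _ unit tt R)
  | S k => let c := cube R k in
      @MProb R _ (_ * mp_T c)%type (@unif01 R \x mp_P c)%E
  end.

Fixpoint cube_coord (R : realType) (n : nat) : mp_T (cube R n) -> nat -> R :=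
  match n return mp_T (cube R n) -> nat -> R with
  | 0 => fun _ _ => 0
  | S k => fun x j => match j with 0 => x.1 | S j' => cube_coord x.2 j' end
  end.

(** * The torus T^n with normalized Lebesgue (Haar) measure mu.
    T^n is parametrized by angle coordinates theta in [0,1]^n; the measure is the
    n-fold product of the uniform probability on [0,1] (i.e. normalized Lebesgue measure),
    and the point of T^n is (exp(2 pi i theta_1), ..., exp(2 pi i theta_n)). *)
Definition Tn (R : realType) (n : nat) := mp_T (cube R n).
Definition torus_mu (R : realType) (n : nat) : probability (Tn R n) R := mp_P (cube R n).

Notation normc := (@Normc.normc _).

Definition torus_pt (R : realType) (n : nat) (x : Tn R n) : 'I_n -> R[i] :=
  fun k => @Complex R (cos (2 * pi * cube_coord x k)) (sin (2 * pi * cube_coord x k)).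

Definition cmeasurable (R : realType) (n : nat) (f : Tn R n -> R[i]) :=
  measurable_fun setT (fun x => complex.Re (f x)) /\
  measurable_fun setT (fun x => complex.Im (f x)).

Definition cint (R : realType) (n : nat) (f : Tn R n -> R[i]) : R[i] :=
  @Complex R (Rintegral (torus_mu R n) setT (fun x => complex.Re (f x)))
             (Rintegral (torus_mu R n) setT (fun x => complex.Im (f x))).

Definition L1norm (R : realType) (n : nat) (f : Tn R n -> R[i]) : \bar R :=
  (\int[torus_mu R n]_x (normc (f x))%:E)%E.

Definition L2 (R : realType) (n : nat) (f : Tn R n -> R[i]) :=
  cmeasurable f /\ (\int[torus_mu R n]_x ((normc (f x)) ^+ 2)%:E < +oo)%E.

Definition inner (R : realType) (n : nat) (f g : Tn R n -> R[i]) : R[i] :=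
  cint (fun x => f x * conjc (g x)).

Definition character (R : realType) (n : nat) (k : 'I_n -> int) (x : Tn R n) : R[i] :=
  \prod_(j < n) (torus_pt x j) ^ (k j).

Definition fourier_coef (R : realType) (n : nat) (f : Tn R n -> R[i]) (k : 'I_n -> int) :=
  inner f (character k).

Definition H2 (R : realType) (n : nat) (f : Tn R n -> R[i]) :=
  L2 f /\ forall k : 'I_n -> int, (exists j, k j < 0) -> fourier_coef f k = 0.

(** H^2_0: f in H^2 with f(0) = 0; the value at 0 of the analytic extension
    sum_k fhat(k) z^k of f is its 0-th Fourier coefficient *)
Definition H2_0 (R : realType) (n : nat) (f : Tn R n -> R[i]) :=
  H2 f /\ fourier_coef f (fun _ => 0) = 0.

Definition Mn (R : realType) (n : nat) (f : Tn R n -> R[i]) :=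
  L2 f /\ forall g h, H2 g -> H2 h -> inner f (fun x => conjc (g x) + h x) = 0.

Definition polydisc (R : realType) (n : nat) (z : 'I_n -> R[i]) :=
  forall k, normc (z k) < 1.

Definition szego (R : realType) (n : nat) (z w : 'I_n -> R[i]) : R[i] :=
  \prod_(k < n) (1 - z k * conjc (w k))^-1.

Definition holomorphic_polydisc (R : realType) (n : nat) (phi : ('I_n -> R[i]) -> R[i]) :=
  forall z, polydisc z ->
  exists d : 'I_n -> R[i], forall e : R, 0 < e -> exists2 delta : R, 0 < delta &
    forall h : 'I_n -> R[i], (forall k, normc (h k) < delta) ->
      normc (phi (fun k => z k + h k) - phi z - \sum_(k < n) d k * h k)
        <= e * \big[Num.max/0]_(k < n) normc (h k).

Definition schur_class (R : realType) (n : nat) (phi : ('I_n -> R[i]) -> R[i]) :=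
  holomorphic_polydisc phi /\ forall z, polydisc z -> normc (phi z) <= 1.

Definition MQ (R : realType) (n m : nat) (z : 'I_m -> 'I_n -> R[i]) (f : Tn R n -> R[i]) :=
  exists (a : 'I_m -> R[i]) (g h : Tn R n -> R[i]),
    [/\ Mn g, H2_0 h &
      forall x, f x = conjc (\sum_(i < m) a i * szego (torus_pt x) (z i)) + g x + h x].

Definition szego_gram (R : realType) (n m : nat) (z : 'I_m -> 'I_n -> R[i]) : 'M[R[i]]_m :=
  \matrix_(j < m, i < m) szego (z j) (z i).

Definition interp_c (R : realType) (n m : nat) (z : 'I_m -> 'I_n -> R[i]) (w : 'I_m -> R[i])
  : 'cV[R[i]]_m := invmx (szego_gram z) *m \col_(i < m) w i.

Definition psiZW (R : realType) (n m : nat) (z : 'I_m -> 'I_n -> R[i]) (w : 'I_m -> R[i])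
  (x : Tn R n) : R[i] :=
  \sum_(i < m) interp_c z w i 0 * szego (torus_pt x) (z i).

Definition contraction_on (R : realType) (n : nat) (S : (Tn R n -> R[i]) -> Prop)
  (Lam : (Tn R n -> R[i]) -> R[i]) :=
  forall f, S f -> ((normc (Lam f))%:E <= L1norm f)%E.

(* Main.v *)
(** The contraction condition is a dual form of interpolation.

    If [phi] is a Schur function with [phi (z i) = w i], write an element of
    [MQ z] as [f = conj(sum_i a_i S(., z_i)) + g + h].  Orthogonality and the
    reproducing property of the Szego kernel give
    [int psi f = sum_i conj(a_i) w_i].  Cauchy's formula on the polydisc and
    Fubini's theorem give [int phi(s x) f(x) dx = sum_i conj(a_i) phi(s z_i)] for
    [0 < s < 1], and the left-hand side is at most [||f||_1] in modulus; let [s]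
    tend to [1].

    Conversely, extend the functional from [MQ z] to [L^2] by Hahn-Banach, keeping
    the bound by the [L^1] norm, to some [Lam], and put
    [phi(v) = Lam(conj S(., v))].  This is holomorphic because
    [v |-> conj S(., v)] is complex differentiable for the sup norm.  The Poisson
    kernel [P_v] differs from [conj S(., v)] by an element of [MQ z] orthogonal to
    [psi], so [|phi(v)| = |Lam(P_v)| <= ||P_v||_1 = 1]. *)

Require Import Defs.
From HB Require Import structures.
From mathcomp Require Import all_boot all_order all_algebra.
From mathcomp Require Import all_classical all_reals all_analysis.
From mathcomp Require Import complex.
From mathcomp Require Import measurable_realfun ring lra.
Set Implicit Arguments. Unset Strict Implicit. Unset Printing Implicit Defensive.
Import Order.TTheory GRing.Theory Num.Theory.
Import numFieldNormedType.Exports.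
Local Open Scope classical_set_scope.
Local Open Scope ring_scope.

(** Two obstacles shape the proof. A Schur function is given on the open polydisc only, and
    [holomorphic_polydisc] asks for differentiability without continuity of the derivative. Hence no
    boundary values are taken: dilates are differentiable at every point of the closed polydisc, and
    Cauchy's formula for them comes from Goursat's bisection, one variable at a time. Conversely,
    the extended functional is never represented by a bounded function; its values on the conjugate
    kernels already give the interpolant, so neither duality of L^1 nor radial limits enter. Kernel
    identities are obtained without summing series: a factor of the kernel satisfies [G = 1 + c e G]
    with [e] a character and [c] of modulus less than 1, and iterating this [k] times leaves a
    bounded remainder multiplied by [c ^+ k]. Functions are defined everywhere and not taken modulo
    null sets. The L^1 norm is thus a seminorm, well behaved only on integrable functions, and
    Hahn-Banach is stated for a seminorm on a subset of the space of all functions. *)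

Local Notation cRe := complex.Re.
Local Notation cIm := complex.Im.

(** * The complex modulus *)

Section complex_modulus.
Variable R : realType.
Implicit Types (a b : R[i]) (r : R).

Lemma cReD a b : cRe (a + b) = cRe a + cRe b. Proof. by case: a b => [? ?] []. Qed.
Lemma cImD a b : cIm (a + b) = cIm a + cIm b. Proof. by case: a b => [? ?] []. Qed.
Lemma cReM a b : cRe (a * b) = cRe a * cRe b - cIm a * cIm b.
Proof. by case: a b => [? ?] []. Qed.
Lemma cImM a b : cIm (a * b) = cRe a * cIm b + cIm a * cRe b.
Proof. by case: a b => [? ?] []. Qed.
Lemma cReJ a : cRe (conjc a) = cRe a. Proof. by case: a. Qed.
Lemma cImJ a : cIm (conjc a) = - cIm a. Proof. by case: a. Qed.

Lemma eqc a b : cRe a = cRe b -> cIm a = cIm b -> a = b.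
Proof. by case: a b => [? ?] [? ?] /= -> ->. Qed.

Lemma normc_sqrtE a : normc a = Num.sqrt (cRe a ^+ 2 + cIm a ^+ 2).
Proof. by case: a. Qed.

Lemma normc_ge0 a : 0 <= normc a. Proof. by rewrite normc_sqrtE sqrtr_ge0. Qed.

Lemma normc_sqr a : normc a ^+ 2 = cRe a ^+ 2 + cIm a ^+ 2.
Proof. by rewrite normc_sqrtE sqr_sqrtr // addr_ge0 ?sqr_ge0. Qed.

Lemma normc_ReIm a : (normc a ^+ 2)%:C%C = a * conjc a.
Proof. by apply: eqc; rewrite ?cReM ?cImM /= ?cReJ ?cImJ ?normc_sqr; ring. Qed.

Lemma normc_conj a : normc (conjc a) = normc a.
Proof. by rewrite !normc_sqrtE cReJ cImJ sqrrN. Qed.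

Lemma normc_real r : normc r%:C%C = `|r|.
Proof. by rewrite normc_sqrtE /= expr0n addr0 sqrtr_sqr. Qed.

Lemma realcB (r s : R) : (r - s)%:C%C = r%:C%C - s%:C%C.
Proof. by apply: eqc; rewrite ?cReD ?cImD //= subr0. Qed.

Lemma normc_eq0 a : (normc a == 0) = (a == 0).
Proof.
apply/eqP/eqP => [/Normc.eq0_normc //|->]; exact: Normc.normc0.
Qed.

Lemma normcX a k : normc (a ^+ k) = normc a ^+ k.
Proof.
elim: k => [|k IH]; first by rewrite !expr0 Normc.normc1.
by rewrite !exprS Normc.normcM IH.
Qed.

Lemma normc_prod (I : finType) (F : I -> R[i]) :
  normc (\prod_i F i) = \prod_i normc (F i).
Proof. exact: (big_morph _ (@Normc.normcM R) (Normc.normc1 R)). Qed.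

Lemma normc_sum (I : finType) (F : I -> R[i]) :
  normc (\sum_i F i) <= \sum_i normc (F i).
Proof.
elim/big_ind2 : _ => [|x1 x2 y1 y2 h1 h2|//]; first by rewrite Normc.normc0.
by rewrite (le_trans (le_normcD _ _)) ?lerD.
Qed.

Lemma normcB a b : normc (a - b) = normc (b - a).
Proof. by rewrite -opprB normcN. Qed.

Lemma normc_triB a b : normc a - normc b <= normc (a - b).
Proof. by have := le_normcD (a - b) b; rewrite subrK lerBlDr. Qed.

Lemma normRe_le a : `|cRe a| <= normc a.
Proof.
rewrite normc_sqrtE -sqrtr_sqr ler_sqrt ?lerDl ?sqr_ge0 //.
by rewrite addr_ge0 ?sqr_ge0.
Qed.

Lemma normIm_le a : `|cIm a| <= normc a.
Proof.
rewrite normc_sqrtE -sqrtr_sqr ler_sqrt ?lerDr ?sqr_ge0 //.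
by rewrite addr_ge0 ?sqr_ge0.
Qed.

Lemma normc_le_ReIm a : normc a <= `|cRe a| + `|cIm a|.
Proof.
rewrite normc_sqrtE -[leRHS]ger0_norm ?addr_ge0// -sqrtr_sqr ler_sqrt ?sqr_ge0//.
rewrite sqrrD !real_normK ?num_real// lerD2r lerDl.
by rewrite mulrn_wge0 // mulr_ge0.
Qed.

(** Turns bounds on real parts into bounds on moduli, for integrals and for the Hahn-Banach
    extension. *)
Lemma normc_rot a : exists2 u : R[i], normc u = 1 & u * a = (normc a)%:C%C.
Proof.
have [->|a0] := eqVneq a 0.
  by exists 1; rewrite ?Normc.normc1 // Normc.normc0 mulr0.
have n0 : normc a != 0 by rewrite normc_eq0.
exists ((normc a)^-1%:C%C * conjc a).
  by rewrite Normc.normcM normc_real normc_conj ger0_norm ?invr_ge0 ?normc_ge0// mulVf.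
rewrite -mulrA (mulrC _ a) -normc_ReIm -rmorphM /=; congr (_%:C)%C.
by rewrite expr2 mulrA mulVf // mul1r.
Qed.

(** Closes the iterated identities [a = c ^+ k * b k] in which the [b k] stay bounded and [c] has
    modulus less than 1. *)
Lemma normc_lim0 a (r c : R) : 0 <= r < 1 ->
  (forall k : nat, normc a <= r ^+ k * c) -> a = 0.
Proof.
move=> /andP[r0 r1] h; apply/eqP; rewrite -normc_eq0 eq_le normc_ge0 andbT.
have cv : (fun k : nat => r ^+ k * c) @ \oo --> (0 : R).
  rewrite -(mul0r c); apply: cvgM; last exact: cvg_cst.
  by apply: cvg_expr; rewrite ger0_norm.
have := @ler_cvg_to _ _ _ _ (cst (normc a)) (fun k : nat => r ^+ k * c) _ _ (cvg_cst _) cv.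
by apply; apply: nearW => k; exact: h.
Qed.

End complex_modulus.

(** * Integration of complex-valued functions *)

Section complex_integral.
Context (d : measure_display) (T : measurableType d) (R : realType).
Implicit Types (D : set T) (f g : T -> R[i]).

Definition cmeas D f :=
  measurable_fun D (fun x => cRe (f x)) /\ measurable_fun D (fun x => cIm (f x)).

Lemma cmeas_cst D c : cmeas D (fun=> c).
Proof. by split; exact: measurable_cst. Qed.

Lemma cmeasD D f g : cmeas D f -> cmeas D g -> cmeas D (fun x => f x + g x).
Proof.
move=> [f1 f2] [g1 g2]; split.
  by under eq_fun do rewrite cReD; exact: measurable_funD.
by under eq_fun do rewrite cImD; exact: measurable_funD.
Qed.

Lemma cmeasM D f g : cmeas D f -> cmeas D g -> cmeas D (fun x => f x * g x).
Proof.
move=> [f1 f2] [g1 g2]; split.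
  by under eq_fun do rewrite cReM; apply: measurable_funB; exact: measurable_funM.
by under eq_fun do rewrite cImM; apply: measurable_funD; exact: measurable_funM.
Qed.

Lemma cmeasJ D f : cmeas D f -> cmeas D (fun x => conjc (f x)).
Proof.
move=> [f1 f2]; split; first by under eq_fun do rewrite cReJ.
by under eq_fun do rewrite cImJ; exact: measurableT_comp.
Qed.

Lemma cmeasN D f : cmeas D f -> cmeas D (fun x => - f x).
Proof.
move=> mf; have := cmeasM (cmeas_cst D (-1)) mf.
by under eq_fun do rewrite mulN1r.
Qed.

Lemma cmeasB D f g : cmeas D f -> cmeas D g -> cmeas D (fun x => f x - g x).
Proof. by move=> mf mg; apply: cmeasD => //; exact: cmeasN. Qed.

Lemma cmeas_sum D (I : finType) (F : I -> T -> R[i]) :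
  (forall i, cmeas D (F i)) -> cmeas D (fun x => \sum_i F i x).
Proof.
move=> mF; rewrite /index_enum; elim: (Finite.enum I) => [|i s IH].
  by under eq_fun do rewrite big_nil; exact: cmeas_cst.
by under eq_fun do rewrite big_cons; exact: cmeasD.
Qed.

Lemma cmeas_prod D (I : finType) (F : I -> T -> R[i]) :
  (forall i, cmeas D (F i)) -> cmeas D (fun x => \prod_i F i x).
Proof.
move=> mF; rewrite /index_enum; elim: (Finite.enum I) => [|i s IH].
  by under eq_fun do rewrite big_nil; exact: cmeas_cst.
by under eq_fun do rewrite big_cons; exact: cmeasM.
Qed.

Lemma cmeas_normc D f : cmeas D f -> measurable_fun D (fun x => normc (f x)).
Proof.
move=> [f1 f2]; under eq_fun do rewrite normc_sqrtE.
apply: measurableT_comp; first by apply: continuous_measurable_fun => x; exact: sqrt_continuous.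
by apply: measurable_funD; exact: measurable_funX.
Qed.


Variable mu : {measure set T -> \bar R}.

Definition cintegrable D f :=
  mu.-integrable D (fun x => (cRe (f x))%:E) /\
  mu.-integrable D (fun x => (cIm (f x))%:E).

Definition cintegral D f : R[i] :=
  Complex (\int[mu]_(x in D) cRe (f x)) (\int[mu]_(x in D) cIm (f x)).

Lemma eq_cintegral D f g : {in D, f =1 g} -> cintegral D f = cintegral D g.
Proof. by move=> fg; congr Complex; apply: eq_Rintegral => x xD; rewrite fg. Qed.

Lemma cintegrable_cmeas D f : cintegrable D f -> cmeas D f.
Proof. by move=> [/integrableP[/measurable_EFinP ? _] /integrableP[/measurable_EFinP ? _]]. Qed.

Lemma cintegrable_le D f (g : T -> R) : measurable D -> cmeas D f ->
  mu.-integrable D (EFin \o g) -> (forall x, D x -> normc (f x) <= g x) ->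
  cintegrable D f.
Proof.
move=> mD [f1 f2] ig fg; split; apply: (le_integrable mD _ _ ig).
- exact/measurable_EFinP.
- move=> x Dx; rewrite lee_fin (le_trans (normRe_le _))//.
  by rewrite (le_trans (fg _ Dx))// ler_norm.
- exact/measurable_EFinP.
- move=> x Dx; rewrite lee_fin (le_trans (normIm_le _))//.
  by rewrite (le_trans (fg _ Dx))// ler_norm.
Qed.

Lemma cintegrable_normc D f : measurable D -> cintegrable D f ->
  mu.-integrable D (fun x => (normc (f x))%:E).
Proof.
move=> mD [h1 h2].
have ig : mu.-integrable D (fun x => (`|cRe (f x)| + `|cIm (f x)|)%:E).
  apply: (eq_integrable mD) (integrableD mD (integrable_abse h1) (integrable_abse h2)).
  by move=> x _ /=; rewrite EFinD.
apply: (le_integrable mD _ _ ig).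
  by apply/measurable_EFinP/cmeas_normc; exact: cintegrable_cmeas.
move=> x _; rewrite lee_fin ger0_norm ?normc_ge0//.
by rewrite (le_trans (normc_le_ReIm _))// ler_norm.
Qed.

Lemma cintegrableD D f g : measurable D ->
  cintegrable D f -> cintegrable D g -> cintegrable D (fun x => f x + g x).
Proof.
move=> mD [f1 f2] [g1 g2]; split.
  apply: (eq_integrable mD) (integrableD mD f1 g1) => x _ /=.
  by rewrite cReD EFinD.
apply: (eq_integrable mD) (integrableD mD f2 g2) => x _ /=.
by rewrite cImD EFinD.
Qed.

Lemma cintegrableZ D c f : measurable D ->
  cintegrable D f -> cintegrable D (fun x => c * f x).
Proof.
move=> mD fi; have ig := cintegrable_normc mD fi.
have ig' : mu.-integrable D (EFin \o (fun x => normc c * normc (f x))).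
  apply: (eq_integrable mD) (integrableZl mD (normc c) ig) => x _ /=.
  by rewrite EFinM.
apply: (cintegrable_le mD _ ig').
  by apply: cmeasM; [exact: cmeas_cst|exact: cintegrable_cmeas].
by move=> x _; rewrite Normc.normcM.
Qed.

Lemma cintegrableN D f : measurable D ->
  cintegrable D f -> cintegrable D (fun x => - f x).
Proof.
by move=> mD fi; have := cintegrableZ (-1) mD fi; under eq_fun do rewrite mulN1r.
Qed.

Lemma cintegrableB D f g : measurable D ->
  cintegrable D f -> cintegrable D g -> cintegrable D (fun x => f x - g x).
Proof. by move=> mD fi gi; apply: cintegrableD => //; exact: cintegrableN. Qed.

Lemma cintegrable0 D : cintegrable D (fun=> 0).
Proof. by split; exact: integrable0. Qed.

Lemma cintegralD D f g : measurable D -> cintegrable D f -> cintegrable D g ->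
  cintegral D (fun x => f x + g x) = cintegral D f + cintegral D g.
Proof.
move=> mD [f1 f2] [g1 g2]; apply: eqc; rewrite ?cReD ?cImD /= -RintegralD//;
by apply: eq_Rintegral => x _; rewrite ?cReD ?cImD.
Qed.

Lemma cintegralZ D c f : measurable D -> cintegrable D f ->
  cintegral D (fun x => c * f x) = c * cintegral D f.
Proof.
move=> mD [f1 f2].
have Z1 r := RintegralZl r mD f1; have Z2 r := RintegralZl r mD f2.
have i1 r : mu.-integrable D (EFin \o (fun x => r * cRe (f x))).
  by apply: (eq_integrable mD) (integrableZl mD r f1) => x _ /=; rewrite EFinM.
have i2 r : mu.-integrable D (EFin \o (fun x => r * cIm (f x))).
  by apply: (eq_integrable mD) (integrableZl mD r f2) => x _ /=; rewrite EFinM.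
apply: eqc; rewrite ?cReM ?cImM /=.
  rewrite -Z1 -Z2 -RintegralB//.
  by apply: eq_Rintegral => x _; rewrite cReM.
rewrite -Z1 -Z2 -RintegralD//.
by apply: eq_Rintegral => x _; rewrite cImM.
Qed.

Lemma cintegralN D f : measurable D -> cintegrable D f ->
  cintegral D (fun x => - f x) = - cintegral D f.
Proof.
move=> mD fi; rewrite -mulN1r -cintegralZ//.
by apply: eq_cintegral => x _; rewrite mulN1r.
Qed.

Lemma cintegralB D f g : measurable D -> cintegrable D f -> cintegrable D g ->
  cintegral D (fun x => f x - g x) = cintegral D f - cintegral D g.
Proof.
by move=> mD fi gi; rewrite cintegralD ?cintegralN//; exact: cintegrableN.
Qed.

Lemma cintegral0 D : cintegral D (fun=> 0) = 0.
Proof. by congr Complex; rewrite /Rintegral integral0. Qed.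

Lemma cintegral_sum D (I : finType) (F : I -> T -> R[i]) : measurable D ->
  (forall i, cintegrable D (F i)) ->
  cintegral D (fun x => \sum_i F i x) = \sum_i cintegral D (F i).
Proof.
move=> mD iF; rewrite /index_enum.
suff : cintegrable D (fun x => \sum_(i <- Finite.enum I) F i x) /\
  cintegral D (fun x => \sum_(i <- Finite.enum I) F i x) =
  \sum_(i <- Finite.enum I) cintegral D (F i) by case.
elim: (Finite.enum I) => [|i s [IHi IH]].
  rewrite big_nil; under eq_fun do rewrite big_nil.
  by split; [exact: cintegrable0|exact: cintegral0].
rewrite big_cons; under eq_fun do rewrite big_cons.
by split; [exact: cintegrableD|rewrite cintegralD// IH].
Qed.

Lemma cintegralJ D f : measurable D -> cintegrable D f ->
  cintegral D (fun x => conjc (f x)) = conjc (cintegral D f).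
Proof.
move=> mD [_ f2].
congr Complex; first by apply: eq_Rintegral => x _; rewrite cReJ.
rewrite -mulN1r -RintegralZl//.
by apply: eq_Rintegral => x _; rewrite cImJ mulN1r.
Qed.

Lemma cintegrableJ D f : measurable D ->
  cintegrable D f -> cintegrable D (fun x => conjc (f x)).
Proof.
move=> mD fi; apply: (cintegrable_le mD _ (cintegrable_normc mD fi)).
  by apply: cmeasJ; exact: cintegrable_cmeas.
by move=> x _; rewrite normc_conj.
Qed.

(** Rotate the integral onto the nonnegative real axis: its modulus is then the integral of the real
    part of [u * f x], where [u] has modulus one. *)
Lemma normc_cintegral D f : measurable D -> cintegrable D f ->
  normc (cintegral D f) <= \int[mu]_(x in D) normc (f x).
Proof.
move=> mD fi; have [u u1 uI] := normc_rot (cintegral D f).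
have -> : normc (cintegral D f) = cRe (cintegral D (fun x => u * f x)).
  by rewrite cintegralZ// uI.
have [ui _] := cintegrableZ u mD fi; apply: le_Rintegral => //.
  exact: cintegrable_normc.
move=> x _; rewrite (le_trans (ler_norm _))// (le_trans (normRe_le _))//.
by rewrite Normc.normcM u1 mul1r.
Qed.

End complex_integral.

Section finite_measure_integral.
Context (d : measure_display) (T : measurableType d) (R : realType).
Variable mu : {measure set T -> \bar R}.
Implicit Types (D : set T) (f g : T -> R[i]).

Lemma integrable_cst_lty D (c : R) : measurable D -> (mu D < +oo)%E ->
  mu.-integrable D (fun=> c%:E).
Proof.
move=> mD muD; apply: (@measurable_bounded_integrable _ _ _ _ (cst c)) => //.
exact: bounded_cst.
Qed.

Lemma cintegrable_bounded D f (M : R) : measurable D -> (mu D < +oo)%E ->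
  cmeas D f -> (forall x, D x -> normc (f x) <= M) -> cintegrable mu D f.
Proof.
move=> mD muD mf fM.
exact: (cintegrable_le mD mf (integrable_cst_lty M mD muD)).
Qed.

Lemma cintegrable_Mbounded D f g (M : R) : measurable D ->
  cmeas D f -> (forall x, D x -> normc (f x) <= M) -> cintegrable mu D g ->
  cintegrable mu D (fun x => f x * g x).
Proof.
move=> mD mf fM gi; have ig := cintegrable_normc mD gi.
have ig' : mu.-integrable D (EFin \o (fun x => M * normc (g x))).
  apply: (eq_integrable mD) (integrableZl mD M ig) => x _ /=.
  by rewrite EFinM.
apply: (cintegrable_le mD _ ig').
  by apply: cmeasM => //; exact: cintegrable_cmeas gi.
by move=> x Dx; rewrite Normc.normcM ler_wpM2r ?normc_ge0// fM.
Qed.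

Lemma normc_cintegral_bound D f (M : R) : measurable D -> (mu D < +oo)%E ->
  cmeas D f -> (forall x, D x -> normc (f x) <= M) ->
  normc (cintegral mu D f) <= M * fine (mu D).
Proof.
move=> mD muD mf fM; have fi := cintegrable_bounded mD muD mf fM.
rewrite (le_trans (normc_cintegral mD fi))// -Rintegral_cst//.
apply: le_Rintegral => //; first exact: cintegrable_normc.
exact: integrable_cst_lty.
Qed.

Lemma cintegral_cst D c : measurable D -> (mu D < +oo)%E ->
  cintegral mu D (fun=> c) = c * (fine (mu D))%:C%C.
Proof.
by move=> mD muD; apply: eqc; rewrite ?cReM ?cImM /= !Rintegral_cst//; ring.
Qed.

End finite_measure_integral.

Section complex_fubini.
Context (d1 d2 : measure_display) (T1 : measurableType d1)
  (T2 : measurableType d2) (R : realType).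
Variable m1 : {sigma_finite_measure set T1 -> \bar R}.
Variable m2 : {sigma_finite_measure set T2 -> \bar R}.
Variable f : T1 * T2 -> R[i].
Hypothesis fi : cintegrable (m1 \x m2)%E setT f.

(** [Rintegral] passes through [fine], so every section is required to be integrable; the iterated
    extended integral then has finite inner values. *)
Lemma cintegral12 : (forall x, cintegrable m2 setT (fun y => f (x, y))) ->
  cintegral (m1 \x m2)%E setT f =
  cintegral m1 setT (fun x => cintegral m2 setT (fun y => f (x, y))).
Proof.
move=> sec; case: fi => f1 f2; congr Complex; rewrite /Rintegral.
  rewrite -(integral12_prod_meas1 f1); congr fine; apply: eq_integral => x _.
  by rewrite /fubini_F fineK//; apply: integrable_fin_num => //; case: (sec x).
rewrite -(integral12_prod_meas1 f2); congr fine; apply: eq_integral => x _.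
by rewrite /fubini_F fineK//; apply: integrable_fin_num => //; case: (sec x).
Qed.

Lemma cintegral21 : (forall y, cintegrable m1 setT (fun x => f (x, y))) ->
  cintegral (m1 \x m2)%E setT f =
  cintegral m2 setT (fun y => cintegral m1 setT (fun x => f (x, y))).
Proof.
move=> sec; case: fi => f1 f2; congr Complex; rewrite /Rintegral.
  rewrite -(integral21_prod_meas1 f1); congr fine; apply: eq_integral => x _.
  by rewrite /fubini_G fineK//; apply: integrable_fin_num => //; case: (sec x).
rewrite -(integral21_prod_meas1 f2); congr fine; apply: eq_integral => x _.
by rewrite /fubini_G fineK//; apply: integrable_fin_num => //; case: (sec x).
Qed.

End complex_fubini.

(** * Measurability *)

Section measurability.
Context (d : measure_display) (T : measurableType d) (R : realType).

(* [y / (y ^+ 2 + 1 / k)] tends to [y^-1] also at [y = 0], where [0^-1 = 0]. *)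
Lemma measurable_funV (D : set T) (f : T -> R) :
  measurable_fun D f -> measurable_fun D (fun x => (f x)^-1).
Proof.
move=> mf; apply: (@measurableT_comp _ _ _ _ _ _ (fun y : R => y^-1)) => //.
apply: (@measurable_fun_cvg _ _ _ _
  (fun k (y : R) => y * (y ^+ 2 + k.+1%:R^-1)^-1)) => [k|y _].
  apply: continuous_measurable_fun => y; apply: cvgM; first exact: cvg_id.
  apply: cvgV; last by apply: cvgD; [exact: exprn_continuous|exact: cvg_cst].
  by rewrite gt_eqF// ltr_wpDl ?sqr_ge0// invr_gt0.
have [->|y0] := eqVneq y 0.
  by under eq_fun do rewrite mul0r; rewrite invr0; exact: cvg_cst.
have -> : y^-1 = y * (y ^+ 2 + 0)^-1 by rewrite addr0 expr2 invfM mulrA divff// mul1r.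
apply: cvgM; first exact: cvg_cst.
apply: cvgV; first by rewrite addr0 expf_neq0.
by apply: cvgD; [exact: cvg_cst|exact: cvg_harmonic].
Qed.

Lemma cmeasV (D : set T) (f : T -> R[i]) :
  cmeas D f -> cmeas D (fun x => (f x)^-1).
Proof.
move=> [f1 f2].
have mV : measurable_fun D (fun x => (cRe (f x) ^+ 2 + cIm (f x) ^+ 2)^-1).
  by apply: measurable_funV; apply: measurable_funD; exact: measurable_funX.
split.
  apply: eq_measurable_fun (measurable_funM f1 mV) => x _ /=.
  by case: (f x).
apply: eq_measurable_fun (measurable_funN (measurable_funM f2 mV)) => x _ /=.
by case: (f x).
Qed.

(* Approximate [f (x, y)] by [f (k / N, y)] where [k / N <= x < (k + 1) / N]. *)
Lemma caratheodory_measurable (f : measurableTypeR R * T -> R) :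
  (forall y, continuous (fun x : R => f (x, y))) ->
  (forall x, measurable_fun setT (fun y => f (x, y))) ->
  measurable_fun setT f.
Proof.
move=> cf mf.
pose q (k : nat) (x : R) : R := (Num.floor (k.+1%:R * x))%:~R / k.+1%:R.
apply: (@measurable_fun_cvg _ _ _ _ (fun k z => f (q k z.1, z.2))) => [k|[x y] _ /=].
  move=> _ B mB; rewrite setTI.
  rewrite [X in measurable X](_ : _ = \bigcup_(j : int)
    ([set x : R | Num.floor (k.+1%:R * x) = j] `*`
     [set y | B (f (j%:~R / k.+1%:R, y))])); last first.
    apply/seteqP; split => [[x y] /= h|[x y] /= [j _ /= [/= hj]]].
      by exists (Num.floor (k.+1%:R * x)).
    by rewrite /q hj.
  apply: countable_bigcupT_measurable => //= j; apply: measurableX.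
    rewrite [X in measurable X](_ : _ = `[j%:~R / k.+1%:R, (j + 1)%:~R / k.+1%:R[%classic).
      exact: measurable_itv.
    apply/seteqP; split => x /=; rewrite in_itv/=.
      move=> <-; have := floor_itv (k.+1%:R * x) => /andP[h1 h2].
      by rewrite ler_pdivrMr// ltr_pdivlMr// [x * _]mulrC h1 h2.
    move=> /andP[h1 h2]; apply: floor_def.
    by rewrite [_ * x]mulrC -ler_pdivrMr// -ltr_pdivlMr// h1 h2.
  by have := mf (j%:~R / k.+1%:R) measurableT _ mB; rewrite setTI.
apply: (@cvg_comp _ _ _ (fun k : nat => q k x) (fun x => f (x, y)) _ (nbhs x)); last exact: cf.
apply/cvgrPdist_lt => e e0; near=> k.
have := floor_itv (k.+1%:R * x) => /andP[h1 h2].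
have k0 : 0 < k.+1%:R :> R by [].
have qx : q k x <= x by rewrite /q ler_pdivrMr// [x * _]mulrC.
rewrite ger0_norm ?subr_ge0//.
have : x < q k x + k.+1%:R^-1.
  by rewrite /q -[X in _ + X]mul1r -mulrDl ltr_pdivlMr// [x * _]mulrC -[1]/(1%:~R) -intrD.
have : k.+1%:R^-1 < e by near: k; exact: (near_infty_natSinv_lt (PosNum e0)).
by move=> ke xq; rewrite ltrBlDl (lt_trans xq)// ltrD2l.
Unshelve. all: by end_near. Qed.

End measurability.

Section torus_measurability.
Variable R : realType.

Lemma measurable_cube_coord (n k : nat) :
  measurable_fun setT (fun x : Tn R n => cube_coord x k).
Proof.
elim: n k => [|n IH] k; first exact: measurable_cst.
case: k => [|k] /=; first exact: measurable_fst.
by apply: (@measurableT_comp _ _ _ _ _ _ (fun x : Tn R n => cube_coord x k));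
  [exact: IH|exact: measurable_snd].
Qed.

Definition expi (t : R) : R[i] := Complex (cos (2 * pi * t)) (sin (2 * pi * t)).

Lemma normc_expi t : normc (expi t) = 1.
Proof. by rewrite normc_sqrtE /= cos2Dsin2 sqrtr1. Qed.

Lemma normc_torus_pt n (x : Tn R n) k : normc (torus_pt x k) = 1.
Proof. exact: normc_expi. Qed.

Lemma cmeas_torus_pt n k : cmeas setT (fun x : Tn R n => torus_pt x k).
Proof.
have mc := @measurable_cube_coord n k.
have m2 : measurable_fun setT (fun x : Tn R n => 2 * pi * cube_coord x k).
  by apply: measurable_funM => //; exact: measurable_cst.
split; rewrite /torus_pt /=.
  by apply: (@measurableT_comp _ _ _ _ _ _ (@cos R)) => //;
    apply: continuous_measurable_fun; exact: continuous_cos.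
by apply: (@measurableT_comp _ _ _ _ _ _ (@sin R)) => //;
  apply: continuous_measurable_fun; exact: continuous_sin.
Qed.

Lemma torus_pt_cons n (t : R) (x : Tn R n) (k : 'I_n.+1) :
  @torus_pt R n.+1 (t, x) k =
  if unlift ord0 k is Some j then torus_pt x j else expi t.
Proof.
case: (unliftP ord0 k) => [j|] -> //=.
Qed.

End torus_measurability.

(** * Continuity of curves and of functions of several variables, and measurability on the torus *)

Section torus_continuity.
Variable R : realType.

(** The point [b] ranges over all of C^n: at a point of the torus this also looks outside the
    polydisc, which dilated functions allow. *)
Definition mcontinuous_at n (F : ('I_n -> R[i]) -> R[i]) (a : 'I_n -> R[i]) :=
  forall e : R, 0 < e -> exists2 delta : R, 0 < delta &
    forall b, (forall k, normc (b k - a k) < delta) -> normc (F b - F a) < e.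

Definition cpath (f : R -> R[i]) (t : R) :=
  forall e : R, 0 < e -> exists2 delta : R, 0 < delta &
    forall s, `|s - t| < delta -> normc (f s - f t) < e.

Lemma cpathP f t : cpath f t <->
  {for t, continuous (fun x => cRe (f x))} /\ {for t, continuous (fun x => cIm (f x))}.
Proof.
split=> [fc|[f1 f2] e e0].
  split; apply/cvgrPdist_lt => e e0; have [dl d0 h] := fc _ e0;
    exists dl => //= s /=; rewrite distrC => /h.
    rewrite normcB; apply: le_lt_trans; rewrite (le_trans _ (normRe_le _))//.
    by rewrite cReD; case: (f s).
  rewrite normcB; apply: le_lt_trans; rewrite (le_trans _ (normIm_le _))//.
  by rewrite cImD; case: (f s).
have e2 : 0 < e / 2 by rewrite divr_gt0.
have /cvgrPdist_lt /(_ _ e2) [d1 /= d10 h1] := f1.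
have /cvgrPdist_lt /(_ _ e2) [d2 /= d20 h2] := f2.
exists (Num.min d1 d2); first by rewrite lt_min d10.
move=> s; rewrite lt_min distrC => /andP[/h1 /= a1 /h2 /= a2].
rewrite normcB (le_lt_trans (normc_le_ReIm _))// (splitr e) ltrD//.
  by move: a1; rewrite cReD; case: (f s).
by move: a2; rewrite cImD; case: (f s).
Qed.

Lemma cpath_cst c t : cpath (fun=> c) t.
Proof. by move=> e e0; exists 1 => // s _; rewrite subrr Normc.normc0. Qed.

Lemma cpath_expi t : cpath (@expi R) t.
Proof.
apply/cpathP; split; rewrite /expi /=.
  apply: (@continuous_comp _ _ _ (fun x => 2 * pi * x) (@cos R)).
    by apply: cvgM; [exact: cvg_cst|exact: cvg_id].
  exact: continuous_cos.
apply: (@continuous_comp _ _ _ (fun x => 2 * pi * x) (@sin R)).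
  by apply: cvgM; [exact: cvg_cst|exact: cvg_id].
exact: continuous_sin.
Qed.

Lemma cmeas_cpath (f : R -> R[i]) : (forall t, cpath f t) ->
  cmeas setT (f : measurableTypeR R -> R[i]).
Proof.
move=> fc; split; apply: continuous_measurable_fun => t;
by have /cpathP[] := fc t.
Qed.

(** Mirrors the product structure of [cube], whose first component is the angle of coordinate
    [ord0]. *)
Definition mcons n (a : R[i]) (z : 'I_n -> R[i]) (k : 'I_n.+1) : R[i] :=
  if unlift ord0 k is Some j then z j else a.

Lemma torus_pt_mcons n (t : R) (x : Tn R n) :
  @torus_pt R n.+1 (t, x) = mcons (expi t) (torus_pt x).
Proof. by apply/funext => k; rewrite torus_pt_cons. Qed.

Lemma mcons_split n (z : 'I_n.+1 -> R[i]) :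
  z = mcons (z ord0) (fun j => z (lift ord0 j)).
Proof. by apply/funext => k; rewrite /mcons; case: (unliftP ord0 k) => [j|] ->. Qed.

Lemma mcons0 n a (z : 'I_n -> R[i]) : mcons a z ord0 = a.
Proof. by rewrite /mcons unlift_none. Qed.

Lemma mconsS n a (z : 'I_n -> R[i]) j : mcons a z (lift ord0 j) = z j.
Proof. by rewrite /mcons liftK. Qed.

(** Induction on [n]: as a function of the first angle and the remaining point, the map is
    continuous in the former and, by induction, measurable in the latter, so
    [caratheodory_measurable] applies. *)
Lemma cmeas_torus n (F : ('I_n -> R[i]) -> R[i]) :
  (forall a, (forall k, normc (a k) = 1) -> mcontinuous_at F a) ->
  cmeas setT (fun x : Tn R n => F (torus_pt x)).
Proof.
elim: n F => [F _|n IH F Fc].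
  have -> : (fun x : Tn R 0 => F (torus_pt x)) = cst (F (fun=> 0)).
    by apply/funext => x /=; congr F; apply/funext; case.
  exact: cmeas_cst.
have p x : forall t, cpath (fun t => F (mcons (expi t) (@torus_pt R n x))) t.
  move=> t e e0.
  have [|dl d0 h] := Fc (mcons (expi t) (torus_pt x)) _ _ e0.
    by move=> k; rewrite /mcons; case: unlift => [j|];
      rewrite ?normc_torus_pt ?normc_expi.
  have [d1 d10 h1] := cpath_expi t d0; exists d1 => // s /h1 hs.
  apply: h => k; rewrite /mcons; case: unlift => [j|//].
  by rewrite subrr Normc.normc0.
have q t : cmeas setT (fun x : Tn R n => F (mcons (expi t) (torus_pt x))).
  apply: (IH (fun y => F (mcons (expi t) y))) => a a1 e e0.
  have [|dl d0 h] := Fc (mcons (expi t) a) _ _ e0.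
    by move=> k; rewrite /mcons; case: unlift => [j|];
      rewrite ?a1 ?normc_expi.
  exists dl => // b hb; apply: h => k; rewrite /mcons; case: unlift => [j|].
    exact: hb.
  by rewrite subrr Normc.normc0.
split.
  apply: (@caratheodory_measurable _ (Tn R n) R
    (fun z => cRe (F (@torus_pt R n.+1 z)))) => [x t|t].
    by under eq_fun do rewrite torus_pt_mcons; have /cpathP[] := p x t.
  by under eq_fun do rewrite torus_pt_mcons; have [] := q t.
apply: (@caratheodory_measurable _ (Tn R n) R
  (fun z => cIm (F (@torus_pt R n.+1 z)))) => [x t|t].
  by under eq_fun do rewrite torus_pt_mcons; have /cpathP[] := p x t.
by under eq_fun do rewrite torus_pt_mcons; have [] := q t.
Qed.

End torus_continuity.

(** * Cauchy's integral formula in one variable *)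

Section bisection.
Variable R : realType.
Variable Phi : R -> R -> R -> R -> R[i].
Hypothesis Phi_split1 : forall a m b c d, a <= m <= b -> c <= d ->
  Phi a b c d = Phi a m c d + Phi m b c d.
Hypothesis Phi_split2 : forall a b c m d, a <= b -> c <= m <= d ->
  Phi a b c d = Phi a b c m + Phi a b m d.

Local Notation rect := (R * R * R * R)%type.
Let P (q : rect) := Phi q.1.1.1 q.1.1.2 q.1.2 q.2.

Let quarter (s : bool * bool) (q : rect) : rect :=
  let: (a, b, c, d) := q in
  let m := (a + b) / 2 in let k := (c + d) / 2 in
  (if s.1 then a else m, if s.1 then m else b,
   if s.2 then c else k, if s.2 then k else d).

(** The default [q] is never taken on a genuine rectangle, by [bestP]. *)
Let best (q : rect) : rect :=
  if [pick s | normc (P q) <= 4 * normc (P (quarter s q))] is Some s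
  then quarter s q else q.

Let half_le (a b : R) : a <= b -> a <= (a + b) / 2 <= b.
Proof. by lra. Qed.

(** Were all four quarters to violate the bound, additivity of [Phi] and the triangle inequality
    would make the modulus on the whole rectangle less than itself. *)
Let bestP a b c d : a <= b -> c <= d ->
  exists s, best (a, b, c, d) = quarter s (a, b, c, d) /\
    normc (P (a, b, c, d)) <= 4 * normc (P (best (a, b, c, d))).
Proof.
move=> ab cd; rewrite /best; case: pickP => [s hs|none]; first by exists s.
exfalso; pose Q := (a, b, c, d).
have lt4 s : 4 * normc (P (quarter s Q)) < normc (P Q).
  by rewrite ltNge; apply/negP => h; have := none s; rewrite h.
have hab := half_le ab; have hcd := half_le cd.
have E : P Q = P (quarter (true, true) Q) + P (quarter (true, false) Q)
    + (P (quarter (false, true) Q) + P (quarter (false, false) Q)).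
  rewrite /P /=; move/andP: (hab) => [h1 h2].
  by rewrite (Phi_split1 hab)// (Phi_split2 h1 hcd) (Phi_split2 h2 hcd).
have := le_normcD (P (quarter (true, true) Q) + P (quarter (true, false) Q))
    (P (quarter (false, true) Q) + P (quarter (false, false) Q)).
rewrite -E.
have := le_normcD (P (quarter (true, true) Q)) (P (quarter (true, false) Q)).
have := le_normcD (P (quarter (false, true) Q)) (P (quarter (false, false) Q)).
have := lt4 (true, true); have := lt4 (true, false).
have := lt4 (false, true); have := lt4 (false, false).
lra.
Qed.

(** Goursat's argument for an abstract additive function of rectangles. Bisecting [k] times loses a
    factor at most [4 ^+ k] in [Phi], exactly the factor by which the squared size shrinks; a local
    bound of smaller order than the squared size therefore forces [Phi] to vanish. *)
Lemma bisection_eq0 a b c d : a <= b -> c <= d ->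
  (forall t u, a <= t <= b -> c <= u <= d -> forall e : R, 0 < e ->
     exists2 delta : R, 0 < delta &
       forall a' b' c' d', a <= a' -> b' <= b -> c <= c' -> d' <= d ->
         a' <= t <= b' -> c' <= u <= d' -> b' - a' < delta -> d' - c' < delta ->
         normc (Phi a' b' c' d') <= e * (b' - a' + (d' - c')) ^+ 2) ->
  Phi a b c d = 0.
Proof.
move=> ab cd loc; pose Q k := iter k best (a, b, c, d).
pose A k := (Q k).1.1.1; pose B k := (Q k).1.1.2.
pose C k := (Q k).1.2; pose D k := (Q k).2.
have QE k : Q k = (A k, B k, C k, D k).
  by rewrite /A /B /C /D; case: (Q k) => [[[? ?] ?] ?].
(* The first group fixes sides and modulus at stage [k]; the second records that stage [k.+1] is
   nested in it. *)
have inv k : [/\ A k <= B k, C k <= D k, B k - A k = (b - a) / 2 ^+ k,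
   D k - C k = (d - c) / 2 ^+ k & normc (Phi a b c d) <= 4 ^+ k * normc (P (Q k))] /\
   [/\ A k <= A k.+1, B k.+1 <= B k, C k <= C k.+1 & D k.+1 <= D k].
  elim: k => [|k [[h1 h2 h3 h4 h5] _]].
    split; first by rewrite /A /B /C /D /= !expr0 !divr1 mul1r.
    have [s [Es _]] := bestP ab cd.
    have := half_le ab; have := half_le cd.
    rewrite /A /B /C /D /Q /= Es /=.
    by case: s {Es} => [[] []] /= /andP[? ?] /andP[? ?]; split.
  have [s [Es hs]] := bestP h1 h2.
  have QS : Q k.+1 = quarter s (Q k) by rewrite {1}/Q iterS -/(Q k) QE.
  have AS : A k.+1 = if s.1 then A k else (A k + B k) / 2.
    by rewrite {1}/A QS QE.
  have BS : B k.+1 = if s.1 then (A k + B k) / 2 else B k.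
    by rewrite {1}/B QS QE.
  have CS : C k.+1 = if s.2 then C k else (C k + D k) / 2.
    by rewrite {1}/C QS QE.
  have DS : D k.+1 = if s.2 then (C k + D k) / 2 else D k.
    by rewrite {1}/D QS QE.
  have hAB := half_le h1; have hCD := half_le h2.
  have g1 : A k.+1 <= B k.+1 by rewrite AS BS; case: s.1; move: hAB => /andP[].
  have g2 : C k.+1 <= D k.+1 by rewrite CS DS; case: s.2; move: hCD => /andP[].
  split; first split => //.
  - by rewrite exprS invfM mulrCA -h3 AS BS; case: s.1; lra.
  - by rewrite exprS invfM mulrCA -h4 CS DS; case: s.2; lra.
  - rewrite (le_trans h5)// exprSr -mulrA ler_wpM2l ?exprn_ge0//.
    by rewrite QS QE; move: hs; rewrite Es.
  have [s' [Es' _]] := bestP g1 g2.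
  have QS' : Q k.+2 = quarter s' (Q k.+1) by rewrite {1}/Q iterS -/(Q k.+1) QE.
  have := half_le g1; have := half_le g2.
  have -> : A k.+2 = (quarter s' (Q k.+1)).1.1.1 by rewrite -QS'.
  have -> : B k.+2 = (quarter s' (Q k.+1)).1.1.2 by rewrite -QS'.
  have -> : C k.+2 = (quarter s' (Q k.+1)).1.2 by rewrite -QS'.
  have -> : D k.+2 = (quarter s' (Q k.+1)).2 by rewrite -QS'.
  rewrite QE /=.
  by case: s' {Es' QS'} => [[] []] /= /andP[? ?] /andP[? ?]; split.
have mon (u : nat -> R) : (forall k, u k <= u k.+1) -> forall i j, (i <= j)%N -> u i <= u j.
  move=> hu i j /subnK <-; elim: (j - i)%N => // l; rewrite addSn => h.
  exact: le_trans h (hu _).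
have Am := mon A (fun k => let: And4 h _ _ _ := (inv k).2 in h).
have Cm := mon C (fun k => let: And4 _ _ h _ := (inv k).2 in h).
have Bm i j : (i <= j)%N -> B j <= B i.
  move=> ij; rewrite -lerN2; apply: (mon (fun k => - B k)) => // k.
  by rewrite lerN2; case: (inv k).2.
have Dm i j : (i <= j)%N -> D j <= D i.
  move=> ij; rewrite -lerN2; apply: (mon (fun k => - D k)) => // k.
  by rewrite lerN2; case: (inv k).2.
have AB i j : A i <= B j.
  have := Am _ _ (leq_maxl i j); have := Bm _ _ (leq_maxr i j).
  by case: (inv (maxn i j)) => [[h _ _ _ _] _] h1 h2; exact: le_trans (le_trans h2 h) h1.
have CD i j : C i <= D j.
  have := Cm _ _ (leq_maxl i j); have := Dm _ _ (leq_maxr i j).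
  by case: (inv (maxn i j)) => [[_ h _ _ _] _] h1 h2; exact: le_trans (le_trans h2 h) h1.
(* The point common to all nested rectangles, at which the local bound is used. *)
pose t := sup (range A); pose u := sup (range C).
have tA k : A k <= t <= B k.
  apply/andP; split.
    apply: ub_le_sup; last by exists k.
    by exists (B 0%N) => _ [i _ <-]; exact: AB.
  by apply: ge_sup; [exists (A 0%N); exists 0%N|move=> _ [i _ <-]; exact: AB].
have uC k : C k <= u <= D k.
  apply/andP; split.
    apply: ub_le_sup; last by exists k.
    by exists (D 0%N) => _ [i _ <-]; exact: CD.
  by apply: ge_sup; [exists (C 0%N); exists 0%N|move=> _ [i _ <-]; exact: CD].
apply/eqP; rewrite -normc_eq0 eq_le normc_ge0 andbT leNgt; apply/negP => eta0.
(* The [+ 1] keeps [L] positive for a degenerate rectangle. As [L] exceeds the initial size, the [e]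
   below turns the local bound into the contradiction that [Phi] has at most half its own
   modulus. *)
pose L := b - a + (d - c) + 1.
have L0 : 0 < L by rewrite /L ltr_wpDl// addr_ge0// subr_ge0.
pose e := normc (Phi a b c d) / 2 / L ^+ 2.
have e0 : 0 < e by rewrite divr_gt0 ?exprn_gt0// divr_gt0.
have [dl dl0 hdl] := loc t u (tA 0%N) (uC 0%N) e e0.
have [k hk] : exists k : nat, L / 2 ^+ k < dl.
  have cv : (fun k : nat => L * (2^-1) ^+ k) @ \oo --> (0 : R).
    rewrite -[X in _ --> X](mulr0 L); apply: cvgM; first exact: cvg_cst.
    by apply: cvg_expr; rewrite ger0_norm ?invr_ge0// invf_lt1// ltr1n.
  move/cvgrPdist_lt : cv => /(_ _ dl0) [k _ /(_ k (leqnn k))] h; exists k.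
  by move: h; rewrite /= sub0r normrN exprVn ger0_norm// mulr_ge0 ?ltW ?invr_gt0 ?exprn_gt0.
have [[h1 h2 h3 h4 h5] _] := inv k.
have k2 : 0 < 2 ^+ k :> R by rewrite exprn_gt0.
have le1 : B k - A k < dl.
  rewrite h3 (le_lt_trans _ hk)// ler_pM2r ?invr_gt0// /L; move: cd; lra.
have le2 : D k - C k < dl.
  rewrite h4 (le_lt_trans _ hk)// ler_pM2r ?invr_gt0// /L; move: ab; lra.
have := hdl (A k) (B k) (C k) (D k) (Am 0%N k isT) (Bm 0%N k isT) (Cm 0%N k isT)
  (Dm 0%N k isT) (tA k) (uC k) le1 le2.
have -> : Phi (A k) (B k) (C k) (D k) = P (Q k) by rewrite QE.
rewrite h3 h4 -mulrDl exprMn => h6.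
have := le_trans h5 (ler_wpM2l (exprn_ge0 k (ltW (ltr0n _ 4))) h6).
rewrite exprVn -exprM mulnC exprM (_ : 2 ^+ 2 = 4 :> R); last by rewrite -natrX.
have k4 : 4 ^+ k != 0 :> R by rewrite expf_neq0.
rewrite mulrCA [_ / _]mulrC mulVKf// => h7.
suff : normc (Phi a b c d) <= normc (Phi a b c d) / 2.
  by move: eta0; lra.
rewrite (le_trans h7)// /e; set N2 := normc _ / 2.
rewrite -mulrA ler_piMr ?divr_ge0 ?normc_ge0//.
rewrite ler_pdivrMl ?exprn_gt0// mulr1 ler_sqr ?nnegrE; rewrite /L.
- by lra.
- by move: ab cd; lra.
- by move: ab cd; lra.
Qed.

End bisection.

(** * Algebra of continuous curves, the exponential, and integrals over segments *)

Section paths.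
Variable R : realType.
Implicit Types (f g : R -> R[i]) (t : R).

Lemma cpathD f g t : cpath f t -> cpath g t -> cpath (fun s => f s + g s) t.
Proof.
move=> /cpathP[f1 f2] /cpathP[g1 g2]; apply/cpathP; split.
  rewrite (_ : (fun _ => _) = (fun s => cRe (f s) + cRe (g s))); first exact: cvgD.
  by apply/funext => s; rewrite cReD.
rewrite (_ : (fun _ => _) = (fun s => cIm (f s) + cIm (g s))); first exact: cvgD.
by apply/funext => s; rewrite cImD.
Qed.

Lemma cpathM f g t : cpath f t -> cpath g t -> cpath (fun s => f s * g s) t.
Proof.
move=> /cpathP[f1 f2] /cpathP[g1 g2]; apply/cpathP; split.
  rewrite (_ : (fun _ => _) =
    (fun s => cRe (f s) * cRe (g s) - cIm (f s) * cIm (g s))).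
    by apply: cvgB; exact: cvgM.
  by apply/funext => s; rewrite cReM.
rewrite (_ : (fun _ => _) =
  (fun s => cRe (f s) * cIm (g s) + cIm (f s) * cRe (g s))).
  by apply: cvgD; exact: cvgM.
by apply/funext => s; rewrite cImM.
Qed.

Lemma cpathB f g t : cpath f t -> cpath g t -> cpath (fun s => f s - g s) t.
Proof.
move=> fc gc; have -> : (fun s => f s - g s) = (fun s => f s + (-1) * g s).
  by apply/funext => s; rewrite mulN1r.
by apply: cpathD => //; apply: cpathM => //; exact: cpath_cst.
Qed.

Lemma cpathV f t : f t != 0 -> cpath f t -> cpath (fun s => (f s)^-1) t.
Proof.
move=> ft0 /cpathP[f1 f2].
have n0 : cRe (f t) ^+ 2 + cIm (f t) ^+ 2 != 0.
  by rewrite -normc_sqr sqrf_eq0 normc_eq0.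
have cV : {for t, continuous (fun s => (cRe (f s) ^+ 2 + cIm (f s) ^+ 2)^-1)}.
  by apply: cvgV => //; apply: cvgD; under eq_fun do rewrite expr2; exact: cvgM.
apply/cpathP; split.
  have -> : (fun s => cRe (f s)^-1) =
      (fun s => cRe (f s) * (cRe (f s) ^+ 2 + cIm (f s) ^+ 2)^-1).
    by apply/funext => s; case: (f s).
  exact: cvgM.
have -> : (fun s => cIm (f s)^-1) =
    (fun s => - (cIm (f s) * (cRe (f s) ^+ 2 + cIm (f s) ^+ 2)^-1)).
  by apply/funext => s; case: (f s).
by apply: cvgN; exact: cvgM.
Qed.

Definition ccontinuous_at (F : R[i] -> R[i]) (a : R[i]) :=
  forall e : R, 0 < e -> exists2 delta : R, 0 < delta &
    forall b, normc (b - a) < delta -> normc (F b - F a) < e.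

Lemma cpath_comp (F : R[i] -> R[i]) f t :
  ccontinuous_at F (f t) -> cpath f t -> cpath (fun s => F (f s)) t.
Proof.
move=> Fc fc e e0; have [d1 d10 h1] := Fc _ e0; have [d2 d20 h2] := fc _ d10.
by exists d2 => // s /h2 /h1.
Qed.

Lemma expiD (s t : R) : expi (s + t) = expi s * expi t.
Proof.
rewrite /expi mulrDr cosD sinD; apply: eqc; rewrite ?cReM ?cImM //=.
by rewrite addrC [cos _ * sin _]mulrC addrC [sin _ * _]mulrC addrC; ring.
Qed.

Lemma expi0 : expi 0 = 1 :> R[i].
Proof. by rewrite /expi mulr0 cos0 sin0. Qed.

Lemma expi1 : expi 1 = 1 :> R[i].
Proof. by rewrite /expi mulr1 mulrC mulr_natr cos2pi sin2pi. Qed.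

Lemma expiX (t : R) k : expi t ^+ k = expi (k%:R * t).
Proof.
elim: k => [|k IH]; first by rewrite mul0r expi0 expr0.
by rewrite exprS IH -expiD -nat1r mulrDl mul1r.
Qed.

Local Notation leb := (@lebesgue_measure R).
Local Notation itg a b f := (cintegral leb `[a, b] f).

Lemma leb_itv_lty (a b : R) : (leb `[a, b] < +oo)%E.
Proof. by rewrite lebesgue_measure_itv /=; case: ifP => _; rewrite ?ltry// -EFinD ltry. Qed.

Lemma fine_leb_itv (a b : R) : a <= b -> fine (leb `[a, b]%classic) = b - a.
Proof.
move=> ab; rewrite lebesgue_measure_itv /= lte_fin.
case: ltP => //= ba; have -> : a = b by apply/le_anti; rewrite ab ba.
by rewrite subrr.
Qed.

Lemma cpath_integrable (a b : R) f :
  (forall t, a <= t <= b -> cpath f t) -> cintegrable leb `[a, b] f.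
Proof.
move=> fc; split; apply: continuous_compact_integrable;
  try exact: segment_compact;
  by apply: continuous_in_subspaceT => t; rewrite inE /= in_itv /= => /fc /cpathP[].
Qed.

Lemma itg_split (a m b : R) f : a <= m <= b ->
  (forall t, a <= t <= b -> cpath f t) -> itg a b f = itg a m f + itg m b f.
Proof.
move=> /andP[am mb] fc; have [f1 f2] := cpath_integrable fc.
have sp (g : R -> R) : leb.-integrable `[a, b] (EFin \o g) ->
    \int[leb]_(x in `[a, b]) g x =
    \int[leb]_(x in `[a, m]) g x + \int[leb]_(x in `[m, b]) g x.
  move=> gi; have := @Rintegral_itvB R g (BLeft a) (BRight b) m gi.
  rewrite !bnd_simp => /(_ am mb) /eqP; rewrite subr_eq => /eqP ->.
  rewrite addrC; congr (_ + _); apply: Rintegral_itv_obnd_cbnd.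
  apply: integrableS gi => //.
  by apply: subset_itvr; rewrite bnd_simp.
by apply: eqc; rewrite ?cReD ?cImD /=; apply: sp.
Qed.

Lemma itg_bound (a b : R) f (M : R) : a <= b ->
  (forall t, a <= t <= b -> cpath f t) ->
  (forall t, a <= t <= b -> normc (f t) <= M) -> normc (itg a b f) <= M * (b - a).
Proof.
move=> ab fc fM.
rewrite -(fine_leb_itv ab); apply: normc_cintegral_bound.
- exact: measurable_itv.
- exact: leb_itv_lty.
- exact: cintegrable_cmeas (cpath_integrable fc).
- by move=> t /=; rewrite in_itv /=; exact: fM.
Qed.

Lemma itg_expi (c a b : R) : a <= b ->
  itg a b (fun t => Complex 0 (2 * pi * c) * expi (c * t)) =
  expi (c * b) - expi (c * a).
Proof.
(* The degenerate interval is split off because the fundamental theorem of calculus is applied with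
   [a < b]. *)
rewrite le_eqVlt => /predU1P[->|ab].
  by rewrite subrr set_itv1 /cintegral !Rintegral_set1.
have dF (F f : R -> R) : (forall t, is_derive t 1 F (f t)) -> continuous f ->
    \int[leb]_(t in `[a, b]) f t = F b - F a.
  move=> dF cf; rewrite /Rintegral (@continuous_FTC2 _ f F)//.
  - exact: continuous_subspaceT.
  - have cF : continuous F by move=> t; apply: differentiable_continuous;
      apply/derivable1_diffP; case: (dF t).
    split; first by move=> t _; case: (dF t).
      by apply: cvg_at_right_filter; exact: cF.
    by apply: cvg_at_left_filter; exact: cF.
  - by move=> t _; rewrite derive1E; case: (dF t).
have clin : continuous (fun t : R => 2 * pi * (c * t)).
  by move=> t; apply: cvgM; [exact: cvg_cst|apply: cvgM; [exact: cvg_cst|exact: cvg_id]].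
have ccos : continuous (fun t : R => cos (2 * pi * (c * t))).
  by move=> t; apply: (@continuous_comp _ _ _ (fun t => 2 * pi * (c * t)) (@cos R)); [exact: clin|exact: continuous_cos].
have csin : continuous (fun t : R => sin (2 * pi * (c * t))).
  by move=> t; apply: (@continuous_comp _ _ _ (fun t => 2 * pi * (c * t)) (@sin R)); [exact: clin|exact: continuous_sin].
have dlin t : is_derive t (1 : R) (fun t : R => 2 * pi * (c * t)) (2 * pi * c).
  by apply: is_derive_eq; rewrite /GRing.scale /= mulr1.
have dcos t : is_derive t (1 : R) (fun t : R => cos (2 * pi * (c * t)))
    (- (2 * pi * c * sin (2 * pi * (c * t)))).
  apply: (is_derive_eq (is_derive1_comp (is_derive_cos _) (dlin t))).
  by rewrite mulNr mulrC.
have dsin t : is_derive t (1 : R) (fun t : R => sin (2 * pi * (c * t)))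
    (2 * pi * c * cos (2 * pi * (c * t))).
  apply: (is_derive_eq (is_derive1_comp (is_derive_sin _) (dlin t))).
  by rewrite mulrC.
apply: eqc.
  transitivity (cos (2 * pi * (c * b)) - cos (2 * pi * (c * a))); last by rewrite cReD.
  rewrite -(dF _ _ dcos).
    by apply: eq_Rintegral => t _; rewrite cReM /=; ring.
  by move=> t; apply: cvgN; apply: cvgM; [exact: cvg_cst|exact: csin].
transitivity (sin (2 * pi * (c * b)) - sin (2 * pi * (c * a))); last by rewrite cImD.
rewrite -(dF _ _ dsin).
  by apply: eq_Rintegral => t _; rewrite cImM /=; ring.
by move=> t; apply: cvgM; [exact: cvg_cst|exact: ccos].
Qed.

Lemma normc_2pii : normc (Complex 0 (2 * pi : R)) = 2 * pi.
Proof.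
by rewrite normc_sqrtE /= expr0n add0r sqrtr_sqr ger0_norm// mulr_ge0// pi_ge0.
Qed.

(** The difference is the integral of the derivative of [expi], whose modulus is [2 * pi]. *)
Lemma expi_lipschitz (s t : R) : normc (expi s - expi t) <= 2 * pi * `|s - t|.
Proof.
wlog ts : s t / t <= s => [hw|].
  by have [/hw //|/ltW /hw] := leP t s; rewrite normcB distrC.
have E : expi s - expi t = itg t s (fun u => Complex 0 (2 * pi * 1) * expi (1 * u)).
  by rewrite itg_expi// !mul1r.
rewrite E [`|_|]ger0_norm ?subr_ge0//; apply: itg_bound => // u _.
  apply: cpathM; first exact: cpath_cst.
  by under eq_fun do rewrite mul1r; exact: cpath_expi.
by rewrite Normc.normcM normc_expi mulr1 mulr1 normc_2pii.
Qed.

End paths.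

(** * Cauchy's theorem for circles contracted towards an interior point *)

Section goursat.
Variable R : realType.
Local Notation leb := (@lebesgue_measure R).
Local Notation itg a b f := (cintegral leb `[a, b] f).

Definition cderivable_at (F : R[i] -> R[i]) (a : R[i]) :=
  exists L : R[i], forall e : R, 0 < e -> exists2 delta : R, 0 < delta &
    forall h, normc h < delta -> normc (F (a + h) - F a - L * h) <= e * normc h.

Lemma cderivable_continuous F a : cderivable_at F a -> ccontinuous_at F a.
Proof.
move=> [L hL] e e0; have [d0 d00 h] := hL 1 ltr01.
pose K := 1 + normc L; have K0 : 0 < K by rewrite ltr_wpDr ?normc_ge0.
exists (Num.min d0 (e / K)); first by rewrite lt_min d00 divr_gt0.
move=> b; rewrite lt_min => /andP[/h]; rewrite [a + _]addrC subrK mul1r => h1 h2.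
have -> : F b - F a = F b - F a - L * (b - a) + L * (b - a) by rewrite subrK.
rewrite (le_lt_trans (le_normcD _ _))// Normc.normcM.
rewrite (@le_lt_trans _ _ (K * normc (b - a)))//.
  by rewrite /K mulrDl mul1r lerD2r.
by rewrite mulrC -ltr_pdivlMr.
Qed.

Variables (F : R[i] -> R[i]) (w : R[i]).
Hypothesis w1 : normc w < 1.
Hypothesis dF : forall a, normc a <= 1 -> cderivable_at F a.

Let beta (u : R) : R[i] := Complex 0 (2 * pi) * expi u / (expi u - w).

Lemma expi_subr_lb (u : R) : 1 - normc w <= normc (expi u - w).
Proof. by rewrite -(normc_expi u) normc_triB. Qed.

Lemma expi_sub_neq0 (u : R) : expi u - w != 0.
Proof.
by rewrite -normc_eq0 gt_eqF// (lt_le_trans _ (expi_subr_lb u))// subr_gt0.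
Qed.

Let cpath_beta u : cpath beta u.
Proof.
apply: cpathM; first by apply: cpathM; [exact: cpath_cst|exact: cpath_expi].
apply: cpathV; first exact: expi_sub_neq0.
by apply: cpathB; [exact: cpath_expi|exact: cpath_cst].
Qed.

Let B := 2 * pi / (1 - normc w).
Let B0 : 0 <= B.
Proof. by rewrite divr_ge0 ?mulr_ge0 ?pi_ge0// subr_ge0 ltW. Qed.

Let normc_beta u : normc (beta u) <= B.
Proof.
rewrite /beta !Normc.normcM normc_2pii normc_expi mulr1 Normc.normcV ler_wpM2l//.
  by rewrite mulr_ge0// pi_ge0.
by rewrite lef_pV2 ?posrE ?expi_subr_lb ?subr_gt0// (lt_le_trans _ (expi_subr_lb u))// subr_gt0.
Qed.

Section annulus.
Variable eps : R.
Hypothesis eps01 : 0 < eps <= 1.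

(** Extends the radial parameter continuously from [[eps, 1]] to the whole line. The contracted
    circles then stay in the closed disc and [alpha] stays bounded for every real [t], so the path
    lemmas need no side condition on [t]. *)
Let clamp (t : R) := if t < eps then eps else if 1 < t then 1 else t.

Let clampP t : eps <= clamp t <= 1.
Proof.
rewrite /clamp; case/andP: eps01 => e0 e1; case: ltP => h; first by rewrite lexx.
by case: ltP => h'; rewrite ?lexx ?e1 ?h ?h'.
Qed.

Let clampE t : eps <= t <= 1 -> clamp t = t.
Proof. by rewrite /clamp => /andP[h1 h2]; rewrite !ltNge h1 h2. Qed.

Let clamp_lip s t : `|clamp s - clamp t| <= `|s - t|.
Proof.
case/andP: eps01 => e0 e1.
have key s' t' : s' <= t' -> 0 <= clamp t' - clamp s' <= t' - s'.
  move=> st; rewrite /clamp; case: (ltP t' eps) => h1; case: (ltP s' eps) => h2;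
  case: (ltP 1 t') => h3; case: (ltP 1 s') => h4; lra.
have [st|/ltW st] := leP s t.
  have /andP[h1 h2] := key _ _ st.
  by rewrite distrC ger0_norm// distrC ger0_norm// subr_ge0.
have /andP[h1 h2] := key _ _ st.
by rewrite ger0_norm// ger0_norm// subr_ge0.
Qed.

Let cpath_clamp t : cpath (fun s => (clamp s)%:C%C) t.
Proof.
move=> e e0; exists e => // s hs; rewrite -realcB normc_real.
exact: le_lt_trans (clamp_lip _ _) hs.
Qed.

Let Gam (t u : R) : R[i] := w + (clamp t)%:C%C * (expi u - w).

Let clamp_ge0 t : 0 <= clamp t.
Proof. by have /andP[h _] := clampP t; case/andP: eps01 => /ltW e0 _; exact: le_trans h. Qed.

Let clamp_neq0 t : (clamp t)%:C%C != 0.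
Proof.
rewrite -normc_eq0 normc_real normr_eq0 gt_eqF//.
by have /andP[h _] := clampP t; case/andP: eps01 => e0 _; exact: lt_le_trans h.
Qed.

Let Gam_le1 t u : normc (Gam t u) <= 1.
Proof.
have -> : Gam t u = (1 - clamp t)%:C%C * w + (clamp t)%:C%C * expi u.
  by rewrite /Gam realcB mulrBr mulrBl mul1r; ring.
have /andP[_ c1] := clampP t; have c0 := clamp_ge0 t.
rewrite (le_trans (le_normcD _ _))// !Normc.normcM !normc_real normc_expi mulr1.
rewrite !ger0_norm ?subr_ge0//.
rewrite -lerBrDr ler_piMr ?subr_ge0// ltW//.
Qed.

Let g (t u : R) := F (Gam t u).

Let cpath_Gam1 u t : cpath (Gam ^~ u) t.
Proof.
apply: cpathD; first exact: cpath_cst.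
by apply: cpathM; [exact: cpath_clamp|exact: cpath_cst].
Qed.

Let cpath_Gam2 t u : cpath (Gam t) u.
Proof.
apply: cpathD; first exact: cpath_cst.
apply: cpathM; first exact: cpath_cst.
by apply: cpathB; [exact: cpath_expi|exact: cpath_cst].
Qed.

Let cpath_g1 u t : cpath (g ^~ u) t.
Proof.
apply: (@cpath_comp _ F); last exact: cpath_Gam1.
by apply: cderivable_continuous; exact: dF.
Qed.

Let cpath_g2 t u : cpath (g t) u.
Proof.
apply: (@cpath_comp _ F); last exact: cpath_Gam2.
by apply: cderivable_continuous; exact: dF.
Qed.

Let alpha (t : R) : R[i] := ((clamp t)%:C%C)^-1.

Let cpath_alpha t : cpath alpha t.
Proof. by apply: cpathV; [exact: clamp_neq0|exact: cpath_clamp]. Qed.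

Let normc_alpha t : normc (alpha t) <= eps^-1.
Proof.
have /andP[h _] := clampP t; have /andP[e0 _] := eps01.
rewrite Normc.normcV normc_real ger0_norm// lef_pV2 ?posrE//.
exact: lt_le_trans h.
Qed.

(* The integral of [F(z) dz / (z - w)] along the boundary of the image of a
   rectangle under [(t, u) |-> w + t (expi u - w)], where
   [dz / (z - w) = dt / t + beta(u) du]. *)
Let Phi a b c d := itg c d (fun u => (g b u - g a u) * beta u)
  - itg a b (fun t => (g t d - g t c) * alpha t).

(** Stated for arbitrary [h] to serve both [g] and the remainder [r] of [Phi_local]. *)
Let cpath_I1 (h : R -> R -> R[i]) a b u : (forall t, cpath (h t) u) ->
  cpath (fun u => (h b u - h a u) * beta u) u.
Proof. by move=> hc; apply: cpathM; [exact: cpathB|exact: cpath_beta]. Qed.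

Let cpath_I2 (h : R -> R -> R[i]) c d t : (forall u, cpath (h ^~ u) t) ->
  cpath (fun t => (h t d - h t c) * alpha t) t.
Proof.
move=> hc; apply: cpathM; last exact: cpath_alpha.
by apply: cpathB; exact: hc.
Qed.

Let Phi_split1 a m b c d : a <= m <= b -> c <= d ->
  Phi a b c d = Phi a m c d + Phi m b c d.
Proof.
move=> amb cd; rewrite /Phi (itg_split amb); last first.
  by move=> t _; apply: cpath_I2 => u; exact: cpath_g1.
rewrite (_ : itg c d _ = itg c d (fun u => (g m u - g a u) * beta u)
   + itg c d (fun u => (g b u - g m u) * beta u)); first by ring.
rewrite -cintegralD.
- by apply: eq_cintegral => u _; ring.
- exact: measurable_itv.
- by apply: cpath_integrable => u _; apply: cpath_I1 => t; exact: cpath_g2.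
- by apply: cpath_integrable => u _; apply: cpath_I1 => t; exact: cpath_g2.
Qed.

Let Phi_split2 a b c m d : a <= b -> c <= m <= d ->
  Phi a b c d = Phi a b c m + Phi a b m d.
Proof.
move=> ab cmd; rewrite /Phi (itg_split cmd); last first.
  by move=> u _; apply: cpath_I1 => t; exact: cpath_g2.
rewrite (_ : itg a b _ = itg a b (fun t => (g t m - g t c) * alpha t)
   + itg a b (fun t => (g t d - g t m) * alpha t)); first by ring.
rewrite -cintegralD.
- by apply: eq_cintegral => u _; ring.
- exact: measurable_itv.
- by apply: cpath_integrable => t _; apply: cpath_I2 => u; exact: cpath_g1.
- by apply: cpath_integrable => t _; apply: cpath_I2 => u; exact: cpath_g1.
Qed.

(** A Lipschitz constant for [Gam]: [2] bounds [expi u - w], the factor of the radial variation, and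
    [2 * pi] is the Lipschitz constant of [expi]; the sum dominates both. *)
Let K : R := 2 * pi + 2.
Let K0 : 0 < K.
Proof. by rewrite ltr_wpDl// mulr_ge0// pi_ge0. Qed.

Let Gam_lip t u t' u' : normc (Gam t u - Gam t' u') <= K * (`|t - t'| + `|u - u'|).
Proof.
have -> : Gam t u - Gam t' u' =
   (clamp t - clamp t')%:C%C * (expi u - w) + (clamp t')%:C%C * (expi u - expi u').
  by rewrite /Gam realcB; ring.
have /andP[_ c1] := clampP t'.
rewrite (le_trans (le_normcD _ _))// !Normc.normcM !normc_real (ger0_norm (clamp_ge0 t')).
have h1 : normc (expi u - w) <= 2.
  by rewrite (le_trans (le_normcD _ _))// normc_expi normcN -[2]/(1 + 1) lerD2l ltW.
have h2 := clamp_lip t t'.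
have h3 := expi_lipschitz u u'.
have h4 : `|clamp t - clamp t'| * normc (expi u - w) <= `|t - t'| * 2.
  by apply: ler_pM => //; exact: normc_ge0.
have h5 : clamp t' * normc (expi u - expi u') <= 1 * (2 * pi * `|u - u'|).
  by apply: ler_pM => //; exact: normc_ge0.
have h6 : 0 <= 2 * pi * `|t - t'| by rewrite !mulr_ge0 ?pi_ge0.
have h7 : 0 <= `|u - u'| by [].
have h8 : 0 <= 2 * `|u - u'| by rewrite mulr_ge0.
rewrite (le_trans (lerD h4 h5))// -subr_ge0.
rewrite [leRHS](_ : _ = 2 * pi * `|t - t'| + 2 * `|u - u'|); first exact: addr_ge0.
by rewrite /K; ring.
Qed.

(** Replace [F] by its first-order expansion at [Gam t u]. The affine part contributes nothing to
    [Phi], and the remainder is at most [e' * K * S] on the boundary; integrating over sides of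
    length at most [S] gives the second factor [S]. *)
Let Phi_local t u : eps <= t <= 1 -> forall e : R, 0 < e ->
  exists2 delta : R, 0 < delta &
  forall a b c d, eps <= a -> b <= 1 -> a <= t <= b -> c <= u <= d ->
    b - a < delta -> d - c < delta ->
    normc (Phi a b c d) <= e * (b - a + (d - c)) ^+ 2.
Proof.
move=> t01 e e0; have [L hL] := dF (Gam_le1 t u).
have /andP[ep0 ep1] := eps01.
have AB : 0 < eps^-1 + B by rewrite ltr_wpDr// invr_gt0.
(* The [2] comes from a difference of two remainders, [K] from [Gam_lip], and [eps^-1] and [B] bound
   the weights [alpha] and [beta]. *)
pose e' := e / (2 * K * (eps^-1 + B)).
have e'0 : 0 < e' by rewrite divr_gt0// !mulr_gt0.
have [d0 d00 hd0] := hL _ e'0.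
(* Both sides are shorter than this, so [K * S < d0] and the expansion of [F] is valid on the whole
   rectangle. *)
exists (d0 / (2 * K)); first by rewrite divr_gt0// mulr_gt0.
move=> a b c d ea b1 atb cud ba dc.
have ab : a <= b by case/andP: atb => h1 h2; exact: le_trans h2.
have cd : c <= d by case/andP: cud => h1 h2; exact: le_trans h2.
set S := b - a + (d - c).
have S0 : 0 <= S by rewrite addr_ge0 ?subr_ge0.
pose r t' u' := g t' u' - g t u - L * (Gam t' u' - Gam t u).
have rle t' u' : a <= t' <= b -> c <= u' <= d -> normc (r t' u') <= e' * (K * S).
  move=> ht hu; have hG : normc (Gam t' u' - Gam t u) <= K * S.
    rewrite (le_trans (Gam_lip _ _ _ _))// ler_pM2l//.
    by move: ht hu atb cud; rewrite /S => /andP[? ?] /andP[? ?] /andP[? ?] /andP[? ?];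
      apply: lerD; rewrite ler_norml; apply/andP; split; lra.
  rewrite (@le_trans _ _ (e' * normc (Gam t' u' - Gam t u)))//; last first.
    by rewrite ler_wpM2l// ltW.
  have := hd0 (Gam t' u' - Gam t u); rewrite [Gam t u + _]addrC subrK; apply.
  rewrite (le_lt_trans hG)// mulrC -ltr_pdivlMr// /S.
  have -> : d0 / K = d0 / (2 * K) + d0 / (2 * K).
    by field; rewrite gt_eqF.
  exact: ltrD.
have rc1 u' t' : cpath (r ^~ u') t'.
  apply: cpathB; first by apply: cpathB; [exact: cpath_g1|exact: cpath_cst].
  apply: cpathM; first exact: cpath_cst.
  by apply: cpathB; [exact: cpath_Gam1|exact: cpath_cst].
have rc2 t' u' : cpath (r t') u'.
  apply: cpathB; first by apply: cpathB; [exact: cpath_g2|exact: cpath_cst].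
  apply: cpathM; first exact: cpath_cst.
  by apply: cpathB; [exact: cpath_Gam2|exact: cpath_cst].
have aE : clamp a = a by apply: clampE; rewrite ea (le_trans ab).
have bE : clamp b = b by apply: clampE; rewrite b1 (le_trans ea).
(* The affine part has the same value in [E1] and [E2] and cancels in [Phi]. Here [expi u - w]
   cancels the denominator of [beta]; in [E2] the clamped radius cancels [alpha]. *)
have E1 : itg c d (fun u => (g b u - g a u) * beta u) =
    itg c d (fun u => (r b u - r a u) * beta u) +
    L * (b - a)%:C%C * (expi d - expi c).
  have -> : expi d - expi c = itg c d (fun u => Complex 0 (2 * pi * 1) * expi (1 * u)).
    by rewrite itg_expi// !mul1r.
  have i1 : cintegrable leb `[c, d] (fun u => Complex 0 (2 * pi * 1) * expi (1 * u)).
    apply: cpath_integrable => v _; apply: cpathM; first exact: cpath_cst.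
    by under eq_fun do rewrite mul1r; exact: cpath_expi.
  rewrite -cintegralZ//.
  rewrite -cintegralD//.
  - apply: eq_cintegral => v _; rewrite /r /Gam aE bE /beta mulr1 mul1r realcB.
    by field; exact: expi_sub_neq0.
  - by apply: cpath_integrable => v _; exact: (@cpath_I1 r).
  - exact: cintegrableZ.
have E2 : itg a b (fun t => (g t d - g t c) * alpha t) =
    itg a b (fun t => (r t d - r t c) * alpha t) +
    L * (b - a)%:C%C * (expi d - expi c).
  have -> : L * (b - a)%:C%C * (expi d - expi c) = itg a b (fun=> L * (expi d - expi c)).
    rewrite cintegral_cst; [|exact: measurable_itv|exact: leb_itv_lty].
    by rewrite mulrAC; congr (_ * _%:C)%C; exact/esym/fine_leb_itv.
  have ic : cintegrable leb `[a, b] (fun=> L * (expi d - expi c)).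
    by apply: cpath_integrable => v _; exact: cpath_cst.
  rewrite -cintegralD//.
  - apply: eq_cintegral => v _; rewrite /r /Gam /alpha.
    by field; exact: clamp_neq0.
  - by apply: cpath_integrable => v _; exact: (@cpath_I2 r).
rewrite /Phi E1 E2 opprD addrACA subrr addr0.
have b1' : normc (itg c d (fun u => (r b u - r a u) * beta u)) <=
    2 * (e' * (K * S)) * B * (d - c).
  apply: itg_bound => // [v _|v hv]; first exact: (@cpath_I1 r).
  rewrite Normc.normcM; apply: ler_pM; rewrite ?normc_ge0 ?normc_beta//.
  rewrite (le_trans (le_normcD _ _))// normcN mulr2n mulrDl mul1r.
  by apply: lerD; apply: rle => //; rewrite lexx ab.
have b2' : normc (itg a b (fun t => (r t d - r t c) * alpha t)) <=
    2 * (e' * (K * S)) * eps^-1 * (b - a).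
  apply: itg_bound => // [v _|v hv]; first exact: (@cpath_I2 r).
  rewrite Normc.normcM; apply: ler_pM; rewrite ?normc_ge0 ?normc_alpha//.
  rewrite (le_trans (le_normcD _ _))// normcN mulr2n mulrDl mul1r.
  by apply: lerD; apply: rle => //; rewrite lexx cd.
have eE : e = 2 * (e' * K) * (eps^-1 + B).
  by rewrite /e'; move: (eps^-1 + B) AB => X X0; field; rewrite !gt_eqF.
rewrite (le_trans (le_normcD _ _))// normcN (le_trans (lerD b1' b2'))//.
have X0 : 0 <= 2 * (e' * (K * S)).
  by rewrite mulr_ge0// mulr_ge0 ?(ltW e'0)// mulr_ge0// ltW.
have sd : d - c <= S by rewrite lerDr subr_ge0.
have sb : b - a <= S by rewrite lerDl subr_ge0.
have m1 : 2 * (e' * (K * S)) * B * (d - c) <= 2 * (e' * (K * S)) * B * S.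
  by rewrite ler_wpM2l// mulr_ge0.
have m2 : 2 * (e' * (K * S)) * eps^-1 * (b - a) <= 2 * (e' * (K * S)) * eps^-1 * S.
  by rewrite ler_wpM2l// mulr_ge0// invr_ge0 ltW.
rewrite (le_trans (lerD m1 m2))// {1}eE le_eqVlt; apply/orP; left; apply/eqP.
by ring.
Qed.

(** This is the vanishing of [Phi eps 1 0 1]: the two radial sides coincide because [expi] has
    period 1, so the integrals over the outer and inner circles agree. *)
Lemma cauchy_annulus :
  itg 0 1 (fun u => F (expi u) * beta u) =
  itg 0 1 (fun u => F (w + eps%:C%C * (expi u - w)) * beta u).
Proof.
have /andP[ep0 ep1] := eps01.
have : Phi eps 1 0 1 = 0.
  apply: (bisection_eq0 Phi_split1 Phi_split2) => //.
  move=> t u ht _ e e0; have [dl d0 h] := @Phi_local t u ht e e0.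
  by exists dl => // a b c d ha hb _ _; exact: h.
rewrite /Phi (_ : itg eps 1 _ = 0) ?subr0; last first.
  rewrite (_ : (fun t => _) = (fun=> 0)) ?cintegral0//.
  by apply/funext => t; rewrite /g /Gam expi0 expi1 subrr mul0r.
rewrite (_ : (fun u => _) =
   (fun u => F (expi u) * beta u - F (w + eps%:C%C * (expi u - w)) * beta u)); last first.
  apply/funext => u; rewrite /g /Gam !clampE ?ep1 ?lexx// rmorph1 mul1r.
  by rewrite (addrC w) subrK -mulrBl.
rewrite cintegralB; first by move/eqP; rewrite subr_eq0 => /eqP.
- exact: measurable_itv.
- apply: cpath_integrable => u _; apply: cpathM; last exact: cpath_beta.
  have := cpath_g2 1 u; rewrite /g /Gam clampE ?lexx ?ep1// rmorph1.
  by under eq_fun do rewrite mul1r (addrC w) subrK.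
- apply: cpath_integrable => u _; apply: cpathM; last exact: cpath_beta.
  by have := cpath_g2 eps u; rewrite /g /Gam clampE ?lexx ?ep1.
Qed.

End annulus.
End goursat.

(** * Cauchy's integral formula on the unit circle *)

Section cauchy_circle.
Variable R : realType.
Local Notation leb := (@lebesgue_measure R).
Local Notation itg a b f := (cintegral leb `[a, b] f).

Lemma conjc_expi (u : R) : conjc (expi u) = expi (- u).
Proof. by rewrite /expi mulrN cosN sinN. Qed.

Lemma expi_conjc (u : R) : expi u * conjc (expi u) = 1.
Proof. by rewrite -normc_ReIm normc_expi expr1n. Qed.

Lemma cpath_conj_expi u : cpath (fun u => conjc (expi u) : R[i]) u.
Proof.
apply: (@cpath_comp _ conjc); last exact: cpath_expi.
by move=> e e0; exists e => // b; rewrite -rmorphB normc_conj.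
Qed.

Lemma cpath_conj_expiX k u : cpath (fun u => conjc (expi u) ^+ k : R[i]) u.
Proof.
elim: k => [|k IH]; first by under eq_fun do rewrite expr0; exact: cpath_cst.
by under eq_fun do rewrite exprS; apply: cpathM => //; exact: cpath_conj_expi.
Qed.

Lemma itg_conj_expi k : itg 0 1 (fun u => conjc (expi u) ^+ k.+1) = 0.
Proof.
have i1 : cintegrable leb `[0, 1] (fun u => expi (- k.+1%:R * u)).
  rewrite (_ : (fun u => _) = (fun u => conjc (expi u) ^+ k.+1)).
    by apply: cpath_integrable => u _; exact: cpath_conj_expiX.
  by apply/funext => u; rewrite conjc_expi expiX mulrN mulNr.
have := @itg_expi R (- k.+1%:R) 0 1 ler01.
have -> : expi (- k.+1%:R * 1) = 1 :> R[i].
  by rewrite mulr1 -(mulr1 k.+1%:R) -mulrN -expiX -conjc_expi expi1 conjc1 expr1n.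
rewrite mulr0 expi0 subrr cintegralZ// => /eqP.
rewrite mulf_eq0 => /orP[|/eqP <-].
  rewrite -normc_eq0 normc_sqrtE /= expr0n add0r sqrtr_sqr normr_eq0 !mulf_eq0.
  by rewrite oppr_eq0 !pnatr_eq0 /= (gt_eqF (@pi_gt0 R)).
by apply: eq_cintegral => u _; rewrite conjc_expi expiX mulrN mulNr.
Qed.

Section fixed_point.
Variable w : R[i].
Hypothesis w1 : normc w < 1.

Lemma conj_expi_lb (u : R) : 1 - normc w <= normc (1 - w * conjc (expi u)).
Proof.
apply: le_trans (normc_triB _ _).
by rewrite Normc.normc1 Normc.normcM normc_conj normc_expi mulr1.
Qed.

Lemma conj_expi_neq0 (u : R) : 1 - w * conjc (expi u) != 0.
Proof.
by rewrite -normc_eq0 gt_eqF// (lt_le_trans _ (conj_expi_lb u))// subr_gt0.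
Qed.

Let cs (u : R) : R[i] := (1 - w * conjc (expi u))^-1.

Let cpath_cs u : cpath cs u.
Proof.
apply: cpathV; first exact: conj_expi_neq0.
apply: cpathB; first exact: cpath_cst.
by apply: cpathM; [exact: cpath_cst|exact: cpath_conj_expi].
Qed.

(** With [J k] the integral of [cs] times the [k]-th power of the conjugate, the equation of [cs]
    gives [J k = w * J k.+1] for positive [k]. The [J k] are bounded, so [J 1] vanishes and only the
    constant term of [J 0] remains. *)
Lemma itg_conj_kernel : itg 0 1 cs = 1.
Proof.
pose J k := itg 0 1 (fun u => conjc (expi u) ^+ k * cs u).
have JS k : J k = itg 0 1 (fun u => conjc (expi u) ^+ k) + w * J k.+1.
  rewrite /J -cintegralZ//; last first.
    by apply: cpath_integrable => u _; apply: cpathM => //; exact: cpath_conj_expiX.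
  rewrite -cintegralD//.
  - apply: eq_cintegral => u _; rewrite /cs exprS.
    by field; exact: conj_expi_neq0.
  - by apply: cpath_integrable => u _; exact: cpath_conj_expiX.
  - apply: cpath_integrable => u _; apply: cpathM; first exact: cpath_cst.
    by apply: cpathM => //; exact: cpath_conj_expiX.
have Jb k : normc (J k) <= (1 - normc w)^-1.
  rewrite -[leRHS]mulr1 -[X in _ * X](subr0 1); apply: itg_bound => // u _.
    by apply: cpathM => //; exact: cpath_conj_expiX.
  rewrite Normc.normcM normcX normc_conj normc_expi expr1n mul1r Normc.normcV.
  by rewrite lef_pV2 ?conj_expi_lb// posrE ?subr_gt0// (lt_le_trans _ (conj_expi_lb u))// subr_gt0.
have J1 k : J 1%N = w ^+ k * J k.+1.
  elim: k => [|k IH]; first by rewrite expr0 mul1r.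
  by rewrite IH JS itg_conj_expi add0r mulrA -exprSr.
have J10 : J 1%N = 0.
  apply: (@normc_lim0 _ _ (normc w) (1 - normc w)^-1); first by rewrite normc_ge0.
  by move=> k; rewrite {1}(J1 k) Normc.normcM normcX ler_wpM2l ?exprn_ge0 ?normc_ge0.
have := JS 0%N; rewrite J10 mulr0 addr0 => J0.
rewrite (_ : itg 0 1 cs = J 0%N); last first.
  by apply: eq_cintegral => u _; rewrite expr0 mul1r.
rewrite J0 (_ : (fun u => _) = (fun=> 1)); last by apply/funext => u; rewrite expr0.
rewrite cintegral_cst; [|exact: measurable_itv|exact: leb_itv_lty].
by rewrite mul1r (_ : fine _ = 1)//; rewrite -[RHS]subr0; exact: fine_leb_itv.
Qed.

(** [cs u] is [expi u / (expi u - w)], so [cauchy_annulus] allows the circle to be contracted to any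
    radius factor [eps]. As [eps] tends to 0, continuity replaces [F] by [F w], and [cs] has
    integral 1. *)
Lemma cauchy_circle (F : R[i] -> R[i]) :
  (forall a, normc a <= 1 -> cderivable_at F a) ->
  itg 0 1 (fun u => F (expi u) * cs u) = F w.
Proof.
move=> dF.
have Fc a : normc a <= 1 -> ccontinuous_at F a.
  by move=> a1; apply: cderivable_continuous; exact: dF.
have Fcs u : cpath (fun u => F (expi u) * cs u) u.
  apply: cpathM => //; apply: (@cpath_comp _ F); last exact: cpath_expi.
  by apply: Fc; rewrite normc_expi.
have pii0 : Complex 0 (2 * pi) != 0 :> R[i].
  by rewrite -normc_eq0 normc_2pii mulf_neq0// gt_eqF// pi_gt0.
have betaE u : Complex 0 (2 * pi) * expi u / (expi u - w) = Complex 0 (2 * pi) * cs u :> R[i].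
  have e0 : expi u != 0 :> R[i] by rewrite -normc_eq0 normc_expi oner_eq0.
  rewrite -mulrA; congr (_ * _); rewrite /cs.
  have -> : 1 - w * conjc (expi u) = (expi u - w) / expi u.
    by rewrite mulrBl divff//; congr (_ - _ * _); apply: (mulfI e0); rewrite expi_conjc divff.
  by rewrite invf_div.
have ann eps : 0 < eps <= 1 ->
   itg 0 1 (fun u => F (expi u) * cs u) =
   itg 0 1 (fun u => F (w + eps%:C%C * (expi u - w)) * cs u).
  move=> he; have := cauchy_annulus w1 dF he.
  have Fe u : cpath (fun u => F (w + eps%:C%C * (expi u - w)) * cs u) u.
    apply: cpathM => //; apply: (@cpath_comp _ F).
      apply: Fc; have /andP[/ltW e0 e1] := he.
      have -> : w + eps%:C%C * (expi u - w) = (1 - eps)%:C%C * w + eps%:C%C * expi u.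
        by rewrite realcB; ring.
      rewrite (le_trans (le_normcD _ _))// !Normc.normcM !normc_real normc_expi mulr1.
      rewrite !ger0_norm ?subr_ge0// -lerBrDr ler_piMr ?subr_ge0// ltW//.
    apply: cpathD; first exact: cpath_cst.
    apply: cpathM; first exact: cpath_cst.
    by apply: cpathB; [exact: cpath_expi|exact: cpath_cst].
  have eqf (G : R -> R[i]) : (forall u, cpath (fun u => G u * cs u) u) ->
      itg 0 1 (fun u => G u * (Complex 0 (2 * pi) * expi u / (expi u - w))) =
      Complex 0 (2 * pi) * itg 0 1 (fun u => G u * cs u).
    move=> Gc; rewrite -cintegralZ//; last by apply: cpath_integrable => u _; exact: Gc.
    by apply: eq_cintegral => u _; rewrite betaE; ring.
  by rewrite !eqf// => /(mulfI pii0).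
apply/eqP; rewrite -subr_eq0 -normc_eq0 eq_le normc_ge0 andbT; apply/ler_addgt0Pr => e e0.
rewrite add0r.
have m0 : 0 < 1 - normc w by rewrite subr_gt0.
(* The tolerance [e * (1 - normc w)] absorbs the bound on [cs]. In [eps], the fraction [dl / 3]
   leaves room for [expi u - w], of modulus at most 2. *)
have [dl d0 hd] := Fc w (ltW w1) _ (mulr_gt0 e0 m0).
pose eps := Num.min 1 (dl / 3).
have eps0 : 0 < eps by rewrite lt_min ltr01 divr_gt0.
have eps1 : 0 < eps <= 1 by rewrite eps0 ge_min lexx.
have -> : F w = itg 0 1 (fun u => F w * cs u).
  by rewrite cintegralZ ?itg_conj_kernel ?mulr1//; apply: cpath_integrable => u _; exact: cpath_cs.
have Fe u : cpath (fun u => F (w + eps%:C%C * (expi u - w)) * cs u) u.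
  apply: cpathM => //; apply: (@cpath_comp _ F).
    apply: Fc; have /andP[/ltW e0' e1] := eps1.
    have -> : w + eps%:C%C * (expi u - w) = (1 - eps)%:C%C * w + eps%:C%C * expi u.
      by rewrite realcB; ring.
    rewrite (le_trans (le_normcD _ _))// !Normc.normcM !normc_real normc_expi mulr1.
    rewrite !ger0_norm ?subr_ge0// -lerBrDr ler_piMr ?subr_ge0// ltW//.
  apply: cpathD; first exact: cpath_cst.
  apply: cpathM; first exact: cpath_cst.
  by apply: cpathB; [exact: cpath_expi|exact: cpath_cst].
have Fw u : cpath (fun u => F w * cs u) u by apply: cpathM => //; exact: cpath_cst.
rewrite (ann eps eps1) -cintegralB//; [|by apply: cpath_integrable..].
rewrite -[leRHS]mulr1 -[X in _ * X](subr0 1); apply: itg_bound => // u _.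
  exact: cpathB.
rewrite -mulrBl Normc.normcM.
have csb : normc (cs u) <= (1 - normc w)^-1.
  rewrite /cs Normc.normcV.
  by rewrite lef_pV2 ?conj_expi_lb// posrE ?subr_gt0// (lt_le_trans _ (conj_expi_lb u))// subr_gt0.
rewrite -(mulfK (lt0r_neq0 m0) e); apply: ler_pM; rewrite ?normc_ge0//.
apply/ltW/hd; rewrite addrC addKr Normc.normcM normc_real (ger0_norm (ltW eps0)).
have h2 : normc (expi u - w) <= 2.
  by rewrite (le_trans (le_normcD _ _))// normc_expi normcN -[2]/(1 + 1) lerD2l ltW.
have h3 : eps <= dl / 3 by rewrite ge_min lexx orbT.
rewrite (le_lt_trans (ler_pM (ltW eps0) (normc_ge0 _) h3 h2))//.
by move: d0; lra.
Qed.

End fixed_point.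

(** [integral_uniform] concerns nonnegative functions, hence the passage through positive and
    negative parts. *)
Lemma cintegral_unif01 (f : R -> R[i]) : cmeas setT (f : measurableTypeR R -> R[i]) ->
  cintegral (@unif01 R) setT f = itg 0 1 f.
Proof.
have key (h : measurableTypeR R -> R) : measurable_fun setT h ->
    \int[@unif01 R]_x h x = \int[leb]_(x in `[0, 1]) h x.
  move=> mh; rewrite /Rintegral; congr fine; rewrite integralE [RHS]integralE.
  rewrite !integral_uniform ?subr0 ?invr1 ?mul1e//.
  - by apply: measurable_funeneg; exact/measurable_EFinP.
  - by apply: measurable_funepos; exact/measurable_EFinP.
by move=> [f1 f2]; congr Complex; exact: key.
Qed.

End cauchy_circle.

(** * The Szego kernel and Cauchy's formula on the polydisc *)

Section szego_kernel.
Variable R : realType.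

Lemma szego1_lb (a b : R[i]) : normc a <= 1 -> normc b < 1 ->
  1 - normc b <= normc (1 - a * conjc b).
Proof.
move=> a1 b1; apply: le_trans (normc_triB _ _).
rewrite Normc.normc1 Normc.normcM normc_conj lerD2l lerN2.
by rewrite ler_piMl ?normc_ge0.
Qed.

Lemma szego1_neq0 (a b : R[i]) : normc a <= 1 -> normc b < 1 -> 1 - a * conjc b != 0.
Proof.
move=> a1 b1; rewrite -normc_eq0 gt_eqF// (lt_le_trans _ (szego1_lb a1 b1))//.
by rewrite subr_gt0.
Qed.

Lemma szego1_le (a b : R[i]) : normc a <= 1 -> normc b < 1 ->
  normc (1 - a * conjc b)^-1 <= (1 - normc b)^-1.
Proof.
move=> a1 b1; rewrite Normc.normcV lef_pV2 ?szego1_lb ?posrE ?subr_gt0//.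
by rewrite (lt_le_trans _ (szego1_lb a1 b1))// subr_gt0.
Qed.

Lemma szegoC n (z w : 'I_n -> R[i]) : conjc (szego z w) = szego w z.
Proof.
rewrite /szego rmorph_prod; apply: eq_bigr => k _.
by rewrite /= conjc_inv rmorphB rmorph1 rmorphM /= conjcK mulrC.
Qed.

Lemma szego_mcons n a (z : 'I_n -> R[i]) (w : 'I_n.+1 -> R[i]) :
  szego (mcons a z) w =
  (1 - a * conjc (w ord0))^-1 * szego z (fun j => w (lift ord0 j)).
Proof.
rewrite /szego big_ord_recl mcons0; congr (_ * _).
by apply: eq_bigr => k _; rewrite mconsS.
Qed.

Definition szego_bound n (w : 'I_n -> R[i]) : R := \prod_k (1 - normc (w k))^-1.

Lemma szego_le n (z w : 'I_n -> R[i]) : (forall k, normc (z k) <= 1) ->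
  polydisc w -> normc (szego z w) <= szego_bound w.
Proof.
move=> z1 w1; rewrite /szego normc_prod; apply: ler_prod => k _.
by rewrite normc_ge0 szego1_le.
Qed.

Lemma cmeas_szego n (w : 'I_n -> R[i]) :
  cmeas setT (fun x : Tn R n => szego (torus_pt x) w).
Proof.
apply: cmeas_prod => k; apply: cmeasV; apply: cmeasB; first exact: cmeas_cst.
by apply: cmeasM; [exact: cmeas_torus_pt|exact: cmeas_cst].
Qed.

Lemma szego_torus_le n (w : 'I_n -> R[i]) (x : Tn R n) : polydisc w ->
  normc (szego (torus_pt x) w) <= szego_bound w.
Proof. by move=> w1; apply: szego_le => // k; rewrite normc_torus_pt. Qed.

Lemma torus_mu_lty n : (torus_mu R n setT < +oo)%E.
Proof. by rewrite probability_setT ltry. Qed.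

Lemma cintE n (f : Tn R n -> R[i]) : cint f = cintegral (torus_mu R n) setT f.
Proof. by []. Qed.

Lemma cint_cst n c : cint (fun _ : Tn R n => c) = c.
Proof.
rewrite cintE cintegral_cst//; last exact: torus_mu_lty.
rewrite (_ : fine _ = 1); first exact: mulr1.
by transitivity (fine (torus_mu R n setT)); rewrite // probability_setT.
Qed.

Lemma cint_cons n (f : Tn R n.+1 -> R[i]) :
  cintegrable (torus_mu R n.+1) setT f ->
  (forall t, cintegrable (torus_mu R n) setT (fun x => f (t, x))) ->
  cint f = cintegral (@unif01 R) setT (fun t => cint (fun x => f (t, x))).
Proof. by move=> fi fs; exact: (@cintegral12 _ _ _ _ R (@unif01 R) (torus_mu R n)). Qed.

(** Derivability is asked on the closed polydisc because the circles of integration are the unit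
    circles themselves. *)
Definition sep_derivable n (F : ('I_n -> R[i]) -> R[i]) :=
  forall a k, (forall j, normc (a j) <= 1) ->
    cderivable_at (fun s => F (fun j => if j == k then s else a j)) (a k).

(* Cauchy's formula in each variable, and Fubini. *)
Lemma cauchy_polydisc n (F : ('I_n -> R[i]) -> R[i]) (M : R) (w : 'I_n -> R[i]) :
  (forall a, (forall j, normc (a j) <= 1) -> mcontinuous_at F a) ->
  sep_derivable F ->
  (forall a, (forall j, normc (a j) <= 1) -> normc (F a) <= M) ->
  polydisc w ->
  cint (fun x => F (torus_pt x) * conjc (szego (torus_pt x) w)) = F w.
Proof.
elim: n F w => [F w _ _ _ _|n IH F w Fc Fd FM w1].
  rewrite [RHS](_ : _ = cint (fun _ : Tn R 0 => F w)); last by rewrite cint_cst.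
  congr cint; apply/funext => x; rewrite /szego big_ord0 conjc1 mulr1.
  by congr F; apply/funext; case.
have Mb a : (forall j, normc (a j) <= 1) ->
    normc (F a * conjc (szego a w)) <= M * szego_bound w.
  move=> a1; rewrite Normc.normcM normc_conj ler_pM ?normc_ge0//.
    exact: FM.
  exact: szego_le.
have mF : cmeas setT (fun x : Tn R n.+1 => F (torus_pt x)).
  by apply: cmeas_torus => a a1; apply: Fc => j; rewrite a1.
rewrite cint_cons; last first.
- move=> t; apply: (cintegrable_bounded (M := M * szego_bound w)) => //.
  + exact: torus_mu_lty.
  + apply: cmeasM.
      under eq_fun do rewrite torus_pt_mcons.
      apply: (@cmeas_torus _ _ (fun y => F (mcons (expi t) y))) => a a1 e e0.
      have [|dl d0 h] := Fc (mcons (expi t) a) _ _ e0.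
        by move=> k; rewrite /mcons; case: unlift => [j|]; rewrite ?a1 ?normc_expi.
      exists dl => // b hb; apply: h => k; rewrite /mcons; case: unlift => [j|].
        exact: hb.
      by rewrite subrr Normc.normc0.
    apply: cmeasJ; under eq_fun do rewrite torus_pt_mcons szego_mcons.
    by apply: cmeasM; [exact: cmeas_cst|exact: cmeas_szego].
  + by move=> x _; apply: Mb => k; rewrite normc_torus_pt.
- apply: (cintegrable_bounded (M := M * szego_bound w)) => //.
  + exact: torus_mu_lty.
  + by apply: cmeasM => //; apply: cmeasJ; exact: cmeas_szego.
  + by move=> x _; apply: Mb => k; rewrite normc_torus_pt.
pose w' j := w (lift ord0 j).
have mcons_le a y : normc a <= 1 -> (forall j, normc (y j) <= 1) ->
    forall j : 'I_n.+1, normc (mcons a y j) <= 1.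
  by move=> a1 y1 j; rewrite /mcons; case: unlift.
have inner t : cint (fun x => F (@torus_pt R n.+1 (t, x)) *
      conjc (szego (@torus_pt R n.+1 (t, x)) w)) =
    F (mcons (expi t) w') * (1 - w ord0 * conjc (expi t))^-1.
  rewrite -(IH (fun y => F (mcons (expi t) y)) w').
  - rewrite cintE mulrC -cintegralZ//.
      apply: eq_cintegral => x _; rewrite torus_pt_mcons szego_mcons rmorphM /=.
      by rewrite conjc_inv rmorphB rmorph1 rmorphM /= conjcK mulrCA [_ * w ord0]mulrC.
    apply: (cintegrable_bounded (M := M * szego_bound w')) => //.
    + exact: torus_mu_lty.
    + apply: cmeasM; last by apply: cmeasJ; exact: cmeas_szego.
      apply: (@cmeas_torus _ _ (fun y => F (mcons (expi t) y))) => a a1 e e0.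
      have [|dl d0 h] := Fc (mcons (expi t) a) _ _ e0.
        by move=> k; rewrite /mcons; case: unlift => [j|]; rewrite ?a1 ?normc_expi.
      exists dl => // b hb; apply: h => k; rewrite /mcons; case: unlift => [j|].
        exact: hb.
      by rewrite subrr Normc.normc0.
    + move=> x _; rewrite Normc.normcM normc_conj ler_pM ?normc_ge0//.
        by apply/FM/mcons_le; rewrite ?normc_expi// => j; rewrite normc_torus_pt.
      by apply: szego_torus_le => j; exact: w1.
  - move=> a a1 e e0.
    have [|dl d0 h] := Fc (mcons (expi t) a) _ _ e0.
      by apply: mcons_le => //; rewrite normc_expi.
    exists dl => // b hb; apply: h => k; rewrite /mcons; case: unlift => [j|].
      exact: hb.
    by rewrite subrr Normc.normc0.
  - move=> a k a1; have := Fd (mcons (expi t) a) (lift ord0 k).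
    rewrite mconsS (_ : (fun s => _) = (fun s => F (mcons (expi t)
      (fun j => if j == k then s else a j)))).
      by apply; apply: mcons_le => //; rewrite normc_expi.
    apply/funext => s; congr F; apply/funext => j; rewrite /mcons.
    by case: (unliftP ord0 j) => [i|] ->.
  - by move=> a a1; apply/FM/mcons_le; rewrite ?normc_expi.
  - by move=> j; exact: w1.
under [in LHS]eq_fun do rewrite inner.
rewrite cintegral_unif01.
  rewrite (@cauchy_circle R (w ord0) (w1 ord0) (fun s => F (mcons s w'))).
    by congr F; rewrite [RHS]mcons_split.
  move=> a a1; have := Fd (mcons a w') ord0; rewrite mcons0.
  rewrite (_ : (fun s => _) = (fun s => F (mcons s w'))).
    by apply; apply: mcons_le => // j; rewrite ltW// w1.
  apply/funext => s; congr F; apply/funext => j; rewrite /mcons.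
  by case: (unliftP ord0 j) => [i|] ->.
apply: cmeasM.
  apply: cmeas_cpath => t e e0.
  have [|dl d0 h] := Fc (mcons (expi t) w') _ _ e0.
    by apply: mcons_le; rewrite ?normc_expi// => j; rewrite ltW// w1.
  have [d1 d10 h1] := cpath_expi t d0; exists d1 => // s /h1 hs.
  apply: h => k; rewrite /mcons; case: unlift => [j|//].
  by rewrite subrr Normc.normc0.
apply: cmeasV; apply: cmeasB; first exact: cmeas_cst.
apply: cmeasM; first exact: cmeas_cst.
by apply: cmeas_cpath; exact: cpath_conj_expi.
Qed.

End szego_kernel.

(** * Square-integrable functions and characters *)

Section square_integrable.
Variables (R : realType) (n : nat).
Local Notation mu := (torus_mu R n).
Implicit Types f g h : Tn R n -> R[i].

Lemma L2_sq f : L2 f -> mu.-integrable setT (fun x => (normc (f x) ^+ 2)%:E).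
Proof.
move=> [mf fy]; apply/integrableP; split.
  by apply/measurable_EFinP; apply: measurable_funX; exact: cmeas_normc.
apply: le_lt_trans fy; rewrite le_eqVlt; apply/orP; left; apply/eqP.
by apply: eq_integral => x _; rewrite gee0_abs// lee_fin sqr_ge0.
Qed.

Lemma sq_L2 f (G : Tn R n -> R) : cmeas setT f -> mu.-integrable setT (EFin \o G) ->
  (forall x, normc (f x) ^+ 2 <= G x) -> L2 f.
Proof.
move=> mf Gi fG; split => //.
have G0 x : 0 <= G x by apply: le_trans (fG x); exact: sqr_ge0.
have /integrableP[_] := Gi; apply: le_lt_trans.
apply: ge0_le_integral => //.
- by move=> x _; rewrite lee_fin sqr_ge0.
- by apply/measurable_EFinP; apply: measurable_funX; exact: cmeas_normc.
- by apply: measurableT_comp => //; exact: measurable_int Gi.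
- by move=> x _ /=; rewrite lee_fin ger0_norm.
Qed.

Lemma L2_mul f g : L2 f -> L2 g -> cintegrable mu setT (fun x => f x * g x).
Proof.
move=> Lf Lg; have If := L2_sq Lf; have Ig := L2_sq Lg.
have I2 : mu.-integrable setT (EFin \o (fun x => normc (f x) ^+ 2 + normc (g x) ^+ 2)).
  by apply: eq_integrable (integrableD measurableT If Ig) => // x _ /=; rewrite EFinD.
apply: (cintegrable_le measurableT _ I2).
  by apply: cmeasM; [case: Lf|case: Lg].
move=> x _; rewrite Normc.normcM.
have := sqr_ge0 (normc (f x) - normc (g x)); rewrite sqrrB.
have := mulr_ge0 (normc_ge0 (f x)) (normc_ge0 (g x)); rewrite -mulr_natr.
move: (normc (f x)) (normc (g x)) => a b; lra.
Qed.

Lemma L2_cst c : L2 (fun _ : Tn R n => c).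
Proof.
apply: (@sq_L2 _ (fun=> normc c ^+ 2)); [exact: cmeas_cst| |by []].
by apply: integrable_cst_lty => //; exact: torus_mu_lty.
Qed.

Lemma L2_cintegrable f : L2 f -> cintegrable mu setT f.
Proof.
move=> Lf; have := L2_mul Lf (L2_cst 1); by under eq_fun do rewrite mulr1.
Qed.

Lemma L2D f g : L2 f -> L2 g -> L2 (fun x => f x + g x).
Proof.
move=> Lf Lg; have If := L2_sq Lf; have Ig := L2_sq Lg.
have I2 : mu.-integrable setT
    (EFin \o (fun x => 2 * (normc (f x) ^+ 2 + normc (g x) ^+ 2))).
  exact: eq_integrable (integrableZl measurableT 2 (integrableD measurableT If Ig)).
have mfg : cmeas setT (fun x => f x + g x) by apply: cmeasD; [case: Lf|case: Lg].
apply: (sq_L2 mfg I2).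
move=> x; have := le_normcD (f x) (g x); have := normc_ge0 (f x + g x).
move: (normc (f x)) (normc (g x)) (normc (f x + g x)) => a b c c0 cab.
rewrite (@le_trans _ _ ((a + b) ^+ 2))//.
  by rewrite ler_sqr ?nnegrE// (le_trans c0).
rewrite -subr_ge0 [leRHS](_ : _ = (a - b) ^+ 2) ?sqr_ge0//.
by ring.
Qed.

Definition bounded_meas f :=
  cmeas setT f /\ exists M : R, forall x, normc (f x) <= M.

Lemma L2_Mbounded f g : bounded_meas f -> L2 g -> L2 (fun x => f x * g x).
Proof.
move=> [mf [M fM]] Lg; have Ig := L2_sq Lg.
have I2 : mu.-integrable setT (EFin \o (fun x => M ^+ 2 * normc (g x) ^+ 2)).
  by apply: eq_integrable (integrableZl measurableT (M ^+ 2) Ig) => // x _ /=; rewrite EFinM.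
have mfg : cmeas setT (fun x => f x * g x) by apply: cmeasM => //; case: Lg.
apply: (sq_L2 mfg I2).
move=> x; rewrite Normc.normcM exprMn ler_wpM2r ?sqr_ge0// ler_sqr ?nnegrE ?normc_ge0//.
exact: le_trans (normc_ge0 _) (fM x).
Qed.

Lemma bounded_cintegrable f : bounded_meas f -> cintegrable mu setT f.
Proof.
move=> [mf [M fM]]; apply: (cintegrable_bounded (M := M)) => //.
exact: torus_mu_lty.
Qed.

Lemma cintegrable_bmM f g : bounded_meas f -> cintegrable mu setT g ->
  cintegrable mu setT (fun x => f x * g x).
Proof. by move=> [mf [M fM]]; exact: cintegrable_Mbounded. Qed.

Lemma bm_cst c : bounded_meas (fun _ : Tn R n => c).
Proof. by split; [exact: cmeas_cst|exists (normc c)]. Qed.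

Lemma bmM f g : bounded_meas f -> bounded_meas g -> bounded_meas (fun x => f x * g x).
Proof.
move=> [mf [M fM]] [mg [N gN]]; split; first exact: cmeasM.
by exists (M * N) => x; rewrite Normc.normcM ler_pM ?normc_ge0.
Qed.

Lemma bmD f g : bounded_meas f -> bounded_meas g -> bounded_meas (fun x => f x + g x).
Proof.
move=> [mf [M fM]] [mg [N gN]]; split; first exact: cmeasD.
by exists (M + N) => x; rewrite (le_trans (le_normcD _ _))// lerD.
Qed.

Lemma bmJ f : bounded_meas f -> bounded_meas (fun x => conjc (f x)).
Proof.
move=> [mf [M fM]]; split; first exact: cmeasJ.
by exists M => x; rewrite normc_conj.
Qed.

Lemma bm_sum (I : finType) (F : I -> Tn R n -> R[i]) :
  (forall i, bounded_meas (F i)) -> bounded_meas (fun x => \sum_i F i x).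
Proof.
move=> bF; rewrite /index_enum; elim: (Finite.enum I) => [|i s IH].
  by under eq_fun do rewrite big_nil; exact: bm_cst.
by under eq_fun do rewrite big_cons; exact: bmD.
Qed.

Lemma bm_L2 f : bounded_meas f -> L2 f.
Proof.
move=> bf; have := L2_Mbounded bf (L2_cst 1); by under eq_fun do rewrite mulr1.
Qed.

Lemma L2Z c f : L2 f -> L2 (fun x => c * f x).
Proof. by apply: L2_Mbounded; exact: bm_cst. Qed.

Lemma L2J f : L2 f -> L2 (fun x => conjc (f x)).
Proof.
move=> Lf; apply: (@sq_L2 _ (fun x => normc (f x) ^+ 2)).
- by apply: cmeasJ; case: Lf.
- exact: L2_sq.
- by move=> x; rewrite normc_conj.
Qed.

Lemma torus_pt_neq0 (x : Tn R n) k : torus_pt x k != 0.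
Proof. by rewrite -normc_eq0 normc_torus_pt oner_eq0. Qed.

Lemma conjc_torus_pt (x : Tn R n) k : conjc (torus_pt x k) = (torus_pt x k)^-1.
Proof.
apply: (mulfI (torus_pt_neq0 x k)); rewrite divff ?torus_pt_neq0//.
by rewrite -normc_ReIm normc_torus_pt expr1n.
Qed.

Lemma normc_character k (x : Tn R n) : normc (character k x) = 1.
Proof.
rewrite /character normc_prod big1// => j _.
by case: (k j) => l; rewrite ?Normc.normcV normcX normc_torus_pt expr1n ?invr1.
Qed.

Lemma bm_character k : bounded_meas (@character R n k).
Proof.
split; last by exists 1 => x; rewrite normc_character.
apply: cmeas_prod => j.
have mX l : cmeas setT (fun x : Tn R n => torus_pt x j ^+ l).
  elim: l => [|l IH]; first by under eq_fun do rewrite expr0; exact: cmeas_cst.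
  by under eq_fun do rewrite exprS; apply: cmeasM => //; exact: cmeas_torus_pt.
by case: (k j) => l; [exact: mX|apply: cmeasV; exact: mX].
Qed.

Lemma characterD k l (x : Tn R n) :
  character (fun j => k j + l j) x = character k x * character l x.
Proof.
rewrite /character -big_split; apply: eq_bigr => j _ /=.
by rewrite expfzDr ?torus_pt_neq0.
Qed.

Lemma characterN k (x : Tn R n) :
  character (fun j => - k j) x = conjc (character k x).
Proof.
rewrite /character rmorph_prod; apply: eq_bigr => j _ /=.
rewrite -invr_expz.
have conjX l : conjc (torus_pt x j ^+ l) = (torus_pt x j)^-1 ^+ l.
  by rewrite rmorphXn; congr (_ ^+ l); exact: conjc_torus_pt.
by case: (k j) => l; rewrite /exprz ?conjc_inv conjX exprVn.
Qed.

Definition dvec (i : 'I_n) : 'I_n -> int := fun j => (i == j)%:Z.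

Lemma character_dvec i (x : Tn R n) : character (dvec i) x = torus_pt x i.
Proof.
rewrite /character (bigD1 i)//= /dvec eqxx expr1z big1 ?mulr1// => j ji.
by rewrite eq_sym (negbTE ji) expr0z.
Qed.

Lemma character0 (x : Tn R n) : character (fun=> 0) x = 1.
Proof. by rewrite /character big1. Qed.

End square_integrable.

(** * Integrals of characters *)

Section character_integral.
Variable R : realType.
Local Notation leb := (@lebesgue_measure R).

Lemma cintegral_expiX (k : nat) :
  cintegral (@unif01 R) setT (fun t => expi t ^+ k.+1) = 0.
Proof.
have p t : cpath (fun t => expi t ^+ k.+1 : R[i]) t.
  elim: k => [|k IH]; first by under eq_fun do rewrite expr1; exact: cpath_expi.
  by under eq_fun do rewrite exprS; apply: cpathM => //; exact: cpath_expi.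
rewrite cintegral_unif01; last exact: cmeas_cpath.
rewrite -[LHS]conjcK -cintegralJ//; last by apply: cpath_integrable.
rewrite -[RHS]conjc0 -(@itg_conj_expi R k); congr (conjc _).
by apply: eq_cintegral => u _; rewrite rmorphXn.
Qed.

Lemma unif01_lty : (@unif01 R setT < +oo)%E.
Proof. by rewrite /unif01 probability_setT ltry. Qed.

(** Split off the first angle: either the positive frequency belongs to the remaining coordinates
    and induction applies, or the first factor is a positive power of [expi] and integrates to 0. *)
Lemma cint_character n (k : 'I_n -> int) j : 0 < k j -> cint (@character R n k) = 0.
Proof.
elim: n k j => [k []//|n IH k j kj].
have cE t x : @character R n.+1 k (t, x) =
    expi t ^ (k ord0) * character (fun i => k (lift ord0 i)) x.
  rewrite /character big_ord_recl torus_pt_mcons mcons0; congr (_ * _).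
  by apply: eq_bigr => i _; rewrite mconsS.
have bi l : cintegrable (torus_mu R n) setT (@character R n l).
  by apply: bounded_cintegrable; exact: bm_character.
rewrite cint_cons; first last.
- by move=> t; under eq_fun do rewrite cE; exact: cintegrableZ.
- by apply: bounded_cintegrable; exact: bm_character.
under [in LHS]eq_fun do under eq_fun do rewrite cE.
under [in LHS]eq_fun do rewrite cintE cintegralZ// -cintE.
case: (unliftP ord0 j) kj => [i|] -> kj.
  rewrite (IH _ i)//; under [in LHS]eq_fun do rewrite mulr0.
  exact: cintegral0.
rewrite (_ : (fun t => _) = (fun t => cint (character (fun i => k (lift ord0 i)))
   * expi t ^ (k ord0))); last by apply/funext => t; rewrite mulrC.
move: kj; case: (k ord0) => [[//|l] _|//].
have p t : cpath (fun t => expi t ^+ l.+1 : R[i]) t.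
  elim: l => [|l IHl]; first by under eq_fun do rewrite expr1; exact: cpath_expi.
  by under eq_fun do rewrite exprS; apply: cpathM => //; exact: cpath_expi.
have ci : cintegrable (@unif01 R) setT (fun t => expi t ^+ l.+1).
  apply: (cintegrable_bounded (M := 1)) => //.
  - exact: unif01_lty.
  - exact: cmeas_cpath.
  - by move=> t _; rewrite normcX normc_expi expr1n.
transitivity (cint (character (fun i => k (lift ord0 i)))
   * cintegral (@unif01 R) setT (fun t => expi t ^+ l.+1)).
  exact: cintegralZ ci.
by rewrite cintegral_expiX mulr0.
Qed.

End character_integral.

(** * Integrals against the Szego kernel *)

Section analytic_in_variable.
Variables (R : realType) (n : nat).
Local Notation mu := (torus_mu R n).
Local Notation S w := (fun x : Tn R n => szego (torus_pt x) w).
Implicit Types (F G : Tn R n -> R[i]) (j : 'I_n).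

(* [F] has no Fourier coefficient at frequencies [- k] with [k j > 0]. *)
Definition analytic_in j F := cintegrable mu setT F /\
  forall k : 'I_n -> int, 0 < k j -> cint (fun x => F x * character k x) = 0.

Definition analytic F := forall j, analytic_in j F.

Lemma analytic_in_coord j F : analytic_in j F -> cint (fun x => torus_pt x j * F x) = 0.
Proof.
move=> [_ h]; rewrite -(h (dvec j)) ?/dvec ?eqxx//.
by apply: eq_cintegral => x _; rewrite character_dvec mulrC.
Qed.

(* [G = 1 + c e_v G] expands as the geometric series of [c e_v], whose
   frequencies do not decrease the [j]-th coordinate. *)
Lemma analytic_in_geometric j F G (c : R[i]) (v : 'I_n -> int) :
  0 <= v j -> normc c < 1 -> bounded_meas G ->
  (forall x, G x = 1 + c * character v x * G x) ->
  analytic_in j F -> analytic_in j (fun x => G x * F x).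
Proof.
move=> vj c1 bG GE [Fi Fk]; have GFi := cintegrable_bmM bG Fi.
split => // k kj.
pose I l := cint (fun x => G x * F x * character (fun i => k i + v i *+ l) x).
have IE l : I l = c * I l.+1.
  have kl : 0 < k j + v j *+ l by rewrite ltr_wpDr// mulrn_wge0.
  transitivity (cint (fun x => F x * character (fun i => k i + v i *+ l) x) + c * I l.+1).
    rewrite /I !cintE -cintegralZ//; last first.
      by under eq_fun do rewrite mulrC; apply: cintegrable_bmM => //; exact: bm_character.
    rewrite -cintegralD//.
    - apply: eq_cintegral => x _; rewrite {1}GE.
      have -> : character (fun i => k i + v i *+ l.+1) x =
          character v x * character (fun i => k i + v i *+ l) x.
        rewrite -characterD; congr character; apply/funext => i.
        by rewrite mulrS addrCA.
      by ring.
    - by under eq_fun do rewrite mulrC; apply: cintegrable_bmM => //; exact: bm_character.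
    - apply: cintegrableZ => //.
      by under eq_fun do rewrite mulrC; apply: cintegrable_bmM => //; exact: bm_character.
  by rewrite (Fk (fun i => k i + v i *+ l))// add0r.
have I0 l : I 0%N = c ^+ l * I l.
  by elim: l => [|l IHl]; rewrite ?expr0 ?mul1r// IHl IE mulrA -exprSr.
have -> : cint (fun x => G x * F x * character k x) = I 0%N.
  apply: eq_cintegral => x _; congr (_ * character _ x).
  by apply/funext => i; rewrite mulr0n addr0.
apply: (@normc_lim0 _ _ (normc c) (\int[mu]_x normc (G x * F x))).
  by rewrite normc_ge0.
move=> l; rewrite {1}(I0 l) Normc.normcM normcX ler_wpM2l ?exprn_ge0 ?normc_ge0//.
have Ii : cintegrable mu setT
    (fun x => G x * F x * character (fun i => k i + v i *+ l) x).
  by under eq_fun do rewrite mulrC; apply: cintegrable_bmM => //; exact: bm_character.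
rewrite (le_trans (normc_cintegral measurableT Ii))//.
rewrite le_eqVlt; apply/orP; left; apply/eqP; apply: eq_Rintegral => x _.
by rewrite [in LHS]Normc.normcM normc_character mulr1.
Qed.

Definition sfac (i : 'I_n) (c : R[i]) (x : Tn R n) : R[i] :=
  (1 - torus_pt x i * conjc c)^-1.

Lemma szego_sfac w (x : Tn R n) : szego (torus_pt x) w = \prod_i sfac i (w i) x.
Proof. by []. Qed.

Lemma sfac_neq0 i c (x : Tn R n) : normc c < 1 -> 1 - torus_pt x i * conjc c != 0.
Proof. by move=> c1; apply: szego1_neq0; rewrite ?normc_torus_pt. Qed.

Lemma bm_sfac i c : normc c < 1 -> bounded_meas (sfac i c).
Proof.
move=> c1; split.
  apply: cmeasV; apply: cmeasB; first exact: cmeas_cst.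
  by apply: cmeasM; [exact: cmeas_torus_pt|exact: cmeas_cst].
by exists (1 - normc c)^-1 => x; apply: szego1_le; rewrite ?normc_torus_pt.
Qed.

Lemma bm_szego w : polydisc w -> bounded_meas (S w).
Proof.
move=> w1; split; first exact: cmeas_szego.
by exists (szego_bound w) => x; exact: szego_torus_le.
Qed.

Lemma sfacE i c (x : Tn R n) : normc c < 1 ->
  sfac i c x = 1 + conjc c * torus_pt x i * sfac i c x.
Proof. by move=> c1; rewrite /sfac; field; exact: sfac_neq0. Qed.

Lemma conjc_sfacE i c (x : Tn R n) : normc c < 1 ->
  conjc (sfac i c x) = 1 + c * conjc (torus_pt x i) * conjc (sfac i c x).
Proof.
by move=> c1; rewrite {1}(sfacE _ _ c1) rmorphD rmorph1 !rmorphM /= conjcK.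
Qed.

Lemma analytic_in_sfac j i c F : normc c < 1 ->
  analytic_in j F -> analytic_in j (fun x => sfac i c x * F x).
Proof.
move=> c1; apply: (@analytic_in_geometric _ _ _ (conjc c) (dvec i)).
- by rewrite /dvec.
- by rewrite normc_conj.
- exact: bm_sfac.
- by move=> x; rewrite character_dvec; exact: sfacE.
Qed.

(** The conjugate factor lowers only the frequency in coordinate [i], so analyticity in another
    coordinate [j] survives. *)
Lemma analytic_in_sfacJ j i c F : i != j -> normc c < 1 ->
  analytic_in j F -> analytic_in j (fun x => conjc (sfac i c x) * F x).
Proof.
move=> ij c1; apply: (@analytic_in_geometric _ _ _ c (fun k => - dvec i k)) => //.
- by rewrite /dvec (negbTE ij) oppr0.
- by apply: bmJ; exact: bm_sfac.
- by move=> x; rewrite characterN character_dvec; exact: conjc_sfacE.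
Qed.

Lemma analytic_prod_sfac (s : seq 'I_n) w F : polydisc w -> analytic F ->
  analytic (fun x => (\prod_(i <- s) sfac i (w i) x) * F x).
Proof.
move=> w1 aF j; elim: s => [|i s IH].
  by under eq_fun do rewrite big_nil mul1r.
by under eq_fun do rewrite big_cons -mulrA; exact: analytic_in_sfac.
Qed.

Lemma analytic_szego w F : polydisc w -> analytic F ->
  analytic (fun x => szego (torus_pt x) w * F x).
Proof. exact: analytic_prod_sfac. Qed.

Lemma cint_szego w F : polydisc w -> analytic F ->
  cint (fun x => szego (torus_pt x) w * F x) = cint F.
Proof.
move=> w1 aF; rewrite /szego /index_enum /=.
elim: (Finite.enum _) => [|i s IH].
  by apply: eq_cintegral => x _; rewrite big_nil mul1r.
rewrite -IH; have aG := analytic_prod_sfac s w1 aF.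
set G := (fun x => (\prod_(i <- s) sfac i (w i) x) * F x) in aG *.
have aH := analytic_in_sfac i (w1 i) (aG i).
transitivity (cint G + conjc (w i) * cint (fun x => torus_pt x i * (sfac i (w i) x * G x))).
  rewrite !cintE -cintegralZ//; last first.
    apply: cintegrable_bmM; last by case: aH.
    split; first exact: cmeas_torus_pt.
    by exists 1 => x; rewrite normc_torus_pt.
  rewrite -cintegralD//.
  - apply: eq_cintegral => x _; rewrite big_cons -/(sfac i (w i) x).
    by rewrite -mulrA -/(G x) {1}(sfacE i x (w1 i)); ring.
  - by case: (aG i).
  - apply: cintegrableZ => //; apply: cintegrable_bmM; last by case: aH.
    split; first exact: cmeas_torus_pt.
    by exists 1 => x; rewrite normc_torus_pt.
by rewrite (analytic_in_coord aH) mulr0 addr0.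
Qed.

Variable z : 'I_n -> R[i].
Hypothesis z1 : polydisc z.

(** The value at [z] of the analytic extension of [F]. *)
Definition szego_eval F := cint (fun x => F x * conjc (szego (torus_pt x) z)).

Lemma bm_coord j : bounded_meas (fun x : Tn R n => torus_pt x j).
Proof.
split; first exact: cmeas_torus_pt.
by exists 1 => x; rewrite normc_torus_pt.
Qed.

Lemma szego_eval_integrable F : cintegrable mu setT F ->
  cintegrable mu setT (fun x => F x * conjc (szego (torus_pt x) z)).
Proof.
move=> Fi; under eq_fun do rewrite mulrC.
by apply: cintegrable_bmM => //; apply: bmJ; exact: bm_szego.
Qed.

Lemma szego_evalD F G : cintegrable mu setT F -> cintegrable mu setT G ->
  szego_eval (fun x => F x + G x) = szego_eval F + szego_eval G.
Proof.
move=> Fi Gi; rewrite /szego_eval !cintE -cintegralD//; try exact: szego_eval_integrable.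
by apply: eq_cintegral => x _; rewrite mulrDl.
Qed.

Lemma szego_evalZ c F : cintegrable mu setT F ->
  szego_eval (fun x => c * F x) = c * szego_eval F.
Proof.
move=> Fi; rewrite /szego_eval !cintE -cintegralZ//; last exact: szego_eval_integrable.
by apply: eq_cintegral => x _; rewrite mulrA.
Qed.

(** Collect [F] and all conjugate factors except the [j]-th into [G], still analytic in [j]. On the
    torus, [torus_pt x j] times the [j]-th conjugate factor is [torus_pt x j] plus [z j] times that
    factor, and [torus_pt x j * G x] has mean 0. *)
Lemma szego_eval_coord j F : analytic_in j F ->
  szego_eval (fun x => torus_pt x j * F x) = z j * szego_eval F.
Proof.
move=> aF.
pose G x := (\prod_(i | i != j) conjc (sfac i (z i) x)) * F x.
have aG : analytic_in j G.
  rewrite /G; under eq_fun do rewrite -big_filter.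
  have : all (fun i => i != j) [seq i <- index_enum 'I_n | i != j] by exact: filter_all.
  elim: [seq _ <- _ | _] => [_|i s IH /= /andP[ij /IH as']].
    by under eq_fun do rewrite big_nil mul1r.
  by under eq_fun do rewrite big_cons -mulrA; exact: analytic_in_sfacJ.
have SE (x : Tn R n) : F x * conjc (szego (torus_pt x) z) = conjc (sfac j (z j) x) * G x.
  rewrite szego_sfac rmorph_prod (bigD1 j)//= /G; by ring.
have Gi : cintegrable mu setT G by case: aG.
have csG : cintegrable mu setT (fun x => conjc (sfac j (z j) x) * G x).
  by apply: cintegrable_bmM => //; apply: bmJ; exact: bm_sfac.
transitivity (cint (fun x => torus_pt x j * G x)
   + z j * cint (fun x => conjc (sfac j (z j) x) * G x)); last first.
  rewrite (analytic_in_coord aG) add0r /szego_eval; congr (_ * _).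
  by apply: eq_cintegral => x _; rewrite SE.
rewrite /szego_eval !cintE -cintegralZ// -cintegralD//.
- apply: eq_cintegral => x _; rewrite -mulrA SE {1}(conjc_sfacE j x (z1 j)) conjc_torus_pt.
  by field; exact: torus_pt_neq0.
- by apply: cintegrable_bmM => //; exact: bm_coord.
- exact: cintegrableZ.
Qed.

Lemma szego_eval_linear j a F : analytic_in j F ->
  szego_eval (fun x => (torus_pt x j - a) * F x) = (z j - a) * szego_eval F.
Proof.
move=> aF; have Fi : cintegrable mu setT F by case: aF.
rewrite mulrBl -szego_eval_coord// -mulNr -szego_evalZ// -szego_evalD.
- by apply: eq_cintegral => x _; congr (_ * _); ring.
- by apply: cintegrable_bmM => //; exact: bm_coord.
- exact: cintegrableZ.
Qed.

(** Factor by factor: multiplying by [1 - torus_pt x i * conjc (w i)] cancels [sfac i (w i)], and by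
    [szego_eval_coord] this multiplication acts on the evaluation as the number
    [1 - z i * conjc (w i)]. *)
Lemma szego_eval_szego w F : polydisc w -> analytic F ->
  szego_eval (fun x => szego (torus_pt x) w * F x) = szego z w * szego_eval F.
Proof.
move=> w1 aF; rewrite /szego /index_enum /=.
elim: (Finite.enum _) => [|i s IH].
  rewrite big_nil mul1r; apply: eq_cintegral => x _; by rewrite big_nil mul1r.
rewrite big_cons -mulrA -IH; have aG := analytic_prod_sfac s w1 aF.
set G := (fun x => (\prod_(i <- s) sfac i (w i) x) * F x) in aG *.
have aH := analytic_in_sfac i (w1 i) (aG i).
have n0 : 1 - z i * conjc (w i) != 0 by apply: szego1_neq0 => //; exact/ltW/z1.
apply: (mulfI n0); rewrite mulVKf//.
have Hi : cintegrable mu setT (fun x => sfac i (w i) x * G x) by case: aH.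
transitivity (szego_eval (fun x => sfac i (w i) x * G x)
   + (- conjc (w i)) * szego_eval (fun x => torus_pt x i * (sfac i (w i) x * G x))).
  rewrite szego_eval_coord// [X in _ * X](_ : _ = szego_eval (fun x => sfac i (w i) x * G x)).
    by ring.
  by apply: eq_cintegral => x _; rewrite big_cons -/(sfac i (w i) x) -[_ * _ * F x]mulrA.
have cHi : cintegrable mu setT (fun x => torus_pt x i * (sfac i (w i) x * G x)).
  by apply: cintegrable_bmM => //; exact: bm_coord.
rewrite -szego_evalZ// -szego_evalD//; last exact: cintegrableZ.
apply: eq_cintegral => x _; congr (_ * _).
rewrite -/(sfac i (w i) x) -/(G x).
have -> : sfac i (w i) x * G x + - conjc (w i) * (torus_pt x i * (sfac i (w i) x * G x))
  = (1 - torus_pt x i * conjc (w i)) * sfac i (w i) x * G x by ring.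
by rewrite /sfac divff ?mul1r// sfac_neq0.
Qed.

Lemma analytic1 : analytic (fun=> 1).
Proof.
move=> j; split; first by apply: bounded_cintegrable; exact: bm_cst.
move=> k kj; rewrite -(@cint_character R n k j)//.
by apply: eq_cintegral => x _; rewrite mul1r.
Qed.

Lemma szego_eval1 : szego_eval (fun=> 1) = 1.
Proof.
transitivity (conjc (cint (fun x => szego (torus_pt x) z * 1))).
  rewrite /szego_eval !cintE -cintegralJ//.
    by apply: eq_cintegral => x _; rewrite mul1r mulr1.
  by apply: bounded_cintegrable; apply: bmM; [exact: bm_szego|exact: bm_cst].
by rewrite cint_szego ?cint_cst ?conjc1//; exact: analytic1.
Qed.

Lemma szego_reproducing w : polydisc w ->
  szego_eval (fun x => szego (torus_pt x) w) = szego z w.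
Proof.
move=> w1; have := szego_eval_szego w1 analytic1; rewrite szego_eval1 mulr1 => <-.
by apply: eq_cintegral => x _; rewrite mulr1.
Qed.

End analytic_in_variable.

(** * The Hardy space, the Gram matrix and the interpolant *)

Section hardy_space.
Variables (R : realType) (n : nat).
Local Notation mu := (torus_mu R n).
Implicit Types (F G : Tn R n -> R[i]).

Lemma H2_analytic F : H2 F -> analytic F.
Proof.
move=> [LF FH] j; split; first exact: L2_cintegrable.
move=> k kj; rewrite -(FH (fun i => - k i)); last by exists j; rewrite oppr_lt0.
by apply: eq_cintegral => x _; rewrite characterN conjcK.
Qed.

Lemma analytic_H2 F : L2 F -> analytic F -> H2 F.
Proof.
move=> LF aF; split => // k [j kj]; have [_ h] := aF j.
rewrite -(h (fun i => - k i)); last by rewrite oppr_gt0.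
by apply: eq_cintegral => x _; rewrite characterN.
Qed.

Lemma analytic_inD j F G : analytic_in j F -> analytic_in j G ->
  analytic_in j (fun x => F x + G x).
Proof.
move=> [Fi Fk] [Gi Gk]; split; first exact: cintegrableD.
move=> k kj.
have Fci : cintegrable mu setT (fun x => F x * character k x).
  by under eq_fun do rewrite mulrC; apply: cintegrable_bmM => //; exact: bm_character.
have Gci : cintegrable mu setT (fun x => G x * character k x).
  by under eq_fun do rewrite mulrC; apply: cintegrable_bmM => //; exact: bm_character.
rewrite -[RHS](addr0 0) -{1}(Fk k kj) -(Gk k kj) !cintE -cintegralD//.
by apply: eq_cintegral => x _; rewrite mulrDl.
Qed.

Lemma analytic_inZ j c F : analytic_in j F -> analytic_in j (fun x => c * F x).
Proof.
move=> [Fi Fk]; split; first exact: cintegrableZ.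
move=> k kj.
have Fci : cintegrable mu setT (fun x => F x * character k x).
  by under eq_fun do rewrite mulrC; apply: cintegrable_bmM => //; exact: bm_character.
rewrite -(mulr0 c) -(Fk k kj) !cintE -cintegralZ//.
by apply: eq_cintegral => x _; rewrite mulrA.
Qed.

Lemma analytic_in_coordM j i F : analytic_in j F ->
  analytic_in j (fun x => torus_pt x i * F x).
Proof.
move=> [Fi Fk]; split; first by apply: cintegrable_bmM => //; exact: bm_coord.
move=> k kj; rewrite -(Fk (fun l => dvec i l + k l)); last by rewrite ltr_wpDl.
by apply: eq_cintegral => x _; rewrite characterD character_dvec; ring.
Qed.

Lemma H2D F G : H2 F -> H2 G -> H2 (fun x => F x + G x).
Proof.
move=> hF hG; apply: analytic_H2; first by apply: L2D; [case: hF|case: hG].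
by move=> j; apply: analytic_inD; exact: H2_analytic.
Qed.

Lemma H2Z c F : H2 F -> H2 (fun x => c * F x).
Proof.
move=> hF; apply: analytic_H2; first by apply: L2Z; case: hF.
by move=> j; apply: analytic_inZ; exact: H2_analytic.
Qed.

Lemma H2_szego w : polydisc w -> H2 (fun x : Tn R n => szego (torus_pt x) w).
Proof.
move=> w1; apply: analytic_H2; first by apply: bm_L2; exact: bm_szego.
have := analytic_szego w1 (@analytic1 R n).
by under eq_fun do rewrite mulr1.
Qed.

Lemma H2_1 : H2 (fun _ : Tn R n => 1 : R[i]).
Proof. by apply: analytic_H2; [exact: L2_cst|exact: analytic1]. Qed.

Lemma H2_zero : H2 (fun _ : Tn R n => 0 : R[i]).
Proof. by have := H2Z 0 H2_1; under eq_fun do rewrite mul0r. Qed.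

Lemma H2_szego_sum m (z : 'I_m -> 'I_n -> R[i]) (c : 'I_m -> R[i]) :
  (forall i, polydisc (z i)) ->
  H2 (fun x : Tn R n => \sum_i c i * szego (torus_pt x) (z i)).
Proof.
move=> z1; rewrite /index_enum; elim: (Finite.enum _) => [|i s IH].
  by under eq_fun do rewrite big_nil; exact: H2_zero.
under eq_fun do rewrite big_cons; apply: H2D => //; apply: H2Z.
by apply: H2_szego.
Qed.

Lemma bm_szego_sum m (z : 'I_m -> 'I_n -> R[i]) (c : 'I_m -> R[i]) :
  (forall i, polydisc (z i)) ->
  bounded_meas (fun x : Tn R n => \sum_i c i * szego (torus_pt x) (z i)).
Proof.
move=> z1; apply: bm_sum => i.
by apply: bmM; [exact: bm_cst|exact: bm_szego].
Qed.

Lemma szego_eval_sum m (z : 'I_m -> 'I_n -> R[i]) (c : 'I_m -> R[i]) (w : 'I_n -> R[i]) :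
  (forall i, polydisc (z i)) -> polydisc w ->
  szego_eval w (fun x => \sum_i c i * szego (torus_pt x) (z i)) =
  \sum_i c i * szego w (z i).
Proof.
move=> z1 w1.
have bi i : cintegrable mu setT (fun x => szego (torus_pt x) (z i)).
  by apply: bounded_cintegrable; exact: bm_szego.
transitivity (\sum_i szego_eval w (fun x => c i * szego (torus_pt x) (z i))).
  rewrite {2}/szego_eval [RHS](eq_bigr _ (fun i _ => cintE _)) -cintegral_sum//.
    by apply: eq_cintegral => x _; rewrite mulr_suml.
  by move=> i; apply: szego_eval_integrable => //; exact: cintegrableZ.
by apply: eq_bigr => i _; rewrite szego_evalZ// szego_reproducing.
Qed.

Lemma cint_conj_szego_sum m (z : 'I_m -> 'I_n -> R[i]) (a : 'I_m -> R[i]) F :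
  (forall i, polydisc (z i)) -> cintegrable mu setT F ->
  cint (fun x => F x * conjc (\sum_i a i * szego (torus_pt x) (z i))) =
  \sum_i conjc (a i) * szego_eval (z i) F.
Proof.
move=> z1 Fi.
have Ei i : cintegrable mu setT (fun x => F x * conjc (szego (torus_pt x) (z i))).
  exact: szego_eval_integrable.
transitivity (cint (fun x => \sum_i conjc (a i) * (F x * conjc (szego (torus_pt x) (z i))))).
  apply: eq_cintegral => x _; rewrite rmorph_sum mulr_sumr; apply: eq_bigr => i _.
  by rewrite rmorphM /= mulrCA.
rewrite cintE cintegral_sum//; last by move=> i; exact: cintegrableZ.
by apply: eq_bigr => i _; rewrite cintegralZ.
Qed.

(** Instead of arguing almost everywhere, bound the modulus [a] of [F x] by [d + d^-1 * a ^+ 2] for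
    each positive [d]; the quadratic term has integral 0, and [d] is arbitrary. *)
Lemma cint_sq_eq0 F G : bounded_meas F -> bounded_meas G ->
  cint (fun x => F x * conjc (F x)) = 0 -> cint (fun x => G x * conjc (F x)) = 0.
Proof.
move=> bF [mG [M GM]] F0; apply/eqP; rewrite -normc_eq0 eq_le normc_ge0 andbT.
have Fi := bounded_cintegrable bF.
have sqi := L2_sq (bm_L2 bF).
have sq0 : \int[mu]_x (normc (F x) ^+ 2) = 0.
  move/(congr1 (@complex.Re R)): F0 => /= <-; apply: eq_Rintegral => x _.
  by rewrite -normc_ReIm.
have GFi : cintegrable mu setT (fun x => G x * conjc (F x)).
  by apply: cintegrable_bmM; [split => //; exists M|exact: cintegrableJ].
apply/ler_addgt0Pr => e e0; rewrite add0r.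
(* The [+ 1] keeps [K] positive; [d] below is chosen so that [K * d = e]. *)
pose K := `|M| + 1; have K0 : 0 < K by rewrite ltr_wpDl.
pose d := e / K; have d0 : 0 < d by rewrite divr_gt0.
rewrite (le_trans (normc_cintegral measurableT GFi))//.
have -> : e = \int[mu]_x (K * d + K / d * normc (F x) ^+ 2).
  rewrite RintegralD//; last 2 first.
  - by apply: integrable_cst_lty => //; exact: torus_mu_lty.
  - by apply: eq_integrable (integrableZl measurableT (K / d) sqi).
  rewrite (@RintegralZl _ _ _ mu setT (fun x => normc (F x) ^+ 2) (K / d) measurableT sqi).
  rewrite [X in _ + _ * X]sq0 mulr0 addr0 Rintegral_cst//.
  rewrite (_ : fine _ = 1) ?mulr1; first by rewrite /d mulrC divfK// gt_eqF.
  by transitivity (fine (mu setT)); rewrite // probability_setT.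
apply: le_Rintegral => //.
- exact: cintegrable_normc.
- have := integrableD measurableT (integrable_cst_lty (K * d) measurableT (torus_mu_lty R n))
     (integrableZl measurableT (K / d) sqi).
  exact: eq_integrable.
move=> x _; rewrite Normc.normcM normc_conj.
have GK : normc (G x) <= K by rewrite (le_trans (GM x))// /K (le_trans (ler_norm _))// lerDl.
rewrite (le_trans (ler_wpM2r (normc_ge0 _) GK))// -mulrA -mulrDr ler_pM2l//.
move: (normc_ge0 (F x)); move: (normc (F x)) => a a0.
have [ad|/ltW da] := leP a d.
  by rewrite (le_trans ad)// lerDl mulr_ge0 ?sqr_ge0// invr_ge0 ltW.
apply: ler_wpDl; first exact: ltW.
rewrite -subr_ge0.
have -> : d^-1 * a ^+ 2 - a = d^-1 * a * (a - d) by field; rewrite gt_eqF.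
by rewrite mulr_ge0 ?subr_ge0// mulr_ge0// invr_ge0 ltW.
Qed.

(** Evaluates the polynomials that separate one node from the others in the proof that the Gram
    matrix is invertible. *)
Lemma szego_eval_prod (I : Type) (s : seq I) (f : I -> 'I_n) (c : I -> R[i])
    (z : 'I_n -> R[i]) : polydisc z ->
  szego_eval z (fun x => \prod_(i <- s) (torus_pt x (f i) - c i)) =
  \prod_(i <- s) (z (f i) - c i).
Proof.
move=> z1.
suff : analytic (fun x : Tn R n => \prod_(i <- s) (torus_pt x (f i) - c i)) /\
  szego_eval z (fun x => \prod_(i <- s) (torus_pt x (f i) - c i)) =
  \prod_(i <- s) (z (f i) - c i) by case.
elim: s => [|i s [IHa IH]].
  rewrite big_nil; under eq_fun do rewrite big_nil.
  by split; [exact: analytic1|exact: szego_eval1].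
rewrite big_cons -IH -szego_eval_linear//.
under eq_fun do rewrite big_cons; split => // j.
under eq_fun do rewrite mulrBl; apply: analytic_inD.
  exact: analytic_in_coordM.
by under eq_fun do rewrite -mulNr; exact: analytic_inZ.
Qed.

Lemma bm_prod_coord (I : Type) (s : seq I) (f : I -> 'I_n) (c : I -> R[i]) :
  bounded_meas (fun x : Tn R n => \prod_(i <- s) (torus_pt x (f i) - c i)).
Proof.
elim: s => [|i s IH]; first by under eq_fun do rewrite big_nil; exact: bm_cst.
under eq_fun do rewrite big_cons; apply: bmM => //.
by apply: bmD; [exact: bm_coord|exact: bm_cst].
Qed.

Section interpolation.
Variables (m : nat) (z : 'I_m -> 'I_n -> R[i]).
Hypotheses (zinj : injective z) (z1 : forall i, polydisc (z i)).

(* A left null vector yields a combination of kernels of norm zero, whose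
   pairing with a polynomial vanishing at all nodes but one picks out a
   coefficient. *)
Lemma szego_gram_unit : szego_gram z \in unitmx.
Proof.
rewrite -row_free_unit; apply: inj_row_free => v v0.
(* The conjugate makes the value of [F] at [z i] the conjugate of entry [i] of [v *m szego_gram z],
   by Hermitian symmetry of the kernel. *)
pose a i := conjc (v 0 i).
pose F x := \sum_i a i * szego (@torus_pt R n x) (z i).
have bF : bounded_meas F by exact: bm_szego_sum.
have evF i : szego_eval (z i) F = 0.
  rewrite szego_eval_sum//.
  transitivity (conjc ((v *m szego_gram z) 0 i)); last by rewrite v0 mxE conjc0.
  by rewrite mxE rmorph_sum; apply: eq_bigr => j _; rewrite mxE rmorphM /= szegoC.
have FF : cint (fun x => F x * conjc (F x)) = 0.
  rewrite cint_conj_szego_sum//; last exact: bounded_cintegrable.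
  by rewrite big1// => i _; rewrite evF mulr0.
apply/rowP => i0; rewrite mxE.
have sep i : i != i0 -> exists j, z i0 j != z i j.
  move=> ii0; apply/existsP; rewrite -negb_forall; apply/negP => /forallP h.
  move/eqP: ii0; apply; apply: zinj; apply/funext => j.
  by have := h j => /eqP.
have /choice[f hf] : forall k : {i : 'I_m | i != i0}, exists j, z i0 j != z (val k) j.
  by move=> k; apply: sep; exact: valP k.
have := cint_sq_eq0 bF (bm_prod_coord (index_enum _) f (fun k => z (val k) (f k))) FF.
rewrite cint_conj_szego_sum//; last by apply: bounded_cintegrable; exact: bm_prod_coord.
rewrite (bigD1 i0)//= [X in _ + X]big1 ?addr0; last first.
  move=> i ii0; rewrite szego_eval_prod//.
  by rewrite (bigD1 (Sub i ii0 : {i : 'I_m | i != i0}))//= subrr mul0r mulr0.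
rewrite conjcK szego_eval_prod// => /eqP; rewrite mulf_eq0 => /orP[/eqP //|].
rewrite prodf_seq_eq0 => /hasP[k _ /=]; rewrite subr_eq0 => h.
by have := hf k; rewrite h.
Qed.

(** The coefficients [interp_c] solve exactly this linear system: [psiZW] interpolates the data,
    with no control of its supremum. *)
Lemma szego_eval_psi (w : 'I_m -> R[i]) i : szego_eval (z i) (psiZW z w) = w i.
Proof.
rewrite szego_eval_sum//.
have := congr1 (fun M : 'cV_m => M i 0)
  (mulKVmx szego_gram_unit (\col_i w i)).
rewrite /= [RHS]mxE mxE => <-; apply: eq_bigr => j _.
by rewrite [szego_gram z i j]mxE mulrC.
Qed.

Lemma H2_psi (w : 'I_m -> R[i]) : H2 (psiZW z w).
Proof. exact: H2_szego_sum. Qed.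

Lemma bm_psi (w : 'I_m -> R[i]) : bounded_meas (psiZW z w).
Proof. exact: bm_szego_sum. Qed.

Lemma Mn_orth (g : Tn R n -> R[i]) G : Mn g -> H2 G -> cint (fun x => G x * g x) = 0.
Proof.
move=> [_ gM] hG; rewrite -(gM G (fun=> 0) hG H2_zero).
by apply: eq_cintegral => x _; rewrite addr0 conjcK mulrC.
Qed.

Lemma H2_0_orth (h : Tn R n -> R[i]) (c : 'I_m -> R[i]) : H2_0 h ->
  cint (fun x => (\sum_i c i * szego (torus_pt x) (z i)) * h x) = 0.
Proof.
move=> [hH h0]; have ah := H2_analytic hH.
have hi : cintegrable mu setT h by apply: L2_cintegrable; case: hH.
have ci i : cintegrable mu setT (fun x => szego (torus_pt x) (z i) * h x).
  by apply: cintegrable_bmM => //; exact: bm_szego.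
transitivity (cint (fun x => \sum_i c i * (szego (torus_pt x) (z i) * h x))).
  by apply: eq_cintegral => x _; rewrite mulr_suml; apply: eq_bigr => i _; rewrite mulrA.
rewrite cintE cintegral_sum//; last by move=> i; exact: cintegrableZ.
rewrite big1// => i _; rewrite cintegralZ// -cintE cint_szego//.
rewrite [cint h](_ : _ = 0) ?mulr0// -h0; apply: eq_cintegral => x _.
by rewrite character0 conjc1 mulr1.
Qed.

Lemma MQ_L2 f : MQ z f -> L2 f.
Proof.
move=> [a [g [h [[Lg _] [[Lh _] _] fE]]]].
have -> : f = (fun x => conjc (\sum_i a i * szego (torus_pt x) (z i)) + g x + h x).
  exact/funext.
apply: L2D => //; apply: L2D => //.
by apply: L2J; apply: bm_L2; exact: bm_szego_sum.
Qed.

Lemma cint_MQ (c a : 'I_m -> R[i]) (g h : Tn R n -> R[i]) : Mn g -> H2_0 h ->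
  cint (fun x => (\sum_i c i * szego (torus_pt x) (z i)) *
    (conjc (\sum_i a i * szego (torus_pt x) (z i)) + g x + h x)) =
  \sum_i conjc (a i) * \sum_j c j * szego (z i) (z j).
Proof.
move=> gM hH; set P := fun x => \sum_i c i * szego (@torus_pt R n x) (z i).
have bP : bounded_meas P by exact: bm_szego_sum.
set Q := fun x => conjc (\sum_i a i * szego (@torus_pt R n x) (z i)).
have bQ : bounded_meas Q by apply: bmJ; exact: bm_szego_sum.
have gi : cintegrable mu setT g by apply: L2_cintegrable; case: gM.
have hi : cintegrable mu setT h by apply: L2_cintegrable; case: hH => [[]].
transitivity (cint (fun x => P x * Q x) + cint (fun x => P x * g x) + cint (fun x => P x * h x)).
  rewrite !cintE -!cintegralD//; try exact: cintegrable_bmM;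
    try (by apply: cintegrable_bmM => //; exact: bounded_cintegrable).
  - by apply: eq_cintegral => x _; rewrite /Q /P; ring.
  - apply: cintegrableD => //; try exact: cintegrable_bmM.
    by apply: cintegrable_bmM => //; exact: bounded_cintegrable.
rewrite (Mn_orth gM); last exact: H2_szego_sum.
rewrite (H2_0_orth c hH) !addr0 cint_conj_szego_sum//; last exact: bounded_cintegrable.
by apply: eq_bigr => i _; rewrite szego_eval_sum.
Qed.

Lemma cint_psi_MQ (w : 'I_m -> R[i]) (a : 'I_m -> R[i]) (g h : Tn R n -> R[i]) :
  Mn g -> H2_0 h ->
  cint (fun x => psiZW z w x *
    (conjc (\sum_i a i * szego (torus_pt x) (z i)) + g x + h x)) =
  \sum_i conjc (a i) * w i.
Proof.
move=> gM hH; rewrite cint_MQ//; apply: eq_bigr => i _.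
by rewrite -szego_eval_sum// szego_eval_psi.
Qed.

End interpolation.
End hardy_space.

(** * Interpolation implies contractivity *)

Section dilation.
Variables (R : realType) (n : nat).
Variable phi : ('I_n -> R[i]) -> R[i].
Hypothesis phiS : schur_class phi.

Lemma holomorphic_continuous z : polydisc z -> mcontinuous_at phi z.
Proof.
move=> z1 e e0; have [d hd] := phiS.1 z z1; have [dl d0 h] := hd 1 ltr01.
(* The [1] accounts for the remainder, taken with tolerance 1, and the sum for the linear part;
   halving in the radius makes the final inequality strict. *)
pose K : R := 1 + \sum_k normc (d k).
have K0 : 0 < K by rewrite ltr_pwDl// sumr_ge0// => k _; exact: normc_ge0.
exists (Num.min dl (e / K / 2)).
  by rewrite lt_min d0 divr_gt0// divr_gt0.
move=> b hb; pose t k := b k - z k.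
have -> : b = (fun k => z k + t k) by apply/funext => k; rewrite /t addrC subrK.
have tl k : normc (t k) < dl by have := hb k; rewrite lt_min => /andP[].
have te k : normc (t k) <= e / K / 2 by have := hb k; rewrite lt_min => /andP[_ /ltW].
have := h t tl; rewrite mul1r => ht.
have maxle : \big[Num.max/0]_(k < n) normc (t k) <= e / K / 2.
  by apply: bigmax_le => //; rewrite ltW// divr_gt0// divr_gt0.
have -> : phi (fun k => z k + t k) - phi z =
  phi (fun k => z k + t k) - phi z - \sum_(k < n) d k * t k + \sum_(k < n) d k * t k.
  by rewrite subrK.
rewrite (le_lt_trans (le_normcD _ _))//.
rewrite (@le_lt_trans _ _ (K * (e / K / 2)))//.
  rewrite /K mulrDl mul1r -/K lerD//; first exact: le_trans maxle.
  rewrite (le_trans (normc_sum _))// mulr_suml ler_sum// => k _.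
  by rewrite Normc.normcM ler_wpM2l ?normc_ge0.
rewrite mulrA mulrCA divff ?gt_eqF// mulr1.
by move: e0; lra.
Qed.

Variable r : R.
Hypothesis r01 : 0 < r < 1.

Definition dilate (a : 'I_n -> R[i]) : 'I_n -> R[i] := fun k => r%:C%C * a k.

Lemma normc_dilate a k : normc (dilate a k) = r * normc (a k).
Proof.
by case/andP: r01 => r0 _; rewrite Normc.normcM normc_real ger0_norm// ltW.
Qed.

Lemma polydisc_dilate a : (forall j, normc (a j) <= 1) -> polydisc (dilate a).
Proof.
case/andP: r01 => r0 r1 a1 k; rewrite normc_dilate (le_lt_trans _ r1)//.
by rewrite ler_piMr// ltW.
Qed.

Lemma dilate_continuous a : (forall j, normc (a j) <= 1) ->
  mcontinuous_at (fun a => phi (dilate a)) a.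
Proof.
move=> a1 e e0; case/andP: (r01) => r0 r1.
have [dl d0 h] := holomorphic_continuous (polydisc_dilate a1) e0.
exists dl => // b hb; apply: h => k.
rewrite /dilate -mulrBr Normc.normcM normc_real (ger0_norm (ltW r0)).
rewrite (le_lt_trans _ (hb k))// ler_piMl ?normc_ge0//; exact: ltW.
Qed.

Lemma dilate_sep_derivable : sep_derivable (fun a => phi (dilate a)).
Proof.
move=> a k a1; case/andP: (r01) => r0 r1.
have [d hd] := phiS.1 _ (polydisc_dilate a1).
exists (r%:C%C * d k) => e e0; have [dl d0 h] := hd e e0.
exists dl => // s hs.
pose t j : R[i] := if j == k then r%:C%C * s else 0.
have nrs : normc (r%:C%C * s) <= normc s.
  rewrite Normc.normcM normc_real (ger0_norm (ltW r0)) ler_piMl ?normc_ge0//; exact: ltW.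
have tl j : normc (t j) < dl.
  by rewrite /t; case: eqP => _; [exact: le_lt_trans hs|rewrite Normc.normc0].
have := h t tl.
have -> : (fun j => dilate a j + t j) = dilate (fun j => if j == k then a k + s else a j).
  apply/funext => j; rewrite /dilate /t; case: eqP => [->|_]; first by rewrite mulrDr.
  by rewrite addr0.
rewrite (_ : dilate (fun j => if j == k then a k else a j) = dilate a); last first.
  by congr dilate; apply/funext => j; case: eqP => [->|].
rewrite (bigD1 k)//= [X in _ - (_ + X)]big1 ?addr0; last first.
  by move=> j jk; rewrite /t (negbTE jk) mulr0.
rewrite {1}/t eqxx [d k * _]mulrCA mulrA => h1; apply: (le_trans h1).
apply: ler_wpM2l; first exact: ltW.
apply: bigmax_le; first exact: normc_ge0.
by move=> j _; rewrite /t; case: eqP => _ //; rewrite Normc.normc0 normc_ge0.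
Qed.

Lemma dilate_le1 a : (forall j, normc (a j) <= 1) -> normc (phi (dilate a)) <= 1.
Proof. by move=> a1; apply: phiS.2; exact: polydisc_dilate. Qed.

Lemma dilate_cauchy v : polydisc v ->
  cint (fun y => phi (dilate (torus_pt y)) * conjc (szego (torus_pt y) v)) =
  phi (dilate v).
Proof.
move=> v1; apply: (@cauchy_polydisc R n (fun a => phi (dilate a)) 1) => //.
- exact: dilate_continuous.
- exact: dilate_sep_derivable.
- exact: dilate_le1.
Qed.

End dilation.

Section product_integrable.
Context (d1 d2 : measure_display) (T1 : measurableType d1)
  (T2 : measurableType d2) (R : realType).
Variables (P1 : probability T1 R) (P2 : probability T2 R).

Lemma cmeas_comp (d d' : measure_display) (U : measurableType d)
    (V : measurableType d') (f : V -> R[i]) (g : U -> V) :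
  cmeas setT f -> measurable_fun setT g -> cmeas setT (fun x => f (g x)).
Proof.
by move=> [f1 f2] mg; split;
  [apply: (@measurableT_comp _ _ _ _ _ _ (fun y => cRe (f y)))|
   apply: (@measurableT_comp _ _ _ _ _ _ (fun y => cIm (f y)))].
Qed.

(** Tonelli's theorem, the second factor having total mass one. *)
Lemma cintegrable_fst (f : T1 -> R[i]) : cintegrable P1 setT f ->
  cintegrable (P1 \x P2)%E setT (fun p => f p.1).
Proof.
move=> fi; have mf := cintegrable_cmeas fi.
have mf1 : cmeas setT (fun p : T1 * T2 => f p.1).
  by apply: cmeas_comp => //; exact: measurable_fst.
have mn : measurable_fun setT (fun p : T1 * T2 => (normc (f p.1))%:E).
  by apply/measurable_EFinP; exact: cmeas_normc.
suff ni : (P1 \x P2)%E.-integrable setT (EFin \o (fun p => normc (f p.1))).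
  exact: (cintegrable_le measurableT mf1 ni).
apply/integrableP; split => //.
under eq_integral do rewrite /= ger0_norm ?normc_ge0//.
rewrite fubini_tonelli1//=; last by move=> p; rewrite lee_fin normc_ge0.
have P2T c : (\int[P2]_y c%:E = c%:E)%E.
  rewrite integral_cst//; transitivity (c%:E * P2 setT)%E => //.
  by rewrite probability_setT mule1.
rewrite /fubini_F /=; under eq_integral do rewrite P2T.
have /integrableP[_] := cintegrable_normc measurableT fi.
by under eq_integral do rewrite /= ger0_norm ?normc_ge0//.
Qed.

End product_integrable.

Section forward.
Variables (R : realType) (n m : nat) (z : 'I_m -> 'I_n -> R[i]).
Local Notation mu := (torus_mu R n).
Hypothesis z1 : forall i, polydisc (z i).

(** Performs the inner integration over [x] in [dilated_bound], with [v] a dilated torus point. *)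
Lemma cint_szego_MQ v (a : 'I_m -> R[i]) (g h : Tn R n -> R[i]) :
  polydisc v -> Mn g -> H2_0 h ->
  cint (fun x => szego (torus_pt x) v *
    (conjc (\sum_i a i * szego (torus_pt x) (z i)) + g x + h x)) =
  \sum_i conjc (a i) * szego (z i) v.
Proof.
move=> v1 gM [hH h0].
have bv := bm_szego v1.
have gi : cintegrable mu setT g by apply: L2_cintegrable; case: gM.
have hi : cintegrable mu setT h by apply: L2_cintegrable; case: hH.
have svi : cintegrable mu setT (fun x => szego (torus_pt x) v) by exact: bounded_cintegrable.
set Q := fun x => conjc (\sum_i a i * szego (@torus_pt R n x) (z i)).
have Qi : cintegrable mu setT Q.
  by apply: bounded_cintegrable; apply: bmJ; exact: bm_szego_sum.
transitivity (cint (fun x => szego (torus_pt x) v * Q x)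
  + cint (fun x => szego (torus_pt x) v * g x) + cint (fun x => szego (torus_pt x) v * h x)).
  rewrite !cintE -!cintegralD//; try exact: cintegrable_bmM.
    by apply: eq_cintegral => x _; ring.
  by apply: cintegrableD => //; exact: cintegrable_bmM.
rewrite (Mn_orth gM (H2_szego v1)) (cint_szego v1 (H2_analytic hH)).
have -> : cint h = 0.
  by rewrite -h0; apply: eq_cintegral => x _; rewrite character0 conjc1 mulr1.
rewrite !addr0 cint_conj_szego_sum//.
by apply: eq_bigr => i _; rewrite szego_reproducing.
Qed.

Variable phi : ('I_n -> R[i]) -> R[i].
Hypothesis phiS : schur_class phi.
Variable r : R.
Hypothesis r01 : 0 < r < 1.
Local Notation dl := (dilate r).

(** The radius is real, so conjugation leaves it alone and it can change sides. *)
Lemma szego_dilate (x y : 'I_n -> R[i]) : szego (dl x) y = szego x (dl y).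
Proof.
by apply: eq_bigr => k _; rewrite /dilate rmorphM /= oppr0 mulrCA mulrA.
Qed.

(** Two dilations occur in [Psi]: one moves the argument of [phi] inside the polydisc, the other the
    parameter of the kernel. Integrating over [y] first, Cauchy's formula at the interior point
    [dl (torus_pt x)] yields [phi] at the twice dilated [x], times [f x]. Integrating over [x] first
    yields a combination of kernels at the nodes, to which Cauchy's formula in [y] applies. Since
    [phi] is bounded by 1, the first expression is at most the L^1 norm of [f]. *)
Lemma dilated_bound (a : 'I_m -> R[i]) (g h f : Tn R n -> R[i]) :
  Mn g -> H2_0 h -> L2 f ->
  (forall x, f x = conjc (\sum_i a i * szego (torus_pt x) (z i)) + g x + h x) ->
  normc (\sum_i conjc (a i) * phi (dl (dl (z i)))) <= \int[mu]_x normc (f x).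
Proof.
move=> gM hH Lf fE; have fi := L2_cintegrable Lf.
pose Psi (p : Tn R n * Tn R n) :=
  phi (dl (torus_pt p.2)) * szego (torus_pt p.1) (dl (torus_pt p.2)) * f p.1.
have pt1 (x : Tn R n) j : normc (torus_pt x j) <= 1 by rewrite normc_torus_pt.
have pd x := polydisc_dilate r01 (pt1 x).
have mphi : cmeas setT (fun y : Tn R n => phi (dl (torus_pt y))).
  apply: (@cmeas_torus _ _ (fun a => phi (dl a))) => b b1.
  by apply: dilate_continuous => // j; rewrite b1.
have bphi : bounded_meas (fun y : Tn R n => phi (dl (torus_pt y))).
  by split => //; exists 1 => x; apply: dilate_le1.
have mS : cmeas setT (fun p : Tn R n * Tn R n =>
    phi (dl (torus_pt p.2)) * szego (torus_pt p.1) (dl (torus_pt p.2))).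
  apply: cmeasM.
    by apply: (@cmeas_comp _ _ _ _ _ (fun y : Tn R n => phi (dl (torus_pt y)))).
  apply: cmeas_prod => k; apply: cmeasV; apply: cmeasB; first exact: cmeas_cst.
  apply: cmeasM.
    apply: (@cmeas_comp _ _ _ _ _ (fun y : Tn R n => torus_pt y k)).
      exact: cmeas_torus_pt.
    exact: measurable_fst.
  apply: cmeasJ; apply: cmeasM; first exact: cmeas_cst.
  apply: (@cmeas_comp _ _ _ _ _ (fun y : Tn R n => torus_pt y k)).
    exact: cmeas_torus_pt.
  exact: measurable_snd.
(* The coordinates of [dl (torus_pt y)] have modulus [r], so each of the [n] factors of the kernel
   is at most [(1 - r)^-1]. *)
pose C : R := (1 - r)^-1 ^+ n.
have SC (x y : Tn R n) :
    normc (phi (dl (torus_pt y)) * szego (torus_pt x) (dl (torus_pt y))) <= C.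
  rewrite Normc.normcM -[C]mul1r; apply: ler_pM; rewrite ?normc_ge0//.
    exact: dilate_le1.
  rewrite (le_trans (szego_torus_le _ (pd y)))// /szego_bound /C.
  rewrite -[X in _ ^+ X](card_ord n) -prodr_const ler_prod// => k _.
  rewrite normc_dilate// normc_torus_pt mulr1 lexx andbT invr_ge0 subr_ge0.
  by case/andP: r01 => _ /ltW.
have Psii : cintegrable (mu \x mu)%E setT Psi.
  apply: (cintegrable_Mbounded (M := C)) => //.
  exact: cintegrable_fst.
have sec1 x : cintegrable mu setT (fun y => Psi (x, y)).
  rewrite /Psi /=; under eq_fun do rewrite mulrC.
  apply: cintegrableZ => //; apply: (cintegrable_bounded (M := C)) => //.
    exact: torus_mu_lty.
  by apply: (@cmeas_comp _ _ _ _ _ _ (fun y => (x, y)) mS); exact: measurable_pair1.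
have sec2 y : cintegrable mu setT (fun x => Psi (x, y)).
  rewrite /Psi /=; under eq_fun do rewrite -mulrA.
  apply: cintegrableZ => //; apply: cintegrable_bmM => //; exact: bm_szego.
have E1 : cintegral (mu \x mu)%E setT Psi = cint (fun x => phi (dl (dl (torus_pt x))) * f x).
  rewrite cintegral12//; apply: eq_cintegral => x _.
  rewrite /Psi /= [RHS]mulrC -dilate_cauchy// -cintegralZ//.
    by apply: eq_cintegral => y _; rewrite mulrC szegoC szego_dilate.
  apply: szego_eval_integrable => //; exact: bounded_cintegrable.
have E2 : cintegral (mu \x mu)%E setT Psi = \sum_i conjc (a i) * phi (dl (dl (z i))).
  have zd i : polydisc (dl (z i)) by apply: polydisc_dilate => // j; exact/ltW/z1.
  rewrite cintegral21//.
  transitivity (cint (fun y : Tn R n =>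
      \sum_i conjc (a i) * (phi (dl (torus_pt y)) * conjc (szego (torus_pt y) (dl (z i)))))).
    apply: eq_cintegral => y _.
    transitivity (phi (dl (torus_pt y)) *
        cint (fun x => szego (torus_pt x) (dl (torus_pt y)) * f x)).
      rewrite cintE -cintegralZ//.
        by apply: eq_cintegral => x _; rewrite /Psi /= mulrA.
      by apply: cintegrable_bmM => //; exact: bm_szego.
    rewrite (_ : cint _ = \sum_i conjc (a i) * szego (z i) (dl (torus_pt y))).
      rewrite mulr_sumr; apply: eq_bigr => i _.
      by rewrite mulrCA szegoC szego_dilate.
    rewrite -(cint_szego_MQ a (pd y) gM hH); apply: eq_cintegral => x _.
    by rewrite fE.
  have ii i : cintegrable mu setT (fun y : Tn R n =>
      phi (dl (torus_pt y)) * conjc (szego (torus_pt y) (dl (z i)))).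
    by apply: szego_eval_integrable => //; exact: bounded_cintegrable.
  rewrite cintE cintegral_sum//; last by move=> i; exact: cintegrableZ.
  by apply: eq_bigr => i _; rewrite cintegralZ// -cintE dilate_cauchy.
rewrite -E2 E1.
have mphi2 : cmeas setT (fun x : Tn R n => phi (dl (dl (torus_pt x)))).
  apply: (@cmeas_torus _ _ (fun a => phi (dl (dl a)))) => b b1 e e0.
  have [|d d0 hd] := @dilate_continuous _ _ _ phiS r r01 (dl b) _ e e0.
    by move=> j; apply/ltW/polydisc_dilate => // k; rewrite b1.
  case/andP: (r01) => r0 r1.
  exists d => // c hc; apply: hd => k.
  rewrite /dilate -mulrBr Normc.normcM normc_real (ger0_norm (ltW r0)).
  rewrite (le_lt_trans _ (hc k))// ler_piMl ?normc_ge0//; exact: ltW.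
have phi2le (x : Tn R n) : normc (phi (dl (dl (torus_pt x)))) <= 1.
  by apply: dilate_le1 => // j; apply/ltW/pd.
have pfi : cintegrable mu setT (fun x => phi (dl (dl (torus_pt x))) * f x).
  by apply: cintegrable_bmM => //; split => //; exists 1.
rewrite (le_trans (normc_cintegral measurableT pfi))//.
apply: le_Rintegral => //; try exact: cintegrable_normc.
by move=> x _; rewrite Normc.normcM ler_piMl ?normc_ge0.
Qed.

End forward.

Section interpolation_contraction.
Variables (R : realType) (n m : nat) (z : 'I_m -> 'I_n -> R[i]) (w : 'I_m -> R[i]).
Local Notation mu := (torus_mu R n).

Lemma L1normE (f : Tn R n -> R[i]) : cintegrable mu setT f ->
  L1norm f = (\int[mu]_x normc (f x))%:E.
Proof.
move=> fi; rewrite /Rintegral fineK//; apply: integrable_fin_num => //.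
exact: cintegrable_normc.
Qed.

Lemma interpolation_contraction (phi : ('I_n -> R[i]) -> R[i]) :
  injective z -> (forall i, polydisc (z i)) ->
  schur_class phi -> (forall i, phi (z i) = w i) ->
  contraction_on (MQ z) (fun f => cint (fun x => psiZW z w x * f x)).
Proof.
move=> zinj z1 phiS phiw f fMQ; have Lf := MQ_L2 z1 fMQ.
rewrite (L1normE (L2_cintegrable Lf)) lee_fin.
case: fMQ => [a [g [h [gM hH fE]]]].
have fE' : f = (fun x => conjc (\sum_(i < m) a i * szego (torus_pt x) (z i)) + g x + h x).
  exact/funext.
rewrite {1}fE' cint_psi_MQ//; apply/ler_addgt0Pr => e e0.
pose K : R := 1 + \sum_i normc (a i).
have K0 : 0 < K by rewrite ltr_pwDl// sumr_ge0// => k _; exact: normc_ge0.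
have eK : 0 < e / K by rewrite divr_gt0.
have /choice[d hd] : forall i, exists d : R, 0 < d /\
    forall b, (forall k, normc (b k - z i k) < d) -> normc (phi b - phi (z i)) < e / K.
  by move=> i; have [d d0 hd] := holomorphic_continuous phiS (z1 i) eK; exists d.
(* Two dilations displace a coordinate by at most [1 - r * r = eta * (2 - eta) < 2 * eta], and
   [d i / 3] keeps this below [d i]. The default [2^-1] ensures that [r] is positive, also when
   there are no nodes. *)
pose eta : R := \big[Num.min/2^-1]_i (d i / 3).
have eta0 : 0 < eta.
  apply: lt_bigmin; first by rewrite invr_gt0.
  by move=> i _; rewrite divr_gt0//; case: (hd i).
have eta2 : eta <= 2^-1 by exact: bigmin_le_id.
have etad i : eta <= d i / 3 by exact: bigmin_le.
pose r := 1 - eta.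
have r01 : 0 < r < 1 by rewrite /r; move: eta0 eta2; lra.
have hb := dilated_bound z1 phiS r01 gM hH Lf fE.
have -> : \sum_i conjc (a i) * w i =
    \sum_i conjc (a i) * phi (dilate r (dilate r (z i))) +
    \sum_i conjc (a i) * (phi (z i) - phi (dilate r (dilate r (z i)))).
  by rewrite -big_split; apply: eq_bigr => i _; rewrite /= -mulrDr (addrC (phi (z i))) addrA subrr add0r phiw.
rewrite (le_trans (le_normcD _ _))// lerD// (le_trans (normc_sum _))//.
rewrite (@le_trans _ _ (\sum_i normc (a i) * (e / K)))//.
  apply: ler_sum => i _; rewrite Normc.normcM normc_conj ler_wpM2l ?normc_ge0//.
  rewrite normcB ltW//; have [di0 hdi] := hd i; apply: hdi => k.
  rewrite /dilate mulrA -[X in _ - X]mul1r -mulrBl Normc.normcM.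
  have -> : r%:C%C * r%:C%C - 1 = (r * r - 1)%:C%C :> R[i].
    by apply: eqc; rewrite ?cReD ?cReM ?cImD ?cImM /=; ring.
  rewrite normc_real.
  have zk := z1 i k.
  rewrite (@le_lt_trans _ _ `|r * r - 1|)//.
    by rewrite ler_piMr// ltW.
  have -> : r * r - 1 = - (eta * (2 - eta)) by rewrite /r; ring.
  rewrite normrN ger0_norm; last by rewrite mulr_ge0 ?ltW//; move: eta2; lra.
  have := etad i; move: eta0 di0; rewrite mulrBr => h1 h2 h3.
  have : 0 < eta * eta by rewrite mulr_gt0.
  by move: h1 h2 h3; lra.
rewrite -mulr_suml.
rewrite mulrA ler_pdivrMr// mulrC ler_pM2l//.
by rewrite /K lerDr.
Qed.

End interpolation_contraction.

(** * The complex Hahn-Banach theorem *)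

Section hahn_banach.
Variables (R : realType) (V : lmodType R[i]) (D M : set V) (p : V -> R).
Variable L0 : V -> R[i].
Hypothesis D0 : D 0.
Hypothesis DL : forall c u v, D u -> D v -> D (c *: u + v).
Hypothesis pD : forall u v, D u -> D v -> p (u + v) <= p u + p v.
Hypothesis pZ : forall c u, D u -> p (c *: u) = normc c * p u.
Hypothesis M0 : M 0.
Hypothesis ML : forall c u v, M u -> M v -> M (c *: u + v).
Hypothesis MD : M `<=` D.
Hypothesis L0L : forall c u v, M u -> M v -> L0 (c *: u + v) = c * L0 u + L0 v.
Hypothesis L0p : forall u, M u -> normc (L0 u) <= p u.

(* Graphs of real-linear functionals dominated by [p]. *)
Let dominated (G : set (V * R)) :=
  (forall x, G x -> D x.1 /\ x.2 <= p x.1) /\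
  (forall (r : R) x y, G x -> G y -> G (r%:C%C *: x.1 + y.1, r * x.2 + y.2)).

Let G0 : set (V * R) := [set x | M x.1 /\ x.2 = cRe (L0 x.1)].

Let p0 : p 0 = 0.
Proof. by have := pZ 0 D0; rewrite scaler0 Normc.normc0 mul0r. Qed.

Let G0_dominated : dominated G0.
Proof.
split=> [[u s] [/= Mu /= ->]|r [u s] [v t] [/= Mu /= ->] [/= Mv /= ->]].
  split; first exact: MD.
  by rewrite (le_trans (ler_norm _))// (le_trans (normRe_le _))// L0p.
split => /=; first exact: ML.
by rewrite L0L// cReD cReM /= mul0r subr0.
Qed.

Let G00 : G0 (0, 0).
Proof.
split => //=; have := L0p M0; rewrite p0 => h.
have /eqP : normc (L0 0) == 0 by rewrite eq_le h normc_ge0.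
by move/eqP; rewrite normc_eq0 => /eqP ->.
Qed.

(** Zorn's lemma is applied to the sets [X] for which [G0] united with [X] is dominated; this covers
    the empty chain and makes the maximal graph contain [G0]. *)
Let maximal : exists2 G, dominated G /\ G0 `<=` G &
  forall G', dominated G' -> G `<=` G' -> G' `<=` G.
Proof.
have [|A [PA maxA]] := @Zorn_bigcup (V * R)%type [set X | dominated (G0 `|` X)].
  move=> F FP tot; split.
    move=> x [/(proj1 G0_dominated) //|[X FX Xx]].
    by have [h _] := FP _ FX; apply: h; right.
  have key X r x y : F X -> (G0 `|` X) x -> (G0 `|` X) y ->
      (G0 `|` \bigcup_(X in F) X) (r%:C%C *: x.1 + y.1, r * x.2 + y.2).
    move=> FX hx hy; have [_ h] := FP _ FX.
    by have [|] := h r x y hx hy; [left|right; exists X].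
  move=> r x y [Gx|[X FX Xx]] [Gy|[Y FY Yy]].
  - by left; exact: (proj2 G0_dominated).
  - by apply: (key Y) => //; [left|right].
  - by apply: (key X) => //; [right|left].
  - have [XY|YX] := tot _ _ FX FY.
      by apply: (key Y) => //; right => //; exact: XY.
    by apply: (key X) => //; right => //; exact: YX.
exists (G0 `|` A); first by split => // x; left.
move=> G' dG' sub x G'x; apply: contrapT => nx.
apply: (maxA G'); last first.
  rewrite /= (_ : G0 `|` G' = G')//; apply/seteqP; split => y; last by right.
  by case=> // Gy; apply: sub; left.
split; first by move=> y Ay; apply: sub; right.
by move=> h; apply: nx; right; exact: h.
Qed.

(** Extend the real part of [L0] as a real-linear functional dominated by [p], through graphs, then
    recover the complex functional from its real part. The set [D] confines the extension to vectors
    on which [p] is a seminorm. *)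
Lemma complex_hahn_banach : exists L : V -> R[i],
  [/\ forall c u v, D u -> D v -> L (c *: u + v) = c * L u + L v,
      forall u, D u -> normc (L u) <= p u &
      forall u, M u -> L u = L0 u].
Proof.
have [G [[Gp GL] G0G] Gmax] := maximal.
have Gz : G (0, 0) by exact: G0G.
have GZ r u s : G (u, s) -> G (r%:C%C *: u, r * s).
  by move=> Gu; have := GL r _ _ Gu Gz; rewrite /= !addr0.
have total v : D v -> exists s, G (v, s).
  move=> Dv; apply: contrapT => nv.
  (* The lower constraints on a value at [v]. By [sep] each lies below every upper constraint
     [p (u' + v) - s'], so the supremum is an admissible value. *)
  pose E : set R := [set t | exists u s, G (u, s) /\ t = s - p (u - v)].
  have Dm u : D u -> D (u - v).
    by move=> Du; have := DL (-1) Dv Du; rewrite scaleN1r addrC.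
  have sep u s u' s' : G (u, s) -> G (u', s') -> s - p (u - v) <= p (u' + v) - s'.
    move=> Gu Gu'; have [/= Du _] := Gp _ Gu; have [/= Du' _] := Gp _ Gu'.
    have [/= _ h] := Gp _ (GL 1 _ _ Gu Gu').
    rewrite rmorph1 scale1r mul1r in h.
    have Dp : D (u' + v) by have := DL 1 Du' Dv; rewrite scale1r.
    have := pD (Dm _ Du) Dp.
    rewrite (_ : u - v + (u' + v) = u + u'); last by rewrite addrACA addNr addr0.
    by move: h; lra.
  have E0 : E !=set0 by exists (0 - p (0 - v)), 0, 0.
  have Eub u' s' : G (u', s') -> ubound E (p (u' + v) - s').
    by move=> Gu' _ [u [s [Gu ->]]]; exact: sep.
  pose c := sup E.
  have c1 u s : G (u, s) -> s - p (u - v) <= c.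
    move=> Gu; apply: ub_le_sup; last by exists u, s.
    by exists (p (0 + v) - 0); exact: Eub.
  have c2 u s : G (u, s) -> c + s <= p (u + v).
    move=> Gu; rewrite -lerBrDr; apply: ge_sup => //; exact: Eub.
  pose G' : set (V * R) := [set x | exists r u s,
    [/\ G (u, s), x.1 = r%:C%C *: v + u & x.2 = r * c + s]].
  have GG' : G `<=` G'.
    by move=> [u s] Gu; exists 0, u, s; rewrite /= rmorph0 scale0r mul0r !add0r.
  have dG' : dominated G'.
    split.
      move=> x [r [u [s [Gu -> ->]]]]; have [/= Du us] := Gp _ Gu.
      split; first exact: DL.
      (* For nonzero [r], dividing by its absolute value and using homogeneity of [p] reduces the
         bound to [c2] when [r] is positive and to [c1] when it is negative. *)
      have [r0|r0|->] := ltrgtP r 0; last first.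
      - by rewrite rmorph0 scale0r mul0r !add0r.
      - have Gr := GZ r^-1 _ _ Gu; have [/= Dr _] := Gp _ Gr.
        have Dr' : D (r^-1%:C%C *: u + v) by have := DL 1 Dr Dv; rewrite scale1r.
        have := c2 _ _ Gr; rewrite -(ler_pM2l r0) mulrDr mulVKf ?gt_eqF//.
        have -> : r * p (r^-1%:C%C *: u + v) = p (r%:C%C *: v + u).
          rewrite -[X in X * _](ger0_norm (ltW r0)) -normc_real -pZ// scalerDr scalerA.
          by rewrite -rmorphM /= divff ?gt_eqF// scale1r addrC.
        by [].
      - pose t := - r; have t0 : 0 < t by rewrite oppr_gt0.
        have Gr := GZ t^-1 _ _ Gu; have [/= Dr _] := Gp _ Gr.
        have := c1 _ _ Gr; rewrite -(ler_pM2l t0) mulrBr mulVKf ?gt_eqF//.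
        have -> : t * p (t^-1%:C%C *: u - v) = p (r%:C%C *: v + u).
          rewrite -[X in X * _](ger0_norm (ltW t0)) -normc_real -pZ; last exact: Dm.
          rewrite scalerBr scalerA -rmorphM /= divff ?gt_eqF// scale1r addrC.
          by rewrite -scaleNr /t -rmorphN opprK.
        by rewrite /t mulNr; lra.
    move=> r x y [r1 [u1 [s1 [Gu1 -> ->]]]] [r2 [u2 [s2 [Gu2 -> ->]]]].
    exists (r * r1 + r2), (r%:C%C *: u1 + u2), (r * s1 + s2).
    split=> /=; first exact: (GL r _ _ Gu1 Gu2).
      by rewrite scalerDr scalerA addrACA -rmorphM -scalerDl -rmorphD.
    by ring.
  apply: nv; exists c; apply: (Gmax _ dG' GG').
  by exists 1, 0, 0; split => //=; rewrite ?rmorph1 ?scale1r ?mul1r ?addr0.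
(* Two values over one [u] differ by a value over [0], which domination bounds by [p 0 = 0]. *)
have uniq u s t : G (u, s) -> G (u, t) -> s = t.
  have h s' t' : G (u, s') -> G (u, t') -> t' <= s'.
    move=> h1 h2; have [/= _] := Gp _ (GL (-1) _ _ h1 h2).
    rewrite (_ : (-1)%:C%C = -1 :> R[i]); last by apply: eqc; rewrite /= ?oppr0.
    by rewrite scaleN1r addNr p0; lra.
  by move=> h1 h2; apply/le_anti; rewrite !h.
have /choice[U hU] : forall v, exists s, D v -> G (v, s).
  move=> v; have [Dv|nD] := pselect (D v); last by exists 0.
  by have [s Gs] := total v Dv; exists s.
have UL (r : R) u v : D u -> D v -> U (r%:C%C *: u + v) = r * U u + U v.
  move=> Du Dv; apply: (@uniq (r%:C%C *: u + v)); first by apply: hU; exact: DL.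
  exact: (GL r _ _ (hU _ Du) (hU _ Dv)).
have Up v : D v -> U v <= p v by move=> Dv; have [] := Gp _ (hU _ Dv).
have UM v : M v -> U v = cRe (L0 v).
  by move=> Mv; apply: (@uniq v); [exact: hU (MD Mv)|exact: G0G].
have DZ c u : D u -> D (c *: u) by move=> Du; have := DL c Du D0; rewrite addr0.
have DD u v : D u -> D v -> D (u + v) by move=> Du Dv; have := DL 1 Du Dv; rewrite scale1r.
have UD u v : D u -> D v -> U (u + v) = U u + U v.
  by move=> Du Dv; have := UL 1 _ _ Du Dv; rewrite rmorph1 scale1r mul1r.
have U0 : U 0 = 0 by have := UD _ _ D0 D0; rewrite addr0; lra.
have UZ (r : R) u : D u -> U (r%:C%C *: u) = r * U u.
  by move=> Du; have := UL r _ _ Du D0; rewrite U0 !addr0.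
pose ii : R[i] := Complex 0 1.
(* A complex-linear functional with real part [U] must be [U v - i U (i v)]. *)
pose L v := Complex (U v) (- U (ii *: v)).
have LD u v : D u -> D v -> L (u + v) = L u + L v.
  move=> Du Dv; rewrite /L scalerDr !UD//; try exact: DZ.
  by apply: eqc; rewrite ?cReD ?cImD //= opprD.
have UC (c : R[i]) u : D u -> U (c *: u) = cRe c * U u + cIm c * U (ii *: u).
  move=> Du; have cE : c = (cRe c)%:C%C + (cIm c)%:C%C * ii.
    by apply: eqc; rewrite ?cReD ?cImD ?cReM ?cImM /=; ring.
  rewrite {1}cE scalerDl UD; [|exact: DZ|exact: DZ]; rewrite UZ// -scalerA UZ//; exact: DZ.
have LZ c u : D u -> L (c *: u) = c * L u.
  move=> Du; have iiE : U (ii *: (c *: u)) = - cIm c * U u + cRe c * U (ii *: u).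
    by rewrite scalerA (UC (ii * c))// cReM cImM /=; ring.
  apply: eqc; first by rewrite cReM /= (UC c u Du); ring.
  by rewrite cImM /= iiE; ring.
exists L; split.
- by move=> c u v Du Dv; rewrite LD ?LZ//; exact: DZ.
(* Rotating [u] makes the value of [L] real and equal to its modulus, so the bound on [U]
   suffices. *)
- move=> u Du; have [a a1 aL] := normc_rot (L u).
  have -> : normc (L u) = U (a *: u).
    by have := congr1 (@complex.Re R) aL; rewrite -LZ//= => ->.
  by rewrite (le_trans (Up _ (DZ _ _ Du)))// pZ// a1 mul1r.
- move=> u Mu; have Mi : M (ii *: u) by have := ML ii Mu M0; rewrite addr0.
  have L00 : L0 0 = 0.
    have := L0p M0; rewrite p0 => h; apply/eqP; rewrite -normc_eq0.
    by rewrite eq_le h normc_ge0.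
  apply: eqc => /=; rewrite UM//.
  by have := L0L ii Mu M0; rewrite addr0 L00 addr0 => ->; rewrite cReM /=; ring.
Qed.

End hahn_banach.

(** * Uniform differentiability of the conjugate kernel *)

Section uniform_differentiability.
Variables (R : realType) (n : nat).
Implicit Types (f : Tn R n -> ('I_n -> R[i]) -> R[i]) (v h : 'I_n -> R[i]).

Local Notation maxn_norm h := (\big[Num.max/0]_(k < n) normc (h k)).

(** A form of differentiability that a functional bounded by the L^1 norm can transport: the partial
    derivatives are bounded and measurable, so the functional applies to them, and the remainder is
    small uniformly in [x], hence in L^1 norm. *)
Definition udiff f v := exists (d : 'I_n -> Tn R n -> R[i]) (B : R),
  [/\ forall u, cmeas setT (f^~ u),
      forall x, normc (f x v) <= B,
      forall k, cmeas setT (d k),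
      forall k x, normc (d k x) <= B &
      forall e : R, 0 < e -> exists2 delta : R, 0 < delta &
        forall h, (forall k, normc (h k) < delta) -> forall x,
        normc (f x (fun k => v k + h k) - f x v - \sum_(k < n) d k x * h k)
          <= e * maxn_norm h].

Lemma maxn_norm_ge0 h : 0 <= maxn_norm h.
Proof. exact: bigmax_ge_id. Qed.

Lemma le_maxn_norm h k : normc (h k) <= maxn_norm h.
Proof. exact: (le_bigmax_cond 0 (fun k => normc (h k))). Qed.

Lemma maxn_norm_lt h (c : R) : 0 < c -> (forall k, normc (h k) < c) -> maxn_norm h < c.
Proof. by move=> c0 hc; apply: bigmax_lt. Qed.

Lemma udiff1 v : udiff (fun _ _ => 1) v.
Proof.
exists (fun _ _ => 0), 1; split.
- by move=> u; exact: cmeas_cst.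
- by move=> x; rewrite Normc.normc1.
- by move=> k; exact: cmeas_cst.
- by move=> k x; rewrite Normc.normc0.
- move=> e e0; exists 1 => // h _ x; rewrite subrr sub0r big1 ?oppr0 ?Normc.normc0.
    by rewrite mulr_ge0 ?maxn_norm_ge0// ltW.
  by move=> k _; rewrite mul0r.
Qed.

Lemma normc_lin_le (d : 'I_n -> R[i]) (B : R) h : (forall k, normc (d k) <= B) ->
  normc (\sum_(k < n) d k * h k) <= n%:R * B * maxn_norm h.
Proof.
move=> dB; rewrite (le_trans (normc_sum _))//.
rewrite (@le_trans _ _ (\sum_(k < n) B * maxn_norm h))//.
  apply: ler_sum => k _; rewrite Normc.normcM ler_pM ?normc_ge0//.
  exact: le_maxn_norm.
by rewrite sumr_const card_ord -[leLHS]mulr_natl mulrA.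
Qed.

(** Product rule. With linear parts [S1], [S2] and remainders [r1], [r2], the error is
    [r1 * g + f * r2 + (S1 + r1) * (S2 + r2)], whose last term is quadratic in the increment. *)
Lemma udiffM f g v : udiff f v -> udiff g v -> udiff (fun x u => f x u * g x u) v.
Proof.
move=> [d1 [B1 [mf fB md1 d1B hf]]] [d2 [B2 [mg gB md2 d2B hg]]].
exists (fun k x => d1 k x * g x v + f x v * d2 k x), (`|B1| * `|B2| + `|B1| * `|B2|).
have le_abs (a b : R) : a <= b -> a <= `|b| by move=> ab; rewrite (le_trans ab)// ler_norm.
have fB' x := le_abs _ _ (fB x); have gB' x := le_abs _ _ (gB x).
have d1B' k x := le_abs _ _ (d1B k x); have d2B' k x := le_abs _ _ (d2B k x).
split.
- by move=> u; exact: cmeasM.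
- move=> x; rewrite Normc.normcM (le_trans (ler_pM _ _ (fB' x) (gB' x))) ?normc_ge0//.
  by rewrite lerDl mulr_ge0.
- by move=> k; apply: cmeasD; exact: cmeasM.
- move=> k x; rewrite (le_trans (le_normcD _ _))// !Normc.normcM.
  by rewrite lerD// ler_pM ?normc_ge0.
move=> e e0.
pose K1 := `|B1| + `|B2| + 1; have K10 : 0 < K1 by rewrite ltr_wpDl// addr_ge0.
pose N1 := n%:R * `|B1| + 1; pose N2 := n%:R * `|B2| + 1.
have N10 : 0 < N1 by rewrite ltr_wpDl// mulr_ge0.
have N20 : 0 < N2 by rewrite ltr_wpDl// mulr_ge0.
(* The bound by 1 gives each increment [S + r] size at most [N1] or [N2] times the norm of [h]. The
   other bound gives half of [e] to the two linear error terms; [a3] gives the other half to the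
   quadratic one. *)
pose e' := Num.min 1 (e / 2 / K1).
have e'0 : 0 < e' by rewrite lt_min ltr01 !divr_gt0.
have e'1 : e' <= 1 by rewrite ge_min lexx.
have e'2 : e' <= e / 2 / K1 by rewrite ge_min lexx orbT.
have [a1 a10 h1] := hf _ e'0; have [a2 a20 h2] := hg _ e'0.
pose a3 := e / 2 / (N1 * N2); have a30 : 0 < a3 by rewrite !divr_gt0// mulr_gt0.
exists (Num.min a3 (Num.min a1 a2)); first by rewrite !lt_min a30 a10.
move=> h hh x.
have ha1 k : normc (h k) < a1 by have := hh k; rewrite !lt_min => /and3P[].
have ha2 k : normc (h k) < a2 by have := hh k; rewrite !lt_min => /and3P[].
have Ha3 : maxn_norm h < a3.
  by apply: maxn_norm_lt => // k; have := hh k; rewrite !lt_min => /and3P[].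
have {}h1 := h1 h ha1 x; have {}h2 := h2 h ha2 x.
have H0 := maxn_norm_ge0 h.
have D1 := normc_lin_le h (fun k => d1B' k x).
have D2 := normc_lin_le h (fun k => d2B' k x).
move: h1 h2 D1 D2 Ha3 H0; set H := maxn_norm h.
set F' := f x (fun k => v k + h k); set G' := g x (fun k => v k + h k).
set S1 := \sum_(k < n) d1 k x * h k; set S2 := \sum_(k < n) d2 k x * h k.
have -> : \sum_(k < n) (d1 k x * g x v + f x v * d2 k x) * h k = S1 * g x v + f x v * S2.
  rewrite /S1 /S2 mulr_suml mulr_sumr -big_split; apply: eq_bigr => k _ /=; ring.
set r1 := F' - f x v - S1; set r2 := G' - g x v - S2 => h1 h2 D1 D2 Ha3 H0.
have -> : F' * G' - f x v * g x v - (S1 * g x v + f x v * S2) =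
   r1 * g x v + f x v * r2 + (S1 + r1) * (S2 + r2) by rewrite /r1 /r2; ring.
have sr1 : normc (S1 + r1) <= N1 * H.
  rewrite (le_trans (le_normcD _ _))// /N1 mulrDl mul1r lerD//.
  by rewrite (le_trans h1)// ler_piMl.
have sr2 : normc (S2 + r2) <= N2 * H.
  rewrite (le_trans (le_normcD _ _))// /N2 mulrDl mul1r lerD//.
  by rewrite (le_trans h2)// ler_piMl.
have t1 : normc (r1 * g x v) <= e' * H * `|B2|.
  by rewrite Normc.normcM ler_pM ?normc_ge0.
have t2 : normc (f x v * r2) <= `|B1| * (e' * H).
  by rewrite Normc.normcM ler_pM ?normc_ge0.
have t3 : normc ((S1 + r1) * (S2 + r2)) <= e / 2 * H.
  rewrite Normc.normcM (le_trans (ler_pM _ _ sr1 sr2)) ?normc_ge0//.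
  have -> : N1 * H * (N2 * H) = N1 * N2 * H * H by ring.
  by rewrite ler_wpM2r// mulrC -ler_pdivlMr ?mulr_gt0// ltW.
have t4 : e' * H * `|B2| + `|B1| * (e' * H) <= e / 2 * H.
  have -> : e' * H * `|B2| + `|B1| * (e' * H) = e' * (`|B1| + `|B2|) * H by ring.
  rewrite ler_wpM2r// (@le_trans _ _ (e' * K1))//.
    by rewrite ler_wpM2l ?(ltW e'0)// /K1 lerDl.
  by rewrite -ler_pdivlMr.
have eH : e * H = e / 2 * H + e / 2 * H by rewrite -mulrDl -splitr.
rewrite eH (le_trans (le_normcD _ _))// lerD//.
by rewrite (le_trans (le_normcD _ _))// (le_trans _ t4)// lerD.
Qed.

(** Conjugating the factor makes it [(1 - u i * c x)^-1], holomorphic in [u]. The second-order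
    remainder is explicit, and [c x] has modulus one, so all bounds are independent of [x]. *)
Lemma udiff_factor i v : polydisc v ->
  udiff (fun x u => conjc (sfac i (u i) x)) v.
Proof.
move=> v1; pose c (x : Tn R n) := conjc (torus_pt x i).
have sE (x : Tn R n) (b : R[i]) : conjc (sfac i b x) = (1 - b * c x)^-1.
  by rewrite /sfac conjc_inv rmorphB rmorph1 rmorphM /= conjcK mulrC.
have c1 x : normc (c x) = 1 by rewrite normc_conj normc_torus_pt.
have mc : cmeas setT c by apply: cmeasJ; exact: cmeas_torus_pt.
pose m0 := 1 - normc (v i); have m00 : 0 < m0 by rewrite subr_gt0 v1.
have lb x : m0 <= normc (1 - v i * c x).
  by apply: le_trans (normc_triB _ _); rewrite Normc.normc1 Normc.normcM c1 mulr1.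
have ms (u : 'I_n -> R[i]) : cmeas setT (fun x => (1 - u i * c x)^-1).
  apply: cmeasV; apply: cmeasB; first exact: cmeas_cst.
  by apply: cmeasM => //; exact: cmeas_cst.
have ubi x : normc (1 - v i * c x)^-1 <= m0^-1.
  by rewrite Normc.normcV lef_pV2 ?posrE// (lt_le_trans m00).
have im0 : 0 <= m0^-1 by rewrite invr_ge0 ltW.
exists (fun k x => if k == i then c x * (1 - v i * c x)^-1 * (1 - v i * c x)^-1 else 0),
  (m0^-1 + m0^-1 * m0^-1); split.
- by move=> u; under eq_fun do rewrite sE; exact: ms.
- by move=> x; rewrite sE (le_trans (ubi x))// lerDl mulr_ge0.
- move=> k; case: eqP => _; last exact: cmeas_cst.
  by apply: cmeasM => //; exact: cmeasM.
- move=> k x; case: eqP => _; last by rewrite Normc.normc0 addr_ge0 ?mulr_ge0.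
  rewrite !Normc.normcM c1 mul1r (le_trans (ler_pM _ _ (ubi x) (ubi x))) ?normc_ge0//.
  by rewrite lerDr.
(* The first bound keeps the shifted denominator at least [m0 / 2]; the second makes [2 / m0 ^+ 3]
   times the squared increment at most [e] times the increment. *)
move=> e e0; exists (Num.min (m0 / 2) (e * m0 ^+ 3 / 2)).
  by rewrite lt_min !divr_gt0// mulr_gt0// exprn_gt0.
move=> h hh x; rewrite !sE (bigD1 i)//= eqxx big1 ?addr0; last first.
  by move=> k /negbTE ->; rewrite mul0r.
have := hh i; rewrite lt_min => /andP[h1 h2].
have lb2 : m0 / 2 <= normc (1 - (v i + h i) * c x).
  have := normc_triB (1 - v i * c x) (h i * c x).
  rewrite Normc.normcM c1 mulr1.
  have -> : 1 - v i * c x - h i * c x = 1 - (v i + h i) * c x by ring.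
  by have := lb x; move: h1; lra.
have n1 : 1 - v i * c x != 0 by rewrite -normc_eq0 gt_eqF// (lt_le_trans m00).
have n2 : 1 - (v i + h i) * c x != 0.
  by rewrite -normc_eq0 gt_eqF// (lt_le_trans _ lb2)// divr_gt0.
rewrite [X in normc X](_ : _ =
   h i * h i * (c x * c x) * ((1 - v i * c x)^-1 * (1 - v i * c x)^-1) * (1 - (v i + h i) * c x)^-1); last first.
  by field; rewrite n1 n2.
have ub2 : normc (1 - (v i + h i) * c x)^-1 <= 2 / m0.
  rewrite Normc.normcV -[leRHS]invrK invf_div lef_pV2 ?posrE ?divr_gt0//.
  by rewrite (lt_le_trans _ lb2)// divr_gt0.
rewrite (@le_trans _ _ (e * normc (h i)))//; last first.
  by rewrite ler_wpM2l ?(ltW e0)// le_maxn_norm.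
rewrite !Normc.normcM c1 !mulr1.
rewrite (@le_trans _ _ (normc (h i) * normc (h i) * (m0^-1 * m0^-1) * (2 / m0)))//.
  rewrite ler_pM ?mulr_ge0 ?normc_ge0//.
  by rewrite ler_wpM2l ?mulr_ge0 ?normc_ge0// ler_pM ?normc_ge0.
have -> : normc (h i) * normc (h i) * (m0^-1 * m0^-1) * (2 / m0) =
   (normc (h i) / (m0 ^+ 3 / 2)) * normc (h i) by field; rewrite gt_eqF.
rewrite ler_wpM2r ?normc_ge0// ler_pdivrMr ?divr_gt0 ?exprn_gt0// ltW//.
by rewrite mulrA.
Qed.

Lemma udiff_szego v : polydisc v ->
  udiff (fun x u => conjc (szego (torus_pt x) u)) v.
Proof.
move=> v1.
have -> : (fun x u => conjc (szego (@torus_pt R n x) u)) =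
    (fun x u => \prod_i conjc (sfac i (u i) x)).
  by apply/funext => x; apply/funext => u; rewrite szego_sfac rmorph_prod.
rewrite /index_enum; elim: (Finite.enum _) => [|i s IH].
  rewrite (_ : (fun x u => _) = (fun _ _ => 1)); first exact: udiff1.
  by apply/funext => x; apply/funext => u; rewrite big_nil.
rewrite (_ : (fun x u => _) = (fun x u =>
  conjc (sfac i (u i) x) * \prod_(i <- s) conjc (sfac i (u i) x))).
  by apply: udiffM => //; exact: udiff_factor.
by apply/funext => x; apply/funext => u; rewrite big_cons.
Qed.

End uniform_differentiability.

(** * Contractivity implies interpolation *)

Section poisson.
Variables (R : realType) (n : nat) (v : 'I_n -> R[i]).
Local Notation mu := (torus_mu R n).
Hypothesis v1 : polydisc v.

Let S (x : Tn R n) := szego (torus_pt x) v.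

(** The product over [k] of the one-variable kernels with numerator [1 - normc (v k) ^+ 2]. Written
    through [szego], it falls under the reproducing identities; [poissonE] gives the real form. *)
Definition poisson (x : Tn R n) : R[i] :=
  (szego v v)^-1 * (szego (torus_pt x) v * conjc (szego (torus_pt x) v)).

Definition poisson_real (x : Tn R n) : R :=
  (\prod_k (1 - normc (v k) ^+ 2)) * normc (szego (torus_pt x) v) ^+ 2.

Lemma poissonE x : poisson x = (poisson_real x)%:C%C.
Proof.
rewrite /poisson /poisson_real rmorphM -normc_ReIm; congr (_ * _).
rewrite /szego prodfV invrK rmorph_prod; apply: eq_bigr => k _.
by rewrite -normc_ReIm rmorphB rmorph1.
Qed.

Lemma poisson_real_ge0 x : 0 <= poisson_real x.
Proof.
rewrite mulr_ge0 ?sqr_ge0// prodr_ge0// => k _.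
by rewrite subr_ge0 expr_le1 ?normc_ge0// ltW.
Qed.

Lemma szego_diag_neq0 : szego v v != 0.
Proof.
apply/prodf_neq0 => k _; rewrite invr_neq0// szego1_neq0//; exact: ltW.
Qed.

Let bS : bounded_meas S. Proof. exact: bm_szego. Qed.

Lemma bm_poisson : bounded_meas poisson.
Proof. by apply: bmM; [exact: bm_cst|apply: bmM => //; exact: bmJ]. Qed.

(** The integral is the value at [v] of [S * F] divided by [szego v v], and [szego_eval_szego] makes
    that value multiplicative. *)
Lemma cint_poisson F : H2 F -> cint (fun x => F x * poisson x) = szego_eval v F.
Proof.
move=> hF; have aF := H2_analytic hF.
have SFi : cintegrable mu setT (fun x => S x * F x).
  by apply: cintegrable_bmM => //; apply: L2_cintegrable; case: hF.
rewrite -[RHS](mulVKf szego_diag_neq0) [X in _ * X]mulrC.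
transitivity ((szego v v)^-1 * szego_eval v (fun x => S x * F x)).
  rewrite /szego_eval !cintE -cintegralZ//; last exact: szego_eval_integrable.
  by apply: eq_cintegral => x _; rewrite /poisson /S; ring.
by rewrite szego_eval_szego//; field; exact: szego_diag_neq0.
Qed.

Lemma L1_poisson : \int[mu]_x normc (poisson x) = 1.
Proof.
have E := cint_poisson (@H2_1 R n); rewrite szego_eval1// in E.
move/(congr1 (@complex.Re R)): E => /= <-; apply: eq_Rintegral => x _.
by rewrite mul1r poissonE normc_real ger0_norm ?poisson_real_ge0.
Qed.

(** The mixed part of the Poisson kernel, whose analytic and conjugate analytic parts have been
    removed; the constant, removed twice, is restored. It vanishes identically in one variable. *)
Let g x := poisson x - S x - conjc (S x) + 1.

Let bg : bounded_meas g.
Proof.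
have N f : bounded_meas f -> bounded_meas (fun x : Tn R n => - f x).
  by move=> bf; under eq_fun do rewrite -mulN1r; apply: bmM => //; exact: bm_cst.
apply: bmD; last exact: bm_cst.
by apply: bmD; [apply: bmD; [exact: bm_poisson|exact: N]|apply: N; exact: bmJ].
Qed.

(** In terms of the analytic extension of [F] the four summands give [F(v) - F(0) - F(v) + F(0)]. *)
Let g_orth F : H2 F -> cint (fun x => F x * g x) = 0.
Proof.
move=> hF; have Fi : cintegrable mu setT F by apply: L2_cintegrable; case: hF.
have i1 : cintegrable mu setT (fun x => F x * poisson x).
  by under eq_fun do rewrite mulrC; apply: cintegrable_bmM => //; exact: bm_poisson.
have i2 : cintegrable mu setT (fun x => S x * F x) by exact: cintegrable_bmM.
have i3 := szego_eval_integrable v1 Fi.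
transitivity (cint (fun x => F x * poisson x) - cint (fun x => S x * F x)
   - szego_eval v F + cint F).
  rewrite /szego_eval !cintE -cintegralB// -cintegralB//; last exact: cintegrableB.
  rewrite -cintegralD//; last by apply: cintegrableB => //; exact: cintegrableB.
  by apply: eq_cintegral => x _; rewrite /g /S; ring.
rewrite cint_poisson// cint_szego//; last exact: H2_analytic.
by ring.
Qed.

Lemma MQ_poisson m (z : 'I_m -> 'I_n -> R[i]) :
  MQ z (fun x => poisson x - conjc (szego (torus_pt x) v)).
Proof.
(* No kernel at the nodes is used: the difference is [g], in [Mn], plus [S x - 1], which vanishes at
   the origin. Hence it lies in [MQ z] whatever the nodes. *)
exists (fun=> 0), g, (fun x => S x - 1); split.
- split; first exact: bm_L2.
  move=> G H hG hH.
  (* As [g] is real, orthogonality to [H2] also gives orthogonality to its conjugates. *)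
  have gJ x : conjc (g x) = g x.
    rewrite /g rmorphD !rmorphB rmorph1 /= conjcK poissonE conjc_real.
    by rewrite -!addrA; congr (_ + _); rewrite addrCA.
  have Li F : H2 F -> cintegrable mu setT (fun x => F x * g x).
    move=> hF; under eq_fun do rewrite mulrC; apply: cintegrable_bmM => //.
    by apply: L2_cintegrable; case: hF.
  transitivity (cint (fun x => G x * g x) + conjc (cint (fun x => H x * g x))).
    rewrite !cintE -cintegralJ//; last exact: Li.
    rewrite -cintegralD//; [|exact: Li|by apply: cintegrableJ => //; exact: Li].
    apply: eq_cintegral => x _; rewrite rmorphD rmorphM /= conjcK gJ; ring.
  by rewrite !g_orth// conjc0 addr0.
- have hS : H2 (fun x => S x - 1).
    by apply: H2D; [exact: H2_szego|have := H2Z (-1) (@H2_1 R n); under eq_fun do rewrite mulr1].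
  split => //; rewrite /fourier_coef /inner.
  transitivity (cint S - cint (fun _ : Tn R n => 1)).
    rewrite !cintE -cintegralB//; [|exact: bounded_cintegrable|].
      by apply: eq_cintegral => x _; rewrite character0 conjc1 mulr1.
    by apply: bounded_cintegrable; exact: bm_cst.
  rewrite (_ : cint S = cint (fun x => S x * 1)); last first.
    by apply: eq_cintegral => x _; rewrite mulr1.
  by rewrite cint_szego ?subrr//; exact: analytic1.
- move=> x; rewrite big1 => [|i _]; last by rewrite mul0r.
  by rewrite conjc0 /g /S; ring.
Qed.

End poisson.

(** * Linear structure of the test space *)

Section subspaces.
Variables (R : realType) (n m : nat) (z : 'I_m -> 'I_n -> R[i]).
Local Notation mu := (torus_mu R n).

Lemma Mn_linear c (f g : Tn R n -> R[i]) : Mn f -> Mn g ->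
  Mn (fun x => c * f x + g x).
Proof.
move=> [Lf hf] [Lg hg]; split; first by apply: L2D => //; exact: L2Z.
move=> G H hG hH.
have LGH : L2 (fun x => conjc (conjc (G x) + H x)).
  apply: L2J; apply: L2D; last by case: hH.
  by apply: L2J; case: hG.
rewrite -[RHS](addr0 0) -[X in X + _](mulr0 c) -{1}(hf G H hG hH) -(hg G H hG hH).
rewrite /inner !cintE -cintegralZ//; last exact: L2_mul.
rewrite -cintegralD//; [|by apply: cintegrableZ => //; exact: L2_mul|exact: L2_mul].
by apply: eq_cintegral => x _; rewrite mulrDl mulrA.
Qed.

Lemma H2_0_linear c (f g : Tn R n -> R[i]) : H2_0 f -> H2_0 g ->
  H2_0 (fun x => c * f x + g x).
Proof.
move=> [hf f0] [hg g0]; split; first by apply: H2D => //; exact: H2Z.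
have Lf : L2 f by case: hf.
have Lg : L2 g by case: hg.
have Lc : L2 (fun x : Tn R n => conjc (character (fun=> 0) x)).
  by apply: bm_L2; apply: bmJ; exact: bm_character.
rewrite -[RHS](addr0 0) -[X in X + _](mulr0 c) -{1}f0 -g0.
rewrite /fourier_coef /inner !cintE -cintegralZ//; last exact: L2_mul.
rewrite -cintegralD//; [|by apply: cintegrableZ => //; exact: L2_mul|exact: L2_mul].
by apply: eq_cintegral => x _; rewrite mulrDl mulrA.
Qed.

Lemma Mn_0 : Mn (fun _ : Tn R n => 0 : R[i]).
Proof.
split; first exact: L2_cst.
move=> G H _ _; rewrite /inner -[RHS](@cintegral0 _ _ _ mu setT).
by apply: eq_cintegral => x _; rewrite mul0r.
Qed.

Lemma H2_0_0 : H2_0 (fun _ : Tn R n => 0 : R[i]).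
Proof.
split; first exact: H2_zero.
rewrite /fourier_coef /inner -[RHS](@cintegral0 _ _ _ mu setT).
by apply: eq_cintegral => x _; rewrite mul0r.
Qed.

Lemma MQ_linear c (f g : Tn R n -> R[i]) : MQ z f -> MQ z g ->
  MQ z (fun x => c * f x + g x).
Proof.
move=> [a [g1 [h1 [M1 H1 E1]]]] [b [g2 [h2 [M2 H2' E2]]]].
(* The coefficients sit under a conjugation in [MQ], whence [conjc c]. *)
exists (fun i => conjc c * a i + b i), (fun x => c * g1 x + g2 x), (fun x => c * h1 x + h2 x).
split; [exact: Mn_linear|exact: H2_0_linear|move=> x].
rewrite E1 E2; have -> : \sum_(i < m) (conjc c * a i + b i) * szego (torus_pt x) (z i) =
   conjc c * (\sum_(i < m) a i * szego (torus_pt x) (z i)) +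
   \sum_(i < m) b i * szego (torus_pt x) (z i).
  by rewrite mulr_sumr -big_split; apply: eq_bigr => i _ /=; ring.
by rewrite rmorphD rmorphM /= conjcK; ring.
Qed.

Lemma MQ_0 : MQ z (fun _ : Tn R n => 0).
Proof.
exists (fun=> 0), (fun=> 0), (fun=> 0); split; [exact: Mn_0|exact: H2_0_0|move=> x].
by rewrite big1 ?conjc0 ?addr0// => i _; rewrite mul0r.
Qed.

Lemma MQ_szego i : MQ z (fun x => conjc (szego (torus_pt x) (z i))).
Proof.
exists (fun j => (j == i)%:R), (fun=> 0), (fun=> 0).
split; [exact: Mn_0|exact: H2_0_0|move=> x]; rewrite !addr0; congr conjc.
by rewrite (bigD1 i)//= eqxx mul1r big1 ?addr0// => j /negbTE ->; rewrite mul0r.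
Qed.

End subspaces.

Section backward.
Variables (R : realType) (n m : nat) (z : 'I_m -> 'I_n -> R[i]) (w : 'I_m -> R[i]).
Local Notation mu := (torus_mu R n).
Local Notation V := (Tn R n -> R[i]).
Hypotheses (zinj : injective z) (z1 : forall i, polydisc (z i)).

Lemma contraction_interpolation :
  contraction_on (MQ z) (fun f => cint (fun x => psiZW z w x * f x)) ->
  exists phi : ('I_n -> R[i]) -> R[i], schur_class phi /\ forall i, phi (z i) = w i.
Proof.
move=> contr; have bpsi := bm_psi z1 w.
have psi_i (f : V) : L2 f -> cintegrable mu setT (fun x => psiZW z w x * f x).
  by move=> Lf; apply: cintegrable_bmM => //; exact: L2_cintegrable.
(* The ambient space is that of all functions on the torus; restricting to [L2] makes the
   real-valued L^1 integral a seminorm. *)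
have [|||||||||L [LL Lp LM]] := @complex_hahn_banach R V (@L2 R n) (MQ z)
   (fun f => \int[mu]_x normc (f x)) (fun f => cint (fun x => psiZW z w x * f x)).
- exact: L2_cst.
- by move=> c f g Lf Lg; apply: L2D => //; exact: L2Z.
- move=> f g Lf Lg; have fi := L2_cintegrable Lf; have gi := L2_cintegrable Lg.
  rewrite -RintegralD//; [|exact: cintegrable_normc|exact: cintegrable_normc].
  apply: le_Rintegral => //.
  + by apply: cintegrable_normc => //; exact: cintegrableD.
  + have := integrableD measurableT (cintegrable_normc measurableT fi)
      (cintegrable_normc measurableT gi); exact: eq_integrable.
  + by move=> x _; exact: le_normcD.
- move=> c f Lf; have fi := L2_cintegrable Lf.
  rewrite -RintegralZl//; last exact: cintegrable_normc.
  by apply: eq_Rintegral => x _; rewrite Normc.normcM.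
- exact: MQ_0.
- by move=> c f g; exact: MQ_linear.
- by move=> f; exact: MQ_L2.
- move=> c f g Mf Mg; have Lf := MQ_L2 z1 Mf; have Lg := MQ_L2 z1 Mg.
  rewrite !cintE -cintegralZ//; last exact: psi_i.
  rewrite -cintegralD//; [|by apply: cintegrableZ => //; exact: psi_i|exact: psi_i].
  by apply: eq_cintegral => x _; rewrite mulrDr mulrCA.
- move=> f Mf; rewrite -lee_fin -L1normE; last by apply: L2_cintegrable; exact: MQ_L2 Mf.
  exact: contr.
have LD (f g : V) : L2 f -> L2 g -> L (fun x => f x + g x) = L f + L g.
  move=> Lf Lg; have := LL 1 f g Lf Lg; rewrite mul1r => <-; congr L.
  by rewrite scale1r.
have L0 : L (fun=> 0) = 0.
  have := LD _ _ (L2_cst n 0) (L2_cst n 0); rewrite addr0 => /esym/eqP.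
  by rewrite -subr_eq0 addrK => /eqP.
have LZ (c : R[i]) (f : V) : L2 f -> L (fun x => c * f x) = c * L f.
  move=> Lf; have := LL c f _ Lf (L2_cst n 0); rewrite L0 [RHS]addr0 => <-; congr L.
  by apply/funext => x /=; rewrite [RHS]addr0.
pose cS v : V := fun x => conjc (szego (torus_pt x) v).
have LcS v : polydisc v -> L2 (cS v).
  by move=> v1; apply: bm_L2; apply: bmJ; exact: bm_szego.
exists (fun v => L (cS v)); split; last first.
  by move=> i; rewrite LM; [exact: szego_eval_psi|exact: MQ_szego].
split; last first.
  move=> v v1.
  have MP := MQ_poisson v1 z.
  have LP : L2 (@poisson R n v) by apply: bm_L2; exact: bm_poisson.
  have -> : L (cS v) = L (@poisson R n v).
    have -> : poisson v = (fun x => cS v x + (poisson v x - cS v x)).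
      by apply/funext => x; rewrite addrC subrK.
    rewrite LD//; [|exact: LcS|exact: MQ_L2 MP].
    rewrite (LM _ MP).
    (* The Poisson kernel and the conjugate kernel both evaluate the analytic function [psiZW] at
       [v]. *)
    rewrite (_ : cint _ = szego_eval v (psiZW z w) - szego_eval v (psiZW z w)).
      by rewrite subrr addr0.
    rewrite -{1}cint_poisson//; last exact: H2_psi.
    rewrite /szego_eval !cintE -cintegralB//.
    - by apply: eq_cintegral => x _; rewrite mulrBr.
    - exact: psi_i.
    - by apply: psi_i; exact: LcS.
  by rewrite (le_trans (Lp _ LP))// L1_poisson.
move=> v v1; have [d [B [mf fB md dB hd]]] := udiff_szego v1.
have bd k : bounded_meas (d k) by split => //; exists B.
exists (fun k => L (d k)) => e e0; have [dl d0 h] := hd e e0.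
(* The derivative in coordinate [k] is [L (d k)]. By linearity the error is [L r], and the uniform
   bound on [r] bounds its L^1 norm, the torus having mass one. *)
exists dl => // t ht.
pose r x := cS (fun k => v k + t k) x - cS v x - \sum_(k < n) d k x * t k.
have br : bounded_meas r.
  split; last by exists (e * \big[Num.max/0]_(k < n) normc (t k)) => x; exact: h.
  apply: cmeasB; first by apply: cmeasB; exact: mf.
  by apply: cmeas_sum => k; apply: cmeasM => //; exact: cmeas_cst.
have sumL : L2 (fun x => \sum_(k < n) d k x * t k) /\
    L (fun x => \sum_(k < n) d k x * t k) = \sum_(k < n) L (d k) * t k.
  rewrite /index_enum; elim: (Finite.enum _) => [|k s [IH1 IH2]].
    rewrite big_nil; under eq_fun do rewrite big_nil.
    by split; [exact: L2_cst|exact: L0].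
  rewrite big_cons; under eq_fun do rewrite big_cons.
  have Lk : L2 (fun x => d k x * t k).
    by under eq_fun do rewrite mulrC; apply: L2Z; exact: bm_L2.
  split; first exact: L2D.
  rewrite LD// IH2; congr (_ + _).
  rewrite [RHS]mulrC -LZ; last exact: bm_L2.
  by congr L; apply/funext => x; rewrite mulrC.
case: sumL => sum2 sumE.
have -> : L (cS (fun k => v k + t k)) - L (cS v) - \sum_(k < n) L (d k) * t k = L r.
  have -> : cS (fun k => v k + t k) =
      (fun x => (r x + cS v x) + \sum_(k < n) d k x * t k).
    by apply/funext => x; rewrite /r; ring.
  have Lr := bm_L2 br; have LS := LcS _ v1.
  rewrite (LD (fun x => r x + cS v x))//; last exact: L2D.
  by rewrite (LD r)// sumE; ring.
rewrite (le_trans (Lp _ (bm_L2 br)))//.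
rewrite -[leRHS](_ : \int[mu]_x (e * \big[Num.max/0]_(k < n) normc (t k)) = _).
  apply: le_Rintegral => //.
  - by apply: cintegrable_normc => //; exact: bounded_cintegrable.
  - by apply: integrable_cst_lty => //; exact: torus_mu_lty.
  - by move=> x _; exact: h.
rewrite Rintegral_cst// (_ : fine _ = 1) ?mulr1//.
by transitivity (fine (mu setT)); rewrite // probability_setT.
Qed.

End backward.

Theorem theorem6p6 (R : realType) (n m : nat) (hn : (1 <= n)%N)
  (z : 'I_m -> 'I_n -> R[i]) (w : 'I_m -> R[i]) :
  injective z -> (forall i, polydisc (z i)) -> (forall i, normc (w i) < 1) ->
  (exists phi : ('I_n -> R[i]) -> R[i], schur_class phi /\ forall i, phi (z i) = w i) <->
  contraction_on (MQ z) (fun f => cint (fun x => psiZW z w x * f x)).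
Proof.
move=> zinj z1 _; split; last exact: contraction_interpolation.
by move=> [phi [phiS phiw]]; exact: interpolation_contraction phiS phiw.
Qed.
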